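(* Let $G$ be a Borel graph of finite maximum degree $\Delta\geq 3$ that does not contain a clique on $\Delta+1$ vertices. If $\mu$ is an atomless $G$-invariant probability measure on $V(G)$ such that $d_\mu(G)\leq \Delta/5$, then $G$ has a $\mu$-equitable $\Delta$-coloring.
   Context: A Borel graph is a simple undirected graph whose vertex set is a standard Borel space and whose edge set is Borel. For Borel $A,B\subseteq V(G)$, $A\approx_G B$ means there is a Borel bijection $\phi\colon A\to B$ with $\phi(x)$ in the same connected component of $G$ as $x$. A probability measure $\mu$ on $V(G)$ is $G$-invariant if $\mu(A)=\mu(B)$ whenever $A\approx_G B$; atomless means $\mu(\{x\})=0$ for all $x$. The $\mu$-average degree is $d_\mu(G)=\int_{V(G)}\deg_G(x)\,d\mu(x)$. A $\mu$-equitable $k$-coloring is a proper coloring $f\colon V(G)\to\mathcal{C}$ with $|\mathcal{C}|=k$, all of whose color classes are $\mu$-measurable, such that $\mu(f^{-1}(\alpha))=1/k$ for every $\alpha\in\mathcal{C}$. *)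

(* Defs.v *)
From mathcomp Require Import all_boot all_algebra.
From mathcomp Require Import all_classical all_reals all_analysis.
From mathcomp Require Import finmap.
Import GRing.Theory Num.Theory.
Set Implicit Arguments.
Unset Strict Implicit.
Unset Printing Implicit Defensive.
Local Open Scope classical_set_scope.
Local Open Scope ring_scope.

Section BorelGraphs.
Context {d : measure_display} {V : measurableType d} {R : realType}.

(* V is a standard Borel space: Borel-isomorphic to a Borel subset of the
   reals (Kuratowski: this is equivalent to being the Borel space of a
   Polish space). The sigma-algebra on R is the canonical Borel one. *)
Definition standard_borel : Prop :=
  exists (f : V -> R) (B : set R),
    measurable B /\ measurable_fun setT f /\ injective f /\ range f = B /\
    (forall A : set V, measurable A -> measurable (f @` A)).

Definition borel_graph (adj : V -> V -> Prop) : Prop :=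
  (forall x y, adj x y -> adj y x) /\ (forall x, ~ adj x x) /\
  measurable [set p : V * V | adj p.1 p.2].

Definition nbhd (adj : V -> V -> Prop) (x : V) : set V := [set y | adj x y].

(* degree (meaningful when the neighbourhood is finite) *)
Definition deg (adj : V -> V -> Prop) (x : V) : nat :=
  #|` fset_set (nbhd adj x)|.

Definition max_degree (adj : V -> V -> Prop) (Delta : nat) : Prop :=
  (forall x, finite_set (nbhd adj x) /\ (deg adj x <= Delta)%N) /\
  exists x, deg adj x = Delta.

Definition has_clique (adj : V -> V -> Prop) (n : nat) : Prop :=
  exists s : seq V, uniq s /\ size s = n /\
    forall x y, x \in s -> y \in s -> x != y -> adj x y.

Definition same_component (adj : V -> V -> Prop) (x y : V) : Prop :=
  exists (n : nat) (p : nat -> V),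
    p 0%N = x /\ p n = y /\ forall i, (i < n)%N -> adj (p i) (p i.+1).

Definition borel_equiv (adj : V -> V -> Prop) (A B : set V) : Prop :=
  exists phi : V -> V,
    measurable_fun A phi /\ set_bij A B phi /\
    forall x, A x -> same_component adj x (phi x).

Definition invariant_measure (adj : V -> V -> Prop)
    (mu : set V -> \bar R) : Prop :=
  forall A B : set V, measurable A -> measurable B ->
    borel_equiv adj A B -> mu A = mu B.

Definition atomless (mu : set V -> \bar R) : Prop :=
  forall x : V, mu [set x] = 0%E.

Definition avg_degree (adj : V -> V -> Prop) (mu : {measure set V -> \bar R})
  : \bar R := (\int[mu]_x ((deg adj x)%:R)%:E)%E.

(* A is mu-measurable (in the completion of mu) with completed measure r *)
Definition mu_measurable_with (mu : set V -> \bar R) (A : set V) (r : \bar R)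
  : Prop :=
  exists B C : set V, measurable B /\ measurable C /\
    B `<=` A /\ A `<=` C /\ mu (C `\` B) = 0%E /\ mu B = r.

Definition equitable_coloring (adj : V -> V -> Prop) (mu : set V -> \bar R)
    (k : nat) (f : V -> 'I_k) : Prop :=
  (forall x y, adj x y -> f x != f y) /\
  forall a : 'I_k, mu_measurable_with mu (f @^-1` [set a]) (k%:R^-1)%:E.

End BorelGraphs.

(* Main.v *)
Require Import Defs.
From mathcomp Require Import finmap.
From mathcomp Require Import all_boot all_order all_algebra.
From mathcomp Require Import all_classical all_reals all_analysis.
From mathcomp Require Import measurable_realfun.
From mathcomp Require Import ring lra zify.
Import Order.TTheory GRing.Theory Num.Theory.
Import numFieldNormedType.Exports.
Set Implicit Arguments.
Unset Strict Implicit.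
Unset Printing Implicit Defensive.
Local Open Scope classical_set_scope.
Local Open Scope ring_scope.

(** Colourings may leave points uncoloured (value [None]) and are compared by the measure
    of the set where they differ.

    A proper colouring of almost everything exists: an uncoloured point can be moved along
    a path, and if no short path helps ("stuck"), then, as for Gallai trees, short cycles
    near it are odd or have chords and the ball around it grows exponentially; so the stuck
    points have exponentially small measure, and the successive repairs change summable
    amounts.

    Among these colourings Ekeland's principle yields one at which no local recolouring
    lowers the total excess of the colour classes over 1/Delta at a linear rate. Recolouring
    a separated set of positive measure of copies of the same pattern transfers mass between
    colours at such a rate. If the excess is positive, let S be the set of colours reachable
    from an overfull one by transfers and W an underfull colour. Every point of colour in S
    then sees every colour outside S, and most such points see W exactly once. Three mass
    transport estimates give an average degree greater than Delta/5: the first two force S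
    to contain more than 7/8 of the colours; in the last one, the neighbours of a W-point w
    whose only W-neighbour is w form a clique, hence have large degree when w has
    many of them. *)

(** * Analytic sets and Lusin-Novikov selection *)

(** Vertices carry only a Borel structure, so measurable recolouring needs a Borel enumeration of
    neighbours; this is the Lusin-Novikov theorem, which rests on the separation of analytic sets.

    Measurable colourings form a complete but not compact space, so neither the uncoloured mass nor
    the excess need attain its infimum. Ekeland's principle replaces a minimiser: a local pattern
    with a linear gain can only have a null set of sites. Patterns are countable in number, so all
    bad sites lie in one null set, and uncolouring the components that it meets makes the local
    conditions hold pointwise. These null components are coloured at the end by a non-measurable
    Brooks colouring, which is harmless since colour classes need only be measurable in the
    completion.

    The repairs converge because moving a hole through [n] vertices changes [n] times the mass it
    gains, [n] grows quadratically with the stage, and the uncoloured mass halves.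

    In the count, the first transport bound leaves the proportion of colours outside [S] either near
    0 or near 1; the second excludes the range near 1. *)

Section Analytic.
Context {R : realType}.

(* [A] is the result of a Souslin scheme whose branches are either eventually empty or
   shrink to a point of [A]. *)
Definition analytic (T : pseudoMetricType R) (A : set T) : Prop :=
  exists P : seq nat -> set T, [/\ P [::] = A,
    forall s, P s = \bigcup_n P (rcons s n) &
    forall x : nat -> nat, (exists n, P (mkseq x n) = set0) \/
      exists2 p, A p & forall e : R, 0 < e -> exists n, P (mkseq x n) `<=` ball p e].

Lemma mkseqSl (T : Type) (x : nat -> T) n :
  mkseq x n.+1 = x 0%N :: mkseq (fun i => x i.+1) n.
Proof.
rewrite /mkseq /=; congr (_ :: _).
by rewrite -[1%N]addn0 iotaDl -map_comp.
Qed.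

Lemma drop_mkseq (T : Type) (x : nat -> T) k n :
  drop k (mkseq x n) = mkseq (fun i => x (k + i)%N) (n - k).
Proof.
by rewrite /mkseq -map_drop drop_iota add0n -[X in iota X _]addn0 iotaDl -map_comp.
Qed.

Lemma scheme_anti (T : Type) (P : seq nat -> set T) (x : nat -> nat) :
  (forall s, P s = \bigcup_n P (rcons s n)) ->
  forall n m, (n <= m)%N -> P (mkseq x m) `<=` P (mkseq x n).
Proof.
move=> PU n m /subnK <-; elim: (m - n)%N => [|k IH] //.
rewrite addSn; apply: subset_trans IH => v.
by rewrite mkseqS [P (mkseq x (k + n))]PU => Pv; exists (x (k + n)%N).
Qed.

Lemma analytic_bigcup (T : pseudoMetricType R) (A : nat -> set T) :
  (forall k, analytic (A k)) -> analytic (\bigcup_k A k).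
Proof.
move=> /choice[P HP].
exists (fun s => if s is k :: s' then P k s' else \bigcup_k A k); split => //.
- case=> [|k s] /=; first by apply: eq_bigcupr => k _; have [] := HP k.
  by have [_ + _] := HP k; apply.
- move=> x; have [P0 PU Px] := HP (x 0%N).
  have [[n Hn]|[p Ap Hp]] := Px (fun i => x i.+1).
  + by left; exists n.+1; rewrite mkseqSl.
  + right; exists p; first by exists (x 0%N).
    by move=> e /Hp[n Hn]; exists n.+1; rewrite mkseqSl.
Qed.

(** One natural number codes a finite list, so a single step of a scheme can carry a letter for each
    of finitely many other schemes. *)
Definition letter (k m : nat) : nat := nth 0%N (CodeSeq.decode m) k.

Arguments letter : simpl never.

Lemma letter_code s k : letter k (CodeSeq.code s) = nth 0%N s k.
Proof. by rewrite /letter CodeSeq.codeK. Qed.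

Lemma map_mkseq (S T : Type) (g : S -> T) (x : nat -> S) n :
  map g (mkseq x n) = mkseq (g \o x) n.
Proof. by rewrite /mkseq -map_comp. Qed.

Lemma ball_separated (T : pseudoMetricType R) (p q : T) : hausdorff_space T ->
  p <> q -> exists2 e : R, 0 < e & ball p e `&` ball q e = set0.
Proof.
move=> hT pq; apply: contrapT => H; apply: pq; apply: hT => A B.
rewrite -!nbhs_ballE => -[a /= a0 aA] [b /= b0 bB].
have m0 : 0 < Num.min a b by rewrite lt_min a0.
apply: contrapT => AB; apply: H; exists (Num.min a b) => //.
apply/seteqP; split => // v [va vb]; apply: AB; exists v; split.
- by apply: aA; apply: le_ball va; rewrite ge_min lexx.
- by apply: bB; apply: le_ball vb; rewrite ge_min lexx orbT.
Qed.

Lemma analytic_bigcap (T : pseudoMetricType R) (A : nat -> set T) :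
  hausdorff_space T -> (forall k, analytic (A k)) -> analytic (\bigcap_k A k).
Proof.
move=> hT /choice[P HP].
have P0 k : P k [::] = A k by have [] := HP k.
have PU k s : P k s = \bigcup_n P k (rcons s n) by have [] := HP k.
(* Scheme [k] reads its letters only from position [k] on: each step then serves finitely many
   schemes, yet each scheme is eventually run along the whole branch. *)
pose Q s := \bigcap_k P k (map (letter k) (drop k s)).
have QE x n k : Q (mkseq x n) `<=` P k (mkseq (fun i => letter k (x (k + i)%N)) (n - k)).
  by move=> v /(_ k I); rewrite drop_mkseq map_mkseq.
exists Q; split => //.
- by rewrite /Q; apply: eq_bigcapr => k _; rewrite /= P0.
- move=> s; apply/seteqP; split.
  + move=> v Qv.
    have H k : exists m, P k (rcons (map (letter k) (drop k s)) m) v.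
      by have := Qv k I; rewrite PU => -[m _]; exists m.
    have [m Hm] := choice H.
    exists (CodeSeq.code (mkseq m (size s).+1)) => // k _.
    have [ks|ks] := leqP k (size s).
      by rewrite drop_rcons// map_rcons letter_code nth_mkseq// ltnS.
    by have := Qv k I; rewrite !drop_oversize ?size_rcons// ltnW.
  + move=> v [m _ Qv] k _; have := Qv k I.
    have [ks|ks] := leqP k (size s).
      by rewrite drop_rcons// map_rcons => H; rewrite PU; eexists; last exact: H.
    by rewrite !drop_oversize ?size_rcons// ltnW.
- move=> x; apply: contrapT => /not_orP[N0 Np].
  have N0' n : exists v, Q (mkseq x n) v.
    apply: contrapT => H; apply: N0; exists n; apply/seteqP; split => // v Qv.
    by apply: H; exists v.
  have H k : exists2 p, A k p & forall e : R, 0 < e ->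
      exists n, Q (mkseq x n) `<=` ball p e.
    have [_ _ /(_ (fun i => letter k (x (k + i)%N)))[[n Hn]|[p Ap Hp]]] := HP k.
      have [v /(QE _ _ k)] := N0' (n + k)%N.
      by rewrite addnK Hn.
    exists p => // e /Hp[n Hn]; exists (n + k)%N.
    by move=> v /(QE _ _ k); rewrite addnK => /Hn.
  have {H}/choice[p Hp] : forall k, exists p, A k p /\ forall e : R, 0 < e ->
      exists n, Q (mkseq x n) `<=` ball p e.
    by move=> k; have [p ? ?] := H k; exists p.
  have QU s : Q (rcons s 0%N) `<=` Q s \/ True by right.
  have Qanti n m : (n <= m)%N -> Q (mkseq x m) `<=` Q (mkseq x n).
    move=> nm v Qv k _; rewrite drop_mkseq map_mkseq.
    apply: (scheme_anti (PU k) (leq_sub2r k nm)).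
    exact: (QE _ _ _ _ Qv).
  have pE k : p k = p 0%N.
    apply: contrapT => /(ball_separated hT)[e e0 He].
    have [_ /(_ _ e0)[n Hn]] := Hp k; have [_ /(_ _ e0)[m Hm]] := Hp 0%N.
    have [v Qv] := N0' (maxn n m).
    suff : (ball (p k) e `&` ball (p 0%N) e) v by rewrite He.
    split; [apply: Hn|apply: Hm]; apply: Qanti Qv.
      exact: leq_maxl.
    exact: leq_maxr.
  apply: Np; exists (p 0%N); last by case: (Hp 0%N).
  by move=> k _; rewrite -(pE k); case: (Hp k).
Qed.

Lemma analyticX (T U : pseudoMetricType R) (A : set T) (B : set U) :
  analytic A -> analytic B -> analytic (A `*` B).
Proof.
move=> [P [P0 PU Px]] [Q [Q0 QU Qx]].
exists (fun s => P (map (letter 0) s) `*` Q (map (letter 1) s)); split.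
- by rewrite /= P0 Q0.
- move=> s; apply/seteqP; split.
  + move=> [v w] [/=]; rewrite PU QU => -[m _ Pm] [n _ Qn].
    by exists (CodeSeq.code [:: m; n]) => //; split; rewrite !map_rcons !letter_code.
  + move=> [v w] [m _ [/=]]; rewrite !map_rcons => ? ?.
    by split; rewrite /= (PU, QU); eexists; eauto.
- move=> x; have [[n Hn]|[p Ap Hp]] := Px (letter 0 \o x).
    by left; exists n; rewrite !map_mkseq Hn set0X.
  have [[n Hn]|[q Bq Hq]] := Qx (letter 1 \o x).
    by left; exists n; rewrite !map_mkseq Hn setX0.
  right; exists (p, q) => // e e0; have [n Hn] := Hp _ e0; have [m Hm] := Hq _ e0.
  exists (maxn n m) => -[v w] [/=]; rewrite !map_mkseq => Pv Qw; split => /=.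
    by apply: Hn; apply: (scheme_anti PU) Pv; exact: leq_maxl.
  by apply: Hm; apply: (scheme_anti QU) Qw; exact: leq_maxr.
Qed.

Lemma analytic_fst (T U : pseudoMetricType R) (A : set (T * U)) :
  analytic A -> analytic (fst @` A).
Proof.
move=> [P [P0 PU Px]]; exists (fun s => fst @` P s); split; first by rewrite P0.
- by move=> s; rewrite {1}PU image_bigcup.
- move=> x; have [[n Hn]|[p Ap Hp]] := Px x.
    by left; exists n; rewrite Hn image_set0.
  right; exists p.1; first by exists p.
  move=> e e0; have [n Hn] := Hp _ e0; exists n.
  by move=> _ [v /Hn[+ _] <-].
Qed.

Definition inv1 (n : nat) : R := n.+1%:R^-1.

Lemma inv1_gt0 n : 0 < inv1 n. Proof. by rewrite invr_gt0. Qed.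

Definition rat_seq (m : nat) : R := ratr (odflt 0 (unpickle m : option rat)).

Lemma dense_ratE (v : R) n : exists m, `|v - rat_seq m| <= inv1 n.
Proof.
have [|r] := @rat_in_itvoo R (v - inv1 n) v.
  by rewrite ltrBlDr ltrDl inv1_gt0.
rewrite in_itv/= => /andP[r1 r2]; exists (pickle r).
have i0 := inv1_gt0 n.
rewrite /rat_seq pickleK/= ler_norml; apply/andP; split; lra.
Qed.

Lemma analytic_closed (F : set R) : closed F -> analytic F.
Proof.
move=> cF; pose q := rat_seq; pose C (i m : nat) : set R := [set v | `|v - q m| <= inv1 i].
exists (fun s => F `&` [set v | forall i, (i < size s)%N -> C i (nth 0%N s i) v]).
split.
- by apply/seteqP; split => // v [].
- move=> s; apply/seteqP; split.
  + move=> v [Fv Hv].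
    have [m Hm] := dense_ratE v (size s).
    exists m => //; split => // i.
    rewrite size_rcons ltnS leq_eqVlt => /orP[/eqP->|lis].
      by rewrite nth_rcons ltnn eqxx.
    by rewrite nth_rcons lis; exact: Hv.
  + move=> v [m _ [Fv Hv]]; split => // i lis.
    by have := Hv i; rewrite size_rcons nth_rcons lis; apply; exact: ltnW.
- move=> x; apply: contrapT => /not_orP[N0 Np].
  have N0' n : exists v, F v /\ forall i, (i < n)%N -> C i (x i) v.
    apply: contrapT => H; apply: N0; exists n; apply/seteqP; split => // v [Fv Hv].
    apply: H; exists v; split=> // i ni; move: (Hv i).
    by rewrite size_mkseq nth_mkseq//; exact.
  have Hle i j : q (x i) - inv1 i <= q (x j) + inv1 j.
    have [v [_ Hv]] := N0' (maxn i j).+1.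
    have := Hv i; rewrite ltnS leq_maxl /C/= => /(_ isT).
    have := Hv j; rewrite ltnS leq_maxr /C/= => /(_ isT).
    by rewrite !ler_norml => /andP[? ?] /andP[? ?]; lra.
  (* The intervals around the [q (x i)] meet pairwise, so the supremum of their left ends lies in
     all of them. *)
  pose S : set R := [set q (x i) - inv1 i | i in setT].
  have S0 : S !=set0 by exists (q (x 0%N) - inv1 0), 0%N.
  have Sub j : ubound S (q (x j) + inv1 j) by move=> _ [i _ <-].
  have pP i : `|sup S - q (x i)| <= inv1 i.
    rewrite ler_norml; apply/andP; split.
      rewrite lerBrDl; apply: ub_le_sup; first by exists (q (x 0%N) + inv1 0); exact: (Sub 0%N).
      by exists i.
    by rewrite lerBlDl; apply: ge_sup.
  have Hball (e : R) : 0 < e -> exists n, forall v, C n (x n) v -> ball (sup S) e v.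
    move=> e0; exists (Num.truncn (2 / e)) => v; rewrite /C/= => vn.
    have h0 : inv1 (Num.truncn (2 / e)) < e / 2.
      rewrite /inv1 -[X in _ < X]invrK invf_div ltf_pV2 ?posrE// ?divr_gt0//.
      exact: truncnS_gt.
    have := pP (Num.truncn (2 / e)).
    move: vn; rewrite -ball_normE /=.
    by rewrite !ler_norml ltr_norml => /andP[? ?] /andP[? ?]; apply/andP; split; lra.
  apply: Np; exists (sup S).
    apply: cF => B; rewrite -nbhs_ballE => -[e /= e0 eB].
    have [n Hn] := Hball _ e0; have [v [Fv Hv]] := N0' n.+1.
    by exists v; split => //; apply: eB; apply: Hn; exact: Hv.
  move=> e /Hball[n Hn]; exists n.+1 => v [Fv Hv]; apply: Hn.
  by have := Hv n; rewrite size_mkseq nth_mkseq//; exact.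
Qed.

(** Analytic sets are not closed under complements; requiring the complement to be analytic too
    repairs this, and Borel sets are then reached from generators alone. *)
Lemma bianalytic_sigma_algebra (T : pseudoMetricType R) :
  hausdorff_space T -> analytic [set: T] ->
  sigma_algebra [set: T] [set A | analytic A /\ analytic (~` A)].
Proof.
move=> hT AT; split.
- split; last by rewrite setC0.
  have -> : set0 = \bigcup_(k : nat) (set0 : set T) by rewrite bigcup0.
  by apply: analytic_bigcup => _; exists (fun=> set0); split => //;
    [move=> _; rewrite bigcup0|move=> x; left; exists 0%N].
- by move=> A [A1 A2] /=; rewrite setTD setCK.
- move=> A HA; split; first by apply: analytic_bigcup => k; case: (HA k).
  by rewrite setC_bigcup; apply: analytic_bigcap => // k; case: (HA k).
Qed.

Lemma borel_analytic (A : set R) : measurable A -> analytic A /\ analytic (~` A).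
Proof.
suff : (@ocitv R).-sigma.-measurable `<=` [set A : set R | analytic A /\ analytic (~` A)] by apply.
rewrite measurable_realfun.RGenCInfty.measurableE.
apply: smallest_sub.
  by apply: bianalytic_sigma_algebra => //; apply: analytic_closed; exact: closedT.
move=> _ [x ->]; split; first by apply: analytic_closed; exact: interval_closed.
have -> : ~` `[x, +oo[ = \bigcup_k [set` `]-oo, x - inv1 k]%R].
  apply/seteqP; split => v /=.
    rewrite in_itv/= andbT => /negP; rewrite -ltNge => vx.
    exists (Num.truncn (x - v)^-1) => //=; rewrite in_itv/=.
    suff : inv1 (Num.truncn (x - v)^-1) < x - v by lra.
    rewrite /inv1 -[X in _ < X]invrK ltf_pV2 ?posrE ?invr_gt0 ?subr_gt0//.
    exact: truncnS_gt.
  move=> [k _ /=]; rewrite !in_itv/= andbT => kv; apply/negP; rewrite -ltNge.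
  by have := inv1_gt0 k; lra.
by apply: analytic_bigcup => k; apply: analytic_closed; exact: interval_closed.
Qed.

Lemma borel_analytic2 (A : set (R * R)) : measurable A -> analytic A.
Proof.
have AT : analytic [set: R] by apply: analytic_closed; exact: closedT.
have hT : hausdorff_space (R * R)%type by exact: norm_hausdorff.
suff : measurable `<=` [set A : set (R * R) | analytic A /\ analytic (~` A)].
  by move=> H /H[].
rewrite measurable_prod_measurableType; apply: smallest_sub.
  apply: bianalytic_sigma_algebra => //.
  by rewrite -setXTT; exact: analyticX.
move=> _ [B /borel_analytic[B1 B2]] [C /borel_analytic[C1 C2]] <-; split.
  exact: analyticX.
have -> : ~` (B `*` C) = (~` B `*` setT) `|` (setT `*` ~` C).
  apply/seteqP; split => -[v w] /=.
    by move=> /not_andP[|]; [left|right].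
  by move=> [[? _]|[_ ?]]; apply/not_andP; [left|right].
rewrite -bigcup2E; apply: analytic_bigcup => -[|[|k]] /=; [exact: analyticX|exact: analyticX|].
have -> : set0 = (setT `*` set0 : set (R * R)) by rewrite setX0.
by apply: analyticX => //; have [] := borel_analytic (@measurable0 _ R).
Qed.

(** Lusin's argument: if all children of two nodes could be separated, a union of intersections
    would separate the nodes. So inseparability descends along two branches; their limits are
    distinct, and disjoint balls around them give the contradiction. *)
Lemma analytic_separation (A B : set R) : analytic A -> analytic B ->
  A `&` B = set0 -> exists S : set R, [/\ measurable S, A `<=` S & S `&` B = set0].
Proof.
move=> [P [P0 PU Px]] [Q [Q0 QU Qx]] AB; apply: contrapT => Nsep.
pose sep (A B : set R) := exists S : set R, [/\ measurable S, A `<=` S & S `&` B = set0].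
have step s t : ~ sep (P s) (Q t) -> exists mn : nat * nat,
    ~ sep (P (rcons s mn.1)) (Q (rcons t mn.2)).
  move=> Nst; apply: contrapT => H; apply: Nst.
  have {}H m n : sep (P (rcons s m)) (Q (rcons t n)).
    by apply: contrapT => mn; apply: H; exists (m, n).
  have /choice[S HS] : forall m, exists S : nat -> set R, forall n,
    [/\ measurable (S n), P (rcons s m) `<=` S n & S n `&` Q (rcons t n) = set0].
    move=> m; have {}H n : exists S, [/\ measurable S, P (rcons s m) `<=` S & S `&` Q (rcons t n) = set0] by exact: H.
    by have [S HS] := choice H; exists S.
  exists (\bigcup_m \bigcap_n S m n); split.
  - apply: bigcup_measurable => m _; apply: bigcap_measurable => //.
    by move=> n _; case: (HS m n).
  - rewrite PU => v [m _ Pv]; exists m => // n _.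
    by have [_ + _] := HS m n; apply.
  - apply/seteqP; split => // v [[m _ Sv]]; rewrite QU => -[n _ Qv].
    by have [_ _ <-] := HS m n; split => //; exact: Sv.
have [F HF] : exists F : seq nat * seq nat -> nat * nat, forall st, ~ sep (P st.1) (Q st.2) ->
    ~ sep (P (rcons st.1 (F st).1)) (Q (rcons st.2 (F st).2)).
  have : forall st : seq nat * seq nat, exists mn : nat * nat, ~ sep (P st.1) (Q st.2) ->
    ~ sep (P (rcons st.1 mn.1)) (Q (rcons st.2 mn.2)).
    move=> [s t]; have [/step[mn H]|H] := pselect (~ sep (P s) (Q t)); first by exists mn.
    by exists (0%N, 0%N).
  by move=> /choice[F HF]; exists F.
pose it := fix it n := if n is m.+1 then
  (rcons (it m).1 (F (it m)).1, rcons (it m).2 (F (it m)).2) else ([::], [::]).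
have Hit n : ~ sep (P (it n).1) (Q (it n).2).
  by elim: n => [|n IH] /=; [rewrite P0 Q0|exact: HF].
pose x n := (F (it n)).1; pose y n := (F (it n)).2.
have itE n : it n = (mkseq x n, mkseq y n).
  by elim: n => [//|n IH]; rewrite !mkseqS /= {1 3}IH.
have {}Hit n : ~ sep (P (mkseq x n)) (Q (mkseq y n)) by have := Hit n; rewrite itE.
have [[n Hn]|[p Ap Hp]] := Px x.
  by apply: (Hit n); exists set0; rewrite Hn; split => //; rewrite set0I.
have [[n Hn]|[q Bq Hq]] := Qx y.
  by apply: (Hit n); exists setT; rewrite Hn; split => //; rewrite setI0.
have [||e e0 He] := @ball_separated R p q; first exact: Rhausdorff.
  move=> pq; suff : (A `&` B) p by rewrite AB.
  by split => //; rewrite pq.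
have [n Hn] := Hp _ e0; have [m Hm] := Hq _ e0.
apply: (Hit (maxn n m)); exists (ball p e); split.
- by apply: open_measurable; exact: ball_open.
- by apply: subset_trans Hn; apply: (scheme_anti PU); exact: leq_maxl.
- rewrite -subset0 -He => v [? Qv]; split => //; apply: Hm.
  by apply: (scheme_anti QU) Qv; exact: leq_maxr.
Qed.

End Analytic.

(** * Borel selection from finite sections *)

Section LusinNovikov.
Context {R : realType}.
Local Notation rat_seq := (@rat_seq R).
Local Notation inv1 := (@inv1 R).

Lemma measurable_glue d d' (T : measurableType d) (T' : measurableType d')
    (B : nat -> set T) (h : nat -> T -> T') (f : T -> T') :
  (forall k, measurable (B k)) -> (forall k, measurable_fun setT (h k)) ->
  (forall x, exists k, B k x) -> (forall k x, B k x -> f x = h k x) ->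
  measurable_fun setT f.
Proof.
move=> mB mh cov fh _ Y mY; rewrite setTI.
have -> : f @^-1` Y = \bigcup_k (B k `&` h k @^-1` Y).
  apply/seteqP; split => x /=.
    by have [k Bk] := cov x => fY; exists k => //; split => //=; rewrite -fh.
  by move=> [k _ [Bk]] /=; rewrite -fh.
apply: bigcupT_measurable => k; apply: measurableI => //.
by rewrite -[X in measurable X]setTI; exact: mh.
Qed.

Lemma measurable_preT d d' (T : measurableType d) (T' : measurableType d')
    (f : T -> T') (Y : set T') : measurable_fun setT f -> measurable Y ->
  measurable (f @^-1` Y).
Proof. by move=> mf mY; rewrite -[X in measurable X]setTI; exact: mf. Qed.

Lemma analytic_setI (A B : set R) : analytic A -> analytic B -> analytic (A `&` B).
Proof.
move=> aA aB; rewrite -bigcap2E; apply: analytic_bigcap; first exact: Rhausdorff.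
by move=> [|[|k]] //=; apply: analytic_closed; exact: closedT.
Qed.

Lemma analytic_section (E : set (R * R)) (U : set R) : measurable E -> measurable U ->
  analytic [set x | exists y, U y /\ E (x, y)].
Proof.
move=> mE mU.
have -> : [set x | exists y, U y /\ E (x, y)] = fst @` (E `&` (setT `*` U)).
  apply/seteqP; split => x /=; first by move=> [y [Uy Ey]]; exists (x, y).
  by move=> [[x' y] [Ey [_ Uy]] /= <-]; exists y.
apply: analytic_fst; apply: borel_analytic2; apply: measurableI => //.
exact: measurableX.
Qed.

Definition small_section (n : nat) (E : set (R * R)) : Prop :=
  forall x s, uniq s -> (forall y, y \in s -> E (x, y)) -> (size s <= n)%N.

(** The set of [x] whose section meets all [J j] is a priori only analytic. There pigeonhole leaves
    exactly one point of the section in each [J j]; comparing it with a rational splits the set into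
    two disjoint analytic parts, which a Borel set separates. The selected point is rebuilt from
    these comparisons, by functions that are Borel everywhere. *)
Lemma section_selector (E : set (R * R)) (m : nat) (J : nat -> set R) :
  measurable E -> (forall j, measurable (J j)) ->
  (forall j, exists M, forall y, J j y -> `|y| <= M) ->
  (forall i j, (i < m)%N -> (j < m)%N -> i != j -> J i `&` J j = set0) ->
  small_section m E ->
  exists2 g : nat -> R -> R, (forall j, measurable_fun setT (g j)) &
  forall x, (forall j, (j < m)%N -> exists y, J j y /\ E (x, y)) ->
    forall j, (j < m)%N -> J j (g j x) /\ E (x, g j x).
Proof.
move=> mE mJ Jb Jd Es.
pose A := [set x | forall j, (j < m)%N -> exists y, J j y /\ E (x, y)].
have aA : analytic A.
  have -> : A = \bigcap_j [set x | (j < m)%N -> exists y, J j y /\ E (x, y)].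
    by apply/seteqP; split => x /= H j; [move=> _; exact: H|exact: (H j I)].
  apply: analytic_bigcap => [|j]; first exact: Rhausdorff.
  case: (ltnP j m) => jm.
    rewrite (_ : [set _ | _] = [set x | exists y, J j y /\ E (x, y)]).
      exact: analytic_section.
    by apply/seteqP; split => x /=; [exact|move=> ? _].
  rewrite (_ : [set _ | _] = setT); first by apply: analytic_closed; exact: closedT.
  by apply/seteqP; split.
have unique x j y y' : A x -> (j < m)%N -> J j y -> E (x, y) -> J j y' -> E (x, y') -> y = y'.
  move=> Ax jm Jy Ey Jy' Ey'; apply: contrapT => yy'.
  have : forall i, exists z, (i < m)%N -> J i z /\ E (x, z).
    move=> i; case: (ltnP i m) => im; last by exists 0.
    by have [z Hz] := Ax _ im; exists z.
  move=> /choice[z Hz].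
  pose s := y' :: [seq if i == j then y else z i | i <- iota 0 m].
  have Hz' i : (i < m)%N -> J i (if i == j then y else z i) /\ E (x, if i == j then y else z i).
    by move=> im; case: eqP => [->//|_]; exact: Hz.
  suff : (size s <= m)%N by rewrite /= size_map size_iota ltnn.
  apply: (Es x); last first.
    move=> w; rewrite inE => /orP[/eqP->//|/mapP[i]].
    by rewrite mem_iota/= add0n => im ->; case: (Hz' _ im).
  rewrite /= map_inj_in_uniq ?iota_uniq ?andbT.
    apply/mapP => -[i]; rewrite mem_iota/= add0n => im.
    case: eqP => [_ /esym//|/eqP ij yz].
    suff : (J i `&` J j) y' by rewrite Jd.
    by split => //; rewrite yz; case: (Hz _ im).
  move=> i k; rewrite !mem_iota/= !add0n => im km ik; apply: contrapT => /eqP ik'.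
  suff : (J i `&` J k) (if i == j then y else z i) by rewrite Jd.
  by split; [case: (Hz' _ im)|rewrite ik; case: (Hz' _ km)].
have sepq j q : exists S : set R, (j < m)%N -> [/\ measurable S,
    (forall x y, A x -> J j y -> E (x, y) -> y < q -> S x) &
    (forall x y, A x -> J j y -> E (x, y) -> q <= y -> ~ S x)].
  case: (ltnP j m) => jm; last by exists set0.
  pose U1 := J j `&` [set` `]-oo, q[]; pose U2 := J j `&` [set` `[q, +oo[].
  have mU1 : measurable U1 by apply: measurableI.
  have mU2 : measurable U2 by apply: measurableI.
  have := analytic_setI aA (analytic_section mE mU1).
  have := analytic_setI aA (analytic_section mE mU2).
  move=> /[swap] /analytic_separation /[apply] -[|S [mS S1 S2]].
    apply/seteqP; split => // x [[Ax [y [[Jy]]]]].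
    rewrite /= in_itv/= => yq Ey [_ [y' [[Jy']]]]; rewrite /= in_itv/= andbT => qy' Ey'.
    by move: qy'; rewrite -(unique _ _ _ _ Ax jm Jy Ey Jy' Ey') leNgt yq.
  exists S => _; split => // x y Ax Jy Ey yq.
    by apply: S1; split => //; exists y; split => //; split => //=; rewrite in_itv.
  move=> Sx; suff : (S `&` (A `&` [set x | exists y, U2 y /\ E (x, y)])) x by rewrite S2.
  by split => //; split => //; exists y; split => //; split => //=; rewrite in_itv/= yq.
have /choice[S HS] : forall j, exists S : nat -> set R, (j < m)%N -> forall k, [/\ measurable (S k),
    (forall x y, A x -> J j y -> E (x, y) -> y < rat_seq k -> S k x) &
    (forall x y, A x -> J j y -> E (x, y) -> rat_seq k <= y -> ~ S k x)].
  by move=> j; have /choice[S HS] := fun k => sepq j (rat_seq k); exists S => jm k; exact: HS.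
have /choice[M HM] := Jb.
(* On the good set, [x] lies outside [S j k] exactly when [rat_seq k] is at most the selected point.
   The bounds by [M j] keep the supremum finite elsewhere. *)
pose h j k x := if x \in S j k then - M j - 1 else Num.min (rat_seq k) (M j).
have hub j x : has_ubound (range (h j ^~ x)).
  exists (Num.max (- M j - 1) (M j)) => _ [k _ <-]; rewrite /h.
  case: ifP => _; rewrite le_max ?lexx//.
  by apply/orP; right; rewrite ge_min lexx orbT.
exists (fun j => if (j < m)%N then fun x => sups (h j ^~ x) 0 else cst 0).
  move=> j; case: ifP => jm; last exact: measurable_cst.
  apply: measurable_fun_sups => [x _|k _]; first exact: hub.
  apply: (@measurable_fun_ifT _ _ _ _ (cst (- M j - 1)) (cst (Num.min (rat_seq k) (M j)))) => //.
  apply: (measurable_fun_bool true).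
  rewrite setTI (_ : _ @^-1` _ = S j k); first by have [] := HS j jm k.
  by apply/seteqP; split => x /=; [move=> /set_mem|move=> /mem_set].
move=> x Ax j jm; rewrite jm.
have [y [Jy Ey]] := Ax _ jm.
suff -> : sups (h j ^~ x) 0 = y by [].
have yM := HM _ _ Jy; move: (yM); rewrite ler_norml => /andP[yM1 yM2].
have mem k : (x \in S j k) = (y < rat_seq k).
  have [_ S1 S2] := HS _ jm k.
  apply/idP/idP; rewrite inE; last exact: S1.
  by rewrite ltNge => Sx; apply/negP => /(S2 _ _ Ax Jy Ey).
apply/eqP; rewrite eq_le; apply/andP; split.
  apply: ge_sup; first by exists (h j 0%N x); exists 0%N.
  move=> _ [k _ <-]; rewrite /h mem; case: ifPn => [_|]; first by lra.
  by rewrite -leNgt => ky; rewrite ge_min ky.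
rewrite leNgt; apply/negP => lty.
set s := sups _ _ in lty.
have [r] : exists r : rat, ratr r \in `]s, y[ by exact: rat_in_itvoo.
rewrite in_itv/= => /andP[sr ry].
have : h j (pickle r) x <= s.
  apply: ub_le_sup; last by exists (pickle r).
  by have [b Hb] := hub j x; exists b => _ [k _ <-]; apply: Hb; exists k.
rewrite /h mem /rat_seq pickleK/= ltNge (ltW ry)/= ge_min leNgt sr/=.
by move=> Ms; move: (lt_le_trans (lt_trans sr ry) yM2); rewrite ltNge Ms.
Qed.

(** The factor 4 makes balls of radius [inv1 n] disjoint even when their centres are only
    approximations within [inv1 n] of the points of [s]. *)
Lemma seq_separated (s : seq R) :
  exists n, forall y y', y \in s -> y' \in s -> y != y' -> 4 * inv1 n <= `|y - y'|.
Proof.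
have inv_small (e : R) : 0 < e -> exists n, 4 * inv1 n <= e.
  move=> e0; exists (Num.truncn (4 / e)).
  suff : inv1 (Num.truncn (4 / e)) <= (4 / e)^-1 by rewrite invf_div; lra.
  rewrite /inv1 lef_pV2 ?posrE ?divr_gt0//.
  by apply: ltW; exact: truncnS_gt.
have inv_mono n n' : (n <= n')%N -> inv1 n' <= inv1 n.
  by move=> nn; rewrite /inv1 lef_pV2 ?posrE// ler_nat ltnS.
elim: s => [|a s [n IH]]; first by exists 0%N.
have [n' Hn'] : exists n', forall y, y \in s -> y != a -> 4 * inv1 n' <= `|y - a|.
  elim: s {IH} => [|b s [k Hk]]; first by exists 0%N.
  have [->|ba] := eqVneq b a.
    exists k => y; rewrite inE => /orP[/eqP->|]; first by rewrite eqxx.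
    exact: Hk.
  have [k' Hk'] : exists n, 4 * inv1 n <= `|b - a| by apply: inv_small; rewrite normr_gt0 subr_eq0.
  exists (maxn k k') => y; rewrite inE => /orP[/eqP-> _|ys ya].
    by apply: le_trans Hk'; rewrite ler_pM2l// inv_mono// leq_maxr.
  by apply: le_trans (Hk _ ys ya); rewrite ler_pM2l// inv_mono// leq_maxl.
exists (maxn n n').
have m1 : 4 * inv1 (maxn n n') <= 4 * inv1 n by rewrite ler_pM2l// inv_mono// leq_maxl.
have m2 : 4 * inv1 (maxn n n') <= 4 * inv1 n' by rewrite ler_pM2l// inv_mono// leq_maxr.
move=> y y'; rewrite !inE => /orP[/eqP->|ys] /orP[/eqP->|y's] yy'.
- by rewrite eqxx in yy'.
- by rewrite distrC; apply: le_trans m2 (Hn' _ y's _); rewrite eq_sym.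
- by apply: le_trans m2 (Hn' _ ys _).
- exact: le_trans m1 (IH _ _ ys y's yy').
Qed.

(** Induction on the size of sections. Over [X], where the section has all [n.+1] points, disjoint
    rational intervals isolate them and [section_selector] applies; elsewhere at most [n] points
    remain. [X] is Borel because membership is certified by the Borel selectors themselves. *)
Lemma lusin_novikov (n : nat) (E : set (R * R)) : measurable E -> small_section n E ->
  exists (nu : nat -> R -> R) (D : nat -> set R),
  [/\ forall i, measurable (D i), forall i, measurable_fun setT (nu i),
    forall x y, E (x, y) <-> exists i, [/\ (i < n)%N, D i x & nu i x = y] &
    forall x i j, (i < n)%N -> (j < n)%N -> D i x -> D j x -> nu i x = nu j x -> i = j].
Proof.
elim: n E => [|n IH] E mE Es.
  exists (fun=> cst 0), (fun=> set0); split => // x y; split => [Exy|[i []//]].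
  by have := Es x [:: y] isT; rewrite /= => H; suff : (1 <= 0)%N by []; apply: H => z;
    rewrite inE => /eqP->.
(* The code [k] lists the index of a common radius, followed by the indices of the rational
   centres. *)
pose J k j := [set v : R | `|v - rat_seq (letter j.+1 k)| < inv1 (letter 0 k)].
have mJ k j : measurable (J k j).
  rewrite (_ : J k j = ball (rat_seq (letter j.+1 k)) (inv1 (letter 0 k))).
    by apply: open_measurable; exact: ball_open.
  by rewrite -ball_normE; apply/seteqP; split => v /=; rewrite distrC.
have bJ k j : exists M, forall y, J k j y -> `|y| <= M.
  exists (`|rat_seq (letter j.+1 k)| + inv1 (letter 0 k)) => y Jy.
  rewrite -[y in `|y|](subrK (rat_seq (letter j.+1 k))) addrC.
  by apply: le_trans (ler_normD _ _) _; rewrite lerD2l; exact: ltW.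
pose ok k := forall i j, (i < n.+1)%N -> (j < n.+1)%N -> i != j -> J k i `&` J k j = set0.
have /choice[g Hg] : forall k, exists g : nat -> R -> R,
    (forall j, measurable_fun setT (g j)) /\ (ok k ->
    forall x, (forall j, (j < n.+1)%N -> exists y, J k j y /\ E (x, y)) ->
    forall j, (j < n.+1)%N -> J k j (g j x) /\ E (x, g j x)).
  move=> k; have [okk|nok] := pselect (ok k); last by exists (fun=> cst 0).
  by have [g g1 g2] := section_selector mE (mJ k) (bJ k) okk Es; exists g.
pose A k := [set x | ok k /\ forall j, (j < n.+1)%N -> J k j (g k j x) /\ E (x, g k j x)].
have mA k : measurable (A k).
  have -> : A k = [set x | ok k] `&`
      \bigcap_(j in [set j | (j < n.+1)%N]) (g k j @^-1` J k j `&` (fun x => (x, g k j x)) @^-1` E).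
    by apply/seteqP; split => x /= [ok1 H]; split => // j; exact: H.
  apply: measurableI.
    have [okk|nok] := pselect (ok k).
      by rewrite (_ : [set _ | _] = setT)//; apply/seteqP; split.
    by rewrite (_ : [set _ | _] = set0)//; apply/seteqP; split.
  apply: bigcap_measurable; first by exists 0%N.
  move=> j _; have [mg _] := Hg k; apply: measurableI; apply: measurable_preT => //.
  exact: measurable_fun_pair.
pose X := \bigcup_k A k.
have mX : measurable X by exact: bigcupT_measurable.
have XP x s : uniq s -> size s = n.+1 -> (forall y, y \in s -> E (x, y)) -> X x.
  move=> us ss sE; have [m Hm] := seq_separated s.
  have /choice[c Hc] : forall j, exists c, `|nth 0 s j - rat_seq c| <= inv1 m.+1.
    by move=> j; exact: dense_ratE.
  pose k := CodeSeq.code (m :: mkseq c n.+1).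
  have mm : inv1 m.+1 < inv1 m by rewrite /inv1 ltf_pV2 ?posrE// ltr_nat.
  have l0 : letter 0 k = m by rewrite /k letter_code.
  have lS i : (i < n.+1)%N -> letter i.+1 k = c i.
    by move=> im; rewrite /k letter_code -[RHS](nth_mkseq 0%N c im).
  have okk : ok k.
    move=> i j im jm ij; apply/seteqP; split => // v []; rewrite /J/= !lS// l0.
    have := Hc i; have := Hc j.
    have : 4 * inv1 m <= `|nth 0 s i - nth 0 s j|.
      by apply: Hm; rewrite ?mem_nth ?ss// nth_uniq ?ss.
    move: (rat_seq _) (rat_seq _) (nth _ _ _) (nth _ _ _) mm => u w a b mm.
    rewrite leNgt ltr_norml !ler_norml !ltr_norml => /negP ab /andP[? ?] /andP[? ?].
    by move=> /andP[? ?] /andP[? ?]; apply: ab; apply/andP; split; lra.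
  exists k => //; split => // j jm; have [_ /(_ okk)] := Hg k; apply => // i im.
  exists (nth 0 s i); split; last by apply: sE; rewrite mem_nth ?ss.
  rewrite /J/= lS// l0.
  exact: le_lt_trans (Hc i) mm.
pose E' := E `&` (~` X `*` setT).
have mE' : measurable E'.
  by apply: measurableI => //; apply: measurableX => //; exact: measurableC.
have Es' : small_section n E'.
  move=> x [|y s]//= us sE; rewrite ltnNge; apply/negP => ns.
  have [_ [nX _]] : E' (x, y) by apply: sE; rewrite mem_head.
  apply: nX; apply: (XP x (take n.+1 (y :: s))).
  - exact: take_uniq.
  - by rewrite size_takel.
  - by move=> z /mem_take /sE[].
have [nu [D [mD mnu D1 D2]]] := IH _ mE' Es'.
pose B k := if k is k'.+1 then A k' `\` \bigcup_(l in [set l | (l < k')%N]) A l else ~` X.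
have mB k : measurable (B k).
  case: k => [|k]; first exact: measurableC.
  by apply: measurableD => //; apply: bigcup_measurable.
have Bcov x : exists k, B k x.
  have [[k _ Ak]|nX] := pselect (X x); last by exists 0%N.
  pose P k := `[< A k x >].
  have exP : exists k, P k by exists k; apply/asboolP.
  case: (ex_minnP exP) => j /asboolP Aj Hj; exists j.+1; split => // -[l /= lj Al].
  by have := Hj l; rewrite leqNgt lj => H; have : false by apply: H; apply/asboolP.
have Bd k l x : B k x -> B l x -> k = l.
  case: k l => [|k] [|l] //=.
  - by move=> nX [Al _]; case: nX; exists l.
  - by move=> [Al _] nX; case: nX; exists k.
  - move=> [Ak Hk] [Al Hl]; congr _.+1; case: (ltngtP k l) => // kl.
      by case: Hl; exists k.
    by case: Hk; exists l.
pose h i k := if k is k'.+1 then g k' i else nu i.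
have mh i k : measurable_fun setT (h i k).
  by case: k => [|k] //=; case: (Hg k).
have /choice[kx Hkx] := Bcov.
exists (fun i x => h i (kx x) x), (fun i => if (i < n)%N then D i `|` X else X); split.
- by move=> i; case: ifP => _ //; exact: measurableU.
- move=> i; apply: (measurable_glue mB (mh i) Bcov) => k x Bk.
  by rewrite (Bd _ _ _ (Hkx x) Bk).
- move=> x y; have := Hkx x; case: (kx x) => [|k] /= Bk.
  + split.
      move=> Exy; have [|i [iln Di nui]] := (D1 x y).1.
        by split.
      by exists i; rewrite iln (leq_trans iln)//; split => //; left.
    move=> [i [_]]; case: ifP => // iln [Di|//] nui.
    by have [] := (D1 x y).2 (ex_intro _ i (And3 iln Di nui)).
  + have [okk Ak] := Bk.1.
    split.
      move=> Exy; apply: contrapT => H.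
      pose s := y :: [seq g k i x | i <- iota 0 n.+1].
      suff : (size s <= n.+1)%N by rewrite /= size_map size_iota ltnn.
      apply: (Es x); last first.
        move=> z; rewrite inE => /orP[/eqP->//|/mapP[i]].
        by rewrite mem_iota add0n => /andP[_ im] ->; case: (Ak _ im).
      rewrite cons_uniq map_inj_in_uniq ?iota_uniq ?andbT.
        apply/mapP => -[i]; rewrite mem_iota add0n => /andP[_ im] yE.
        by apply: H; exists i; split => //; case: ifP => _; [right|]; exists k => //; case: Bk.
      move=> i j; rewrite !mem_iota !add0n => /andP[_ im] /andP[_ jm] ij.
      apply: contrapT => /eqP ij'; suff : (J k i `&` J k j) (g k i x) by rewrite okk.
      by split; [case: (Ak _ im)|rewrite ij; case: (Ak _ jm)].
    by move=> [i [im _ <-]]; case: (Ak _ im).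
- move=> x i j im jm; have := Hkx x; case: (kx x) => [|k] /= Bk.
  + case: ifP => // iln [Di|//]; case: ifP => // jln [Dj|//]; exact: D2.
  + move=> _ _ ij; have [okk Ak] := Bk.1.
    apply: contrapT => /eqP ij'; suff : (J k i `&` J k j) (g k i x) by rewrite okk.
    by split; [case: (Ak _ im)|rewrite ij; case: (Ak _ jm)].
Qed.

End LusinNovikov.

(** * Moving an uncoloured point *)

Lemma map_uniq_inj (S T : eqType) (f : S -> T) (s : seq S) :
  uniq (map f s) -> {in s &, injective f}.
Proof.
elim: s => [|a s IH] //= /andP[fa us] x y; rewrite !inE.
move=> /orP[/eqP->|xs] /orP[/eqP->|ys] // fxy.
- by move: fa; rewrite fxy map_f.
- by move: fa; rewrite -fxy map_f.
- exact: IH.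
Qed.

Section HoleWalk.
Context {V : eqType} (nbr : V -> seq V) (D : nat).
Hypothesis nbr_uniq : forall x, uniq (nbr x).
Hypothesis nbr_sym : forall x y, (y \in nbr x) = (x \in nbr y).
Hypothesis nbr_irr : forall x, x \notin nbr x.
Hypothesis nbr_size : forall x, (size (nbr x) <= D)%N.
Implicit Types (f g : V -> option 'I_D) (u w x y z : V) (p q s : seq V).

Definition edge x y := y \in nbr x.

(** Uncoloured vertices are unconstrained, even when adjacent to each other. *)
Definition proper f := forall x y, y \in nbr x -> f x <> None -> f x <> f y.

Definition shift f u w := fun z => if z == u then f w else if z == w then None else f z.

Fixpoint shiftw f u p := if p is w :: p' then shiftw (shift f u w) w p' else f.

Definition full f u := forall a, exists2 y, y \in nbr u & f y = Some a.

(* [shiftw f u p] moves the hole [u] along [p]; a full hole cannot be filled. *)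
Definition stuck n f u := forall p, path edge u p -> (size p <= n)%N ->
  full (shiftw f u p) (last u p).

(** Pigeonhole: [D] colours on at most [D] neighbours. *)
Lemma fullP f u : full f u ->
  [/\ {in nbr u &, injective f}, forall y, y \in nbr u -> f y <> None & size (nbr u) = D].
Proof.
move=> Hf; pose s1 : seq (option 'I_D) := map Some (enum 'I_D).
have us1 : uniq s1 by rewrite map_inj_uniq ?enum_uniq// => ? ? [].
have ss1 : size s1 = D by rewrite size_map size_enum_ord.
have sub : {subset s1 <= map f (nbr u)}.
  by move=> _ /mapP[a _ ->]; have [y yu <-] := Hf a; exact: map_f.
have le : (size (map f (nbr u)) <= size s1)%N by rewrite size_map ss1.
have [eqs eqi] := uniq_min_size us1 sub le.
have us : uniq (map f (nbr u)) by exact: leq_size_uniq le.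
split; last by rewrite -ss1 eqs size_map.
  exact: map_uniq_inj.
move=> y yu fy; have : None \in s1 by rewrite eqi -fy map_f.
by case/mapP.
Qed.

Lemma stuck0 n f u : stuck n f u -> full f u.
Proof. by move=> /(_ [::]); exact. Qed.

Lemma stuckS n m f u : (m <= n)%N -> stuck n f u -> stuck m f u.
Proof. by move=> mn S p pp pm; apply: S => //; exact: leq_trans mn. Qed.

Lemma stuck_shift n f u w : w \in nbr u -> stuck n.+1 f u -> stuck n (shift f u w) w.
Proof. by move=> wu S p pp pn; apply: (S (w :: p)) => //=; rewrite [edge _ _]wu. Qed.

Lemma nbr_neq x y : y \in nbr x -> y != x.
Proof. by move=> yx; apply/eqP => e; move: (nbr_irr x); rewrite -{1}e yx. Qed.

Lemma proper_shift f u w : proper f -> f u = None -> full f u -> w \in nbr u ->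
  proper (shift f u w) /\ shift f u w w = None.
Proof.
move=> pf fu Hf wu; have [finj fnN _] := fullP Hf.
have wnu := nbr_neq wu.
split; last by rewrite /shift eqxx (negPf wnu).
have key z : z \in nbr u -> z != w -> f z <> f w.
  by move=> zu /eqP zw fzw; apply: zw; exact: finj.
move=> x y yx; rewrite /shift.
have [xu|xu] := eqVneq x u; have [yu|yu] := eqVneq y u.
- by move: yx; rewrite xu yu (negPf (nbr_irr u)).
- case: eqVneq => [_ H|yw _ /esym]; first exact: H.
  by apply: key => //; rewrite -xu.
- case: eqVneq => [_ H|xw _]; first by case: H.
  by apply: key => //; rewrite -yu nbr_sym.
- have [_ H|xw] := eqVneq x w; first by case: H.
  by have [_ H|yw] := eqVneq y w; [exact: H|exact: pf].
Qed.

Lemma stuck_walk p n f u : proper f -> f u = None -> path edge u p ->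
  stuck (size p + n) f u ->
  [/\ proper (shiftw f u p), shiftw f u p (last u p) = None &
      stuck n (shiftw f u p) (last u p)].
Proof.
elim: p f u => [|w p IH] f u pf fu //= /andP[wu pp]; rewrite addSn => S.
have [pf' fw] := proper_shift pf fu (stuck0 S) wu.
by apply: IH => //; exact: stuck_shift.
Qed.

Lemma shiftw_notin p f u z : z \notin u :: p -> shiftw f u p z = f z.
Proof.
elim: p f u => [|w p IH] f u //= zup.
rewrite IH; last by move: zup; rewrite !inE !negb_or => /and3P[_ -> ->].
by move: zup; rewrite /shift !inE !negb_or => /and3P[/negPf-> /negPf-> _].
Qed.

Lemma map_shiftw p f u : uniq (u :: p) -> f u = None ->
  map (shiftw f u p) (u :: p) = rcons (map f p) None.
Proof.
elim: p f u => [|w p IH] f u; first by move=> _ /= ->.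
move=> /= /andP[uwp uwp'] fu.
have uw : w != u by apply/eqP => e; move: uwp; rewrite e mem_head.
rewrite shiftw_notin// {1}/shift eqxx; congr (_ :: _).
rewrite -/(map _ (w :: p)) IH//; last by rewrite /shift (negPf uw) eqxx.
congr rcons; apply/eq_in_map => z zp; rewrite /shift.
case: eqVneq => [zu|_]; first by move: uwp; rewrite -zu inE zp orbT.
by case: eqVneq => // zw; move: uwp'; rewrite -zw zp.
Qed.

Lemma shiftw_rcons p f u w : shiftw f u (rcons p w) = shift (shiftw f u p) (last u p) w.
Proof. by elim: p f u => [|v p IH] f u //=; exact: IH. Qed.

Lemma rotate_cycle n f c cs : proper f -> f c = None -> (1 < size cs)%N ->
  path edge c (rcons cs c) -> uniq (c :: cs) -> stuck ((size cs).+1 + n) f c ->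
  exists g, [/\ proper g, g c = None, stuck n g c, map g cs = rot 1 (map f cs) &
    forall z, z \notin c :: cs -> g z = f z].
Proof.
move=> pf fc s1 pc uc S.
have := stuck_walk pf fc pc; rewrite size_rcons => /(_ _ S).
rewrite last_rcons => -[pg gc Sg].
exists (shiftw f c (rcons cs c)); split => //; last first.
  move=> z zc; apply: shiftw_notin; move: zc; rewrite !inE mem_rcons inE !negb_or.
  by move=> /andP[-> ->].
rewrite shiftw_rcons; set g1 := shiftw f c cs.
have := map_shiftw uc fc; rewrite -/g1.
case: cs s1 {pc S pg gc Sg} uc @g1 => [//|a es] _ uc g1 g1E.
have [g1c g1es] : g1 c = f a /\ map g1 (a :: es) = rcons (map f es) None.
  by move: g1E; rewrite [X in X -> _]/= => -[g1c g1es]; split.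
have E : a :: es = rcons (belast a es) (last a es) by exact: lastI.
rewrite -[last c _]/(last a es) [X in rot 1 X]/= rot1_cons -g1c.
move: uc g1es; rewrite E; move: (last a es) (belast a es) => l es'.
rewrite cons_uniq mem_rcons inE negb_or rcons_uniq => /andP[/andP[cl ces] /andP[les ues]].
rewrite !map_rcons => /rcons_inj[<- _].
congr rcons; last by rewrite /shift eqxx.
apply/eq_in_map => z zes; rewrite /shift.
case: eqVneq => [zl|_]; first by move: les; rewrite -zl zes.
by case: eqVneq => // zc; move: ces; rewrite -zc zes.
Qed.

(** Only chords at the base [c] are excluded; the rest of the cycle may have some. *)
Definition chordless c cs := forall z, z \in cs -> z \in nbr c -> z = head c cs \/ z = last c cs.

(* One rotation of the hole changes only the colours on the cycle, and both before and
   after it the colours around the hole are a permutation of all colours. *)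
Lemma rotate_cycle_colors f c cs a : proper f -> f c = None -> (1 < size cs)%N ->
  path edge c (rcons cs c) -> uniq (c :: cs) -> chordless c cs ->
  stuck (size cs).+1 f c ->
  nth a (map f cs) 1 = last a (map f cs).
Proof.
move=> pf fc s1 pc uc ch S; rewrite -[(size cs).+1]addn0 in S.
have [g [pg gc Sg gcs gout]] := rotate_cycle pf fc s1 pc uc S.
have Hf := stuck0 S; have [finj fnN _] := fullP Hf.
have Hg := stuck0 Sg.
case: cs s1 pc uc ch gcs gout {S} => [//|c1 [//|c2 cs]] _ pc uc ch gcs gout.
move: (gcs); rewrite /= rot1_cons /= => -[gc1 _].
set l := last c (c1 :: c2 :: cs).
have lE : l = last c2 cs by [].
have lc : l \in nbr c.
  move: pc; rewrite rcons_path => /andP[_].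
  by rewrite /edge nbr_sym.
have c1c : c1 \in nbr c by move: pc => /= /andP[].
have l1 : l != c1.
  by apply/eqP => e; move: uc => /= /and3P[_ + _]; rewrite -e lE mem_last.
have gl : g l = f c1.
  have := congr1 (last (g c1)) gcs; rewrite last_map rot1_cons last_rcons => <-.
  by rewrite lE.
have [al Hal] : exists al, f l = Some al.
  by case E: (f l) (fnN _ lc) => [al|//] _; exists al.
have [y yc gy] := Hg al.
suff yc1 : y = c1 by rewrite /= last_map -gc1 -yc1 gy -Hal.
have [ycs|ycs] := boolP (y \in c1 :: c2 :: cs).
  have [->//|yl] := ch y ycs yc.
  have : f c1 = f l by rewrite -gl -[l]yl gy -Hal yl.
  by move=> /finj => /(_ c1c lc) e; move: l1; rewrite e eqxx.
have yl : y = l.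
  apply: finj => //; rewrite Hal -gy gout//.
  by rewrite inE negb_or ycs andbT nbr_neq.
by move: ycs; rewrite yl lE in_cons mem_last orbT.
Qed.

Lemma no_even_cycle f c cs : proper f -> f c = None ->
  path edge c (rcons cs c) -> uniq (c :: cs) -> chordless c cs ->
  odd (size cs) -> (1 < size cs)%N -> stuck ((size cs).+1 * (size cs).+1) f c -> False.
Proof.
move=> pf fc pc uc ch oL L1; set L := size cs => S.
have Hf := stuck0 S; have [_ fnN _] := fullP Hf.
have H k : (k <= L)%N ->
    exists g, [/\ proper g, g c = None, stuck (L.+1 * (L.+1 - k)) g c & map g cs = rot k (map f cs)].
  elim: k => [|k IH] kL; first by exists f; rewrite subn0 rot0.
  have [g [pg gc Sg gE]] := IH (ltnW kL).
  have [|g' [pg' gc' Sg' gE' _]] := @rotate_cycle (L.+1 * (L.+1 - k.+1)) g c cs pg gc L1 pc uc.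
    by rewrite -mulnS subSS -subSn//; exact: ltnW.
  exists g'; split => //; rewrite gE' gE -rotD ?add1n//.
  by rewrite size_map -/L.
pose s := map f cs; have sL : size s = L by rewrite size_map.
pose t j := nth None s (j %% L).
have L0 : (0 < L)%N by exact: ltnW.
have Hrot k i : (k <= L)%N -> (i < L)%N -> nth None (rot k s) i = t (i + k)%N.
  move=> kL iL; rewrite /t nth_cat size_drop sL nth_drop addnC.
  case: ltnP => ik; first by rewrite modn_small//; lia.
  rewrite nth_take; last by lia.
  have -> : (i + k = (i - (L - k)) + L)%N by lia.
  by rewrite modnDr modn_small//; lia.
have t2 j : (L <= j)%N -> (j < L + L)%N -> t j.+2 = t j.
  move=> Lj jL.
  have kL : ((j - L).+1 <= L)%N by lia.
  have [g [pg gc Sg gE]] := H _ kL.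
  have := @rotate_cycle_colors g c cs None pg gc L1 pc uc ch _.
  have S1 : stuck L.+1 g c.
    by apply: stuckS Sg; rewrite -[X in (X <= _)%N]muln1 leq_mul2l; lia.
  move=> /(_ S1); rewrite gE -nth_last size_rot sL !Hrot//; last by rewrite prednK.
  have -> : (1 + (j - L).+1)%N = ((L.-1 + (j - L).+1) + 2 - L)%N by lia.
  move=> e; rewrite -addn2; move: e; rewrite /t.
  have -> : (L.-1 + (j - L).+1 = j)%N by lia.
  by rewrite -{2}(@subnK L (j + 2)) ?modnDr//; lia.
have tL i : (i.*2 <= L.+1)%N -> t (L + i.*2)%N = t L.
  elim: i => [|i IH] iL; first by rewrite addn0.
  rewrite doubleS !addnS t2; [|lia|lia].
  by apply: IH; lia.
have e : t (L + L.+1)%N = t L.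
  have -> : L.+1 = (L.+1./2).*2 by rewrite -[LHS]odd_double_half /= oL.
  by apply: tL; rewrite -[X in (_ <= X)%N]odd_double_half /= oL.
move: e; rewrite /t (_ : L + L.+1 = 1 + L + L)%N; last by lia.
rewrite !modnDr modnn modn_small// /s => /esym.
case: cs L1 pc uc @L {S H s sL t L0 Hrot t2 tL oL ch} => [//|c1 [//|c2 cs]] _ /= pc _.
by move/and3P: pc => [cc1 c12 _]; apply: pf => //; exact: fnN.
Qed.

End HoleWalk.

(** * Exponential growth of the ball around a stuck hole *)

Ltac nat_lia := repeat match goal with
  | H : ?T |- _ => match T with
    | is_true (leq _ _) => fail 1
    | @eq nat _ _ => fail 1
    | nat => fail 1
    | _ => clear H
    end
  end; lia.

(** [N] moves bring the hole to any vertex of the ball; the square then pays for rotating a cycle of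
    at most [N.*2 + 8] vertices. *)
Definition room (N n0 : nat) : Prop := (N + (N.*2 + 8) * (N.*2 + 8) <= n0)%N.

Section StuckGrowth.
Context {V : eqType} (nbr : V -> seq V) (D : nat).
Hypothesis nbr_uniq : forall x, uniq (nbr x).
Hypothesis nbr_sym : forall x y, (y \in nbr x) = (x \in nbr y).
Hypothesis nbr_irr : forall x, x \notin nbr x.
Hypothesis nbr_size : forall x, (size (nbr x) <= D)%N.
Hypothesis D3 : (3 <= D)%N.
Hypothesis no_clique : forall s, uniq s -> size s = D.+1 ->
  ~ {in s &, forall x y, x != y -> y \in nbr x}.
Variables (f : V -> option 'I_D) (u : V) (N n0 : nat).
Hypothesis pf : proper nbr f.
Hypothesis fu : f u = None.
Hypothesis Sf : stuck nbr n0 f u.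
Hypothesis n0N : room N n0.
Implicit Types (x y z w c : V) (q s cs : seq V).
Local Notation edge := (edge nbr).

Definition lev n x := (exists p, [/\ path edge u p, last u p = x & size p = n]) /\
  forall p, path edge u p -> last u p = x -> (n <= size p)%N.

Lemma lev_inj n m x : lev n x -> lev m x -> n = m.
Proof.
move=> [[p [pp px pn]] Hn] [[q [qp qx qm]] Hm]; apply/eqP; rewrite eqn_leq.
by rewrite -{1}qm -{2}pn Hn// Hm.
Qed.

Lemma lev0 x : lev 0 x <-> x = u.
Proof.
split; first by move=> [[p [_ <- /size0nil->]] _].
by move=> ->; split; [exists [::]|].
Qed.

Lemma lev_path p : path edge u p -> exists2 n, (n <= size p)%N & lev n (last u p).
Proof.
move=> pp; pose P n := `[< exists q, [/\ path edge u q, last u q = last u p & size q = n] >].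
have exP : exists n, P n by exists (size p); apply/asboolP; exists p.
case: (ex_minnP exP) => n /asboolP Hn Hmin; exists n.
  by apply: Hmin; apply/asboolP; exists p.
by split => // q pq qx; apply: Hmin; apply/asboolP; exists q.
Qed.

Lemma lev_nbr n x y : lev n x -> y \in nbr x ->
  exists2 m, lev m y & (m <= n.+1)%N && (n <= m.+1)%N.
Proof.
move=> [[p [pp px pn]] Hn] yx.
have pp' : path edge u (rcons p y) by rewrite rcons_path pp px.
have [m] := lev_path pp'; rewrite size_rcons last_rcons pn => mn Lm; exists m => //.
rewrite mn/=; have [[q [qp qy qm]] _] := Lm.
have := Hn (rcons q x); rewrite rcons_path last_rcons size_rcons qp qy qm; apply => //.
by rewrite /edge nbr_sym.
Qed.

Lemma lev_nbr_le n m x y : lev n x -> lev m y -> y \in nbr x -> (n <= m.+1)%N.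
Proof.
move=> Ln Lm /(lev_nbr Ln)[k Lk /andP[_]].
by rewrite (lev_inj Lm Lk).
Qed.

Lemma lev_parent n x : lev n.+1 x -> exists2 p, p \in nbr x & lev n p.
Proof.
move=> [[p [pp px pn]] Hn]; case/lastP: p pp px pn => [//|p y].
rewrite last_rcons size_rcons rcons_path => /andP[pp yl] yx [pn].
exists (last u p); first by rewrite nbr_sym -yx.
have [m mp Lm] := lev_path pp; suff <- : m = n by [].
have [[q [qp qy qm]] _] := Lm.
have := Hn (rcons q x); rewrite rcons_path last_rcons size_rcons qp qy qm -yx.
move=> /(_ yl erefl); rewrite ltnS => nm.
by apply/eqP; rewrite eqn_leq nm andbT -pn.
Qed.

Lemma lev_full n x : (n <= N)%N -> lev n x -> size (nbr x) = D.
Proof.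
move=> nN [[p [pp px pn]] _].
have [_ _ S] : [/\ proper nbr (shiftw f u p), shiftw f u p (last u p) = None &
      stuck nbr 0 (shiftw f u p) (last u p)].
  by apply: stuck_walk => //; apply: stuckS Sf; rewrite pn; move: n0N; rewrite /room; lia.
by have [_ _] := fullP nbr_size (stuck0 S); rewrite px.
Qed.

Definition simple_cycle c cs := path edge c (rcons cs c) && uniq (c :: cs).

Lemma no_even n c cs : (n <= N)%N -> lev n c -> simple_cycle c cs -> chordless nbr c cs ->
  odd (size cs) -> (1 < size cs)%N -> (size cs <= N.*2 + 7)%N -> False.
Proof.
move=> nN [[p [pp <- pn]] _] /andP[pc uc] ch oc c1 cN.
have [pg gc S] : [/\ proper nbr (shiftw f u p), shiftw f u p (last u p) = None &
      stuck nbr ((size cs).+1 * (size cs).+1) (shiftw f u p) (last u p)].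
  apply: stuck_walk => //; apply: stuckS Sf; rewrite pn.
  apply: leq_trans n0N; apply: leq_add => //; apply: leq_mul; nat_lia.
by apply: (no_even_cycle nbr_sym nbr_irr nbr_size pg gc pc uc ch oc c1 S).
Qed.

(** Climb towards the hole from both parents until the two lines coincide. Equally many steps up and
    down make the path even, and each round uses a new level, which keeps it simple. It is the arc
    that closes the long even cycles below. *)
Lemma meet n x y p p' : lev n.+1 x -> lev n.+1 y ->
  p \in nbr x -> lev n p -> p' \in nbr y -> lev n p' ->
  exists q, [/\ path edge p q, last p q = p', uniq (p :: q), ~~ odd (size q) &
   [/\ (size q <= n.*2)%N, forall z, z \in p :: q -> exists2 m, (m <= n)%N & lev m z,
     forall z, z \in p :: q -> lev n z -> z = p \/ z = p' &
     p <> p' -> exists2 q', q = rcons q' p' & q' != [::]]].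
Proof.
elim: n x y p p' => [|n IH] x y p p' Lx Ly px Lp p'y Lp'.
  have -> : p' = p by rewrite (lev0 p').1// (lev0 p).1.
  exists [::]; split => //; split => // [z|z]; rewrite inE => /eqP->; first by exists 0%N.
  by left.
have [<-|/eqP pp'] := pselect (p = p').
  exists [::]; split => //; split => // [z|z]; rewrite inE => /eqP->; first by exists n.+1.
  by left.
have [r rp Lr] := lev_parent Lp; have [r' r'p' Lr'] := lev_parent Lp'.
have [q [pq lq uq oq [sq levq _ _]]] := IH _ _ _ _ Lp Lp' rp Lr r'p' Lr'.
have notlev z : lev n.+1 z -> z \notin r :: q.
  by move=> Lz; apply/negP => /levq[m mn /(lev_inj Lz)]; nat_lia.
exists (rcons (r :: q) p'); split.
- by rewrite /= [edge p r]rp rcons_path pq lq /= [edge _ _]nbr_sym.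
- by rewrite last_rcons.
- rewrite cons_uniq mem_rcons in_cons negb_or pp' notlev//.
  by rewrite rcons_uniq notlev.
- by rewrite size_rcons/= negbK.
- split.
  + by rewrite size_rcons /= doubleS !ltnS.
  + move=> z; rewrite inE mem_rcons inE => /or3P[/eqP->|/eqP->|/levq[m mn Lm]].
    * by exists n.+1.
    * by exists n.+1.
    * by exists m => //; exact: leqW.
  + move=> z; rewrite inE mem_rcons inE => /or3P[/eqP->|/eqP->|zq Lz]; [by left|by right|].
    by move: (notlev _ Lz); rewrite zq.
  + by move=> _; exists (r :: q).
Qed.

Lemma levNe n m x y : lev n x -> lev m y -> n <> m -> x != y.
Proof. by move=> Lx Ly nm; apply/eqP => xy; apply: nm; apply: (lev_inj Lx); rewrite xy. Qed.

Lemma levNeS n x y : lev n.+1 x -> lev n y -> x != y.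
Proof. by move=> Lx Ly; apply: (levNe Lx Ly); lia. Qed.

(** Two parents, the arc of [meet] between them and [x] form an even cycle. It has no chord at [x],
    since a neighbour of [x] on the arc must lie at level [n], where the arc has only its ends. *)
Lemma parent_unique n x p p' : (n < N)%N -> lev n.+1 x ->
  p \in nbr x -> lev n p -> p' \in nbr x -> lev n p' -> p = p'.
Proof.
move=> nN Lx px Lp p'x Lp'; apply: contrapT => pp'.
have [q [pq lq uq oq [sq levq levq2 Hq]]] := meet Lx Lx px Lp p'x Lp'.
have [q' qE q'0] := Hq pp'.
apply: (@no_even n.+1 x (p :: q)) => //; first (apply/andP; split).
- by rewrite /= rcons_path pq lq [edge x p]px /= [edge _ _]nbr_sym.
- rewrite cons_uniq uq andbT; apply/negP => /levq[m mn /(lev_inj Lx)]; nat_lia.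
- move=> z zq zx; rewrite /= lq; apply: levq2 => //.
  have [m mn Lm] := levq _ zq; have := lev_nbr_le Lx Lm zx.
  by rewrite ltnS => nm; have -> : n = m by nat_lia.
- by rewrite qE /= size_rcons.
- by rewrite /=; nat_lia.
Qed.

(** Otherwise there is an even cycle in every case, and its base is chosen so that uniqueness of
    parents rules out chords there: [x] if the parent of [y'] is not [p]; else [y] if [y] and [y']
    are not adjacent or if [p] and [py] are adjacent; else the parent [py]. *)
Lemma share_parent n x y y' p : (n < N)%N -> lev n.+1 x -> lev n.+1 y -> lev n.+1 y' ->
  y \in nbr x -> y' \in nbr x -> y != y' -> p \in nbr x -> lev n p -> p \in nbr y.
Proof.
move=> nN Lx Ly Ly' yx y'x yy' px Lp.
have [py pyy Lpy] := lev_parent Ly; have [py' py'y' Lpy'] := lev_parent Ly'.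
have [->//|ppy] := pselect (p = py); exfalso.
have xy : x != y by rewrite eq_sym; exact: (nbr_neq nbr_irr yx).
have xy' : x != y' by rewrite eq_sym; exact: (nbr_neq nbr_irr y'x).
have xNy : x \in nbr y by rewrite nbr_sym.
have xNy' : x \in nbr y' by rewrite nbr_sym.
have uniqp z a b : lev n.+1 z -> a \in nbr z -> lev n a -> b \in nbr z -> lev n b -> a = b.
  exact: parent_unique.
have eqp' : p = py'.
  apply: contrapT => ppy'.
  have [q [pq lq uq oq [sq levq levq2 Hq]]] := meet Ly Ly' pyy Lpy py'y' Lpy'.
  have notlev z : lev n.+1 z -> z \notin py :: q.
    by move=> Lz; apply/negP => /levq[m mn /(lev_inj Lz)]; nat_lia.
  apply: (@no_even n.+1 x (y :: rcons (py :: q) y')) => //; first (apply/andP; split).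
  - rewrite /= [edge x y]yx [edge y py]pyy /= !rcons_path pq lq last_rcons /=.
    by rewrite [edge py' y']nbr_sym py'y' [edge y' x]xNy'.
  - move: uq notlev; move: (py :: q) => S uS nS.
    by rewrite 2!cons_uniq rcons_uniq !in_cons !mem_rcons !in_cons !negb_or xy xy' yy' !nS.
  - move=> z; rewrite in_cons mem_rcons in_cons => /or3P[/eqP->|/eqP->|zq] zx; [by left| |].
      by right; rewrite /= last_rcons.
    have [m mn Lm] := levq _ zq; have := lev_nbr_le Lx Lm zx; rewrite ltnS => nm.
    have Lz : lev n z by have -> : n = m by nat_lia.
    have zp := uniqp _ _ _ Lx zx Lz px Lp.
    by case: (levq2 _ zq Lz) => e; [case: ppy|case: ppy']; rewrite -zp.
  - by rewrite /= size_rcons /= negbK.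
  - by rewrite /= size_rcons /=; nat_lia.
have py'P : p \in nbr y' by rewrite eqp'.
have npy : p \notin nbr y by apply/negP => H; apply: ppy; exact: (uniqp y).
have [q [pq lq uq oq [sq levq levq2 Hq]]] := meet Ly' Ly py'P Lp pyy Lpy.
have notlev z : lev n.+1 z -> z \notin p :: q.
  by move=> Lz; apply/negP => /levq[m mn /(lev_inj Lz)]; nat_lia.
have [yNy'|yNy'] := boolP (y' \in nbr y); last first.
  apply: (@no_even n.+1 y (x :: y' :: p :: q)) => //; first (apply/andP; split).
  - rewrite /= [edge y x]xNy [edge x y']y'x [edge y' p]py'P /= rcons_path pq lq /=.
    by rewrite [edge _ _]nbr_sym.
  - move: uq notlev; move: (p :: q) => S uS nS.
    by rewrite 3!cons_uniq uS !in_cons !negb_or xy' (eq_sym y) xy yy' !nS.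
  - move=> z; rewrite in_cons in_cons => /or3P[/eqP->|/eqP->|zq] zy; [by left| |].
      by move: yNy'; rewrite zy.
    have [m mn Lm] := levq _ zq; have := lev_nbr_le Ly Lm zy; rewrite ltnS => nm.
    have Lz : lev n z by have -> : n = m by nat_lia.
    right; rewrite /= lq; exact: (uniqp y).
  - by rewrite /= !negbK.
  - by rewrite /=; nat_lia.
have [ppE|nppE] := boolP (py \in nbr p).
  apply: (@no_even n.+1 y [:: x; p; py]) => //; first (apply/andP; split).
  - by rewrite /= [edge y x]xNy [edge x p]px [edge p py]ppE [edge _ _]nbr_sym pyy.
  - rewrite /= !inE !negb_or (eq_sym y x) xy (levNeS Ly Lp)// (levNeS Ly Lpy)//.
    by rewrite (levNeS Lx Lp)// (levNeS Lx Lpy)//= andbT; apply/eqP.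
  - move=> z; rewrite !inE => /or3P[/eqP->|/eqP->|/eqP->] zy; [by left| |by right].
    by move: npy; rewrite zy.
  - by rewrite addnC.
have [q' qE q'0] := Hq ppy.
case: n Lx Ly Ly' Lp Lpy Lpy' nN {Hq} sq levq levq2 notlev uniqp
    => [|n] Lx Ly Ly' Lp Lpy Lpy' nN sq levq levq2 notlev uniqp.
  by move: ppy; rewrite (lev0 p).1// (lev0 py).1.
have upy : py \notin p :: q'.
  by move: uq; rewrite qE -rcons_cons rcons_uniq => /andP[].
apply: (@no_even n.+1 py (y :: x :: y' :: p :: q')) => //.
- exact: ltnW.
- apply/andP; split.
- have [pq' eq'] : path edge p q' /\ edge (last p q') py.
    by move: pq; rewrite qE rcons_path => /andP[].
  rewrite /= [edge py y]nbr_sym pyy [edge y x]xNy [edge x y']y'x [edge y' p]py'P /=.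
  by rewrite rcons_path pq' eq'.
- have nl z : lev n.+2 z -> z \notin p :: q'.
    move=> /notlev; rewrite qE -rcons_cons mem_rcons in_cons negb_or.
    by case/andP.
  move: uq; rewrite qE -rcons_cons rcons_uniq => /andP[_ uq'].
  move: uq' nl upy; move: (p :: q') => S uS nS pyS.
  rewrite 4!cons_uniq uS !in_cons !negb_or pyS !nS// yy' xy' (eq_sym y x) xy.
  by rewrite (eq_sym py y) (eq_sym py x) (eq_sym py y') (levNeS Ly Lpy)// (levNeS Lx Lpy)// (levNeS Ly' Lpy).
- have lastq : last p q' \in nbr py.
    by move: pq; rewrite qE rcons_path => /andP[_]; rewrite /edge nbr_sym.
  have levq' z : z \in p :: q' -> z \in nbr py -> lev n z.
    move=> zq' zpy; have zq : z \in p :: q by rewrite qE -rcons_cons mem_rcons in_cons zq' orbT.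
    have [m mn Lm] := levq _ zq; have := lev_nbr_le Lpy Lm zpy; rewrite ltnS => nm.
    have [e|e] : m = n.+1 \/ n = m by nat_lia.
      2: by rewrite e.
    exfalso; rewrite e in Lm; case: (levq2 _ zq Lm) => ze.
      by move: nppE; rewrite nbr_sym -ze zpy.
    by move: upy; rewrite -ze zq'.
  have nch z : lev n.+2 z -> z \in nbr py -> p \in nbr z -> False.
    move=> Lz zpy pz; apply: ppy; apply: (uniqp z) => //.
    by rewrite nbr_sym.
  move=> z; rewrite 3!in_cons => /or4P[/eqP->|/eqP->|/eqP->|zq] zpy; [by left| | |].
  + by case: (nch x).
  + by case: (nch y').
  + right; rewrite [last _ _]/(last p q'); apply: (@parent_unique n py) => //.
    * exact: ltnW.
    * exact: levq'.
    * by apply: levq' => //; exact: mem_last.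
- by move: oq; rewrite qE size_rcons /= !negbK.
- by move: sq; rewrite qE size_rcons /=; nat_lia.
Qed.

(** With a common parent [p], non-adjacent [y] and [y'] would lie on the 4-cycle [y], [x], [y'],
    [p], chordless at [y]. *)
Lemma siblings_adj n x y y' : (n < N)%N -> lev n.+1 x -> lev n.+1 y -> lev n.+1 y' ->
  y \in nbr x -> y' \in nbr x -> y != y' -> y' \in nbr y.
Proof.
move=> nN Lx Ly Ly' yx y'x yy'; apply: contrapT => /negP nyy'.
have [p px Lp] := lev_parent Lx.
have py : p \in nbr y by apply: (@share_parent n x y y').
have py' : p \in nbr y' by apply: (@share_parent n x y' y) => //; rewrite eq_sym.
have xy : x != y by rewrite eq_sym; exact: (nbr_neq nbr_irr yx).
have xy' : x != y' by rewrite eq_sym; exact: (nbr_neq nbr_irr y'x).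
apply: (@no_even n.+1 y [:: x; y'; p]) => //; first (apply/andP; split).
- rewrite /= [edge y x]nbr_sym yx [edge x y']y'x [edge y' p]py' [edge p y]nbr_sym.
  by rewrite py.
- rewrite /= !inE !negb_or eq_sym xy yy' xy' (levNeS Ly Lp)// (levNeS Lx Lp)//.
  by rewrite (levNeS Ly' Lp).
- move=> z; rewrite !inE => /or3P[/eqP->|/eqP->|/eqP->] zy; [by left| |by right].
  by move: nyy'; rewrite zy.
- by rewrite addnC.
Qed.

(** Otherwise a parent [w] of [y'] differs from [x], and the cycle from [y] through [y'], [w], [x']
    and [x] is even; by uniqueness of parents it has no chord at [y]. *)
Lemma cousin n x y x' y' : (n.+1 < N)%N -> lev n.+1 x -> lev n.+1 x' -> x' \in nbr x ->
  lev n.+2 y -> y \in nbr x -> lev n.+2 y' -> y' \in nbr y -> x \in nbr y'.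
Proof.
move=> nN Lx Lx' x'x Ly yx Ly' y'y; apply: contrapT => /negP nxy'.
have [w wy' Lw] := lev_parent Ly'.
have xy : x \in nbr y by rewrite nbr_sym.
have xw : x != w by apply/eqP => e; move: nxy'; rewrite e wy'.
have yy' : y != y' by rewrite eq_sym; exact: (nbr_neq nbr_irr y'y).
have xx' : x != x' by rewrite eq_sym; exact: (nbr_neq nbr_irr x'x).
have nwy : w \notin nbr y.
  by apply/negP => wy; move: xw; rewrite (@parent_unique n.+1 y x w) ?eqxx.
have [e|/eqP wx'] := pselect (w = x').
  apply: (@no_even n.+2 y [:: y'; w; x]) => //; first (apply/andP; split).
  - rewrite /= [edge y y']y'y [edge y' w]wy' [edge x y]yx [edge w x]nbr_sym.
    by rewrite e x'x.
  - rewrite /= !inE !negb_or yy' (levNeS Ly Lw)// (levNeS Ly Lx)// (levNeS Ly' Lw)//.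
    by rewrite (levNeS Ly' Lx)// eq_sym xw.
  - move=> z; rewrite !inE => /or3P[/eqP->|/eqP->|/eqP->] zy; [by left| |by right].
    by move: nwy; rewrite zy.
  - by rewrite addnC.
have [p pw Lp] := lev_parent Lw; have [p' p'x' Lp'] := lev_parent Lx'.
have [q [pq lq uq oq [sq levq levq2 Hq]]] := meet Lw Lx' pw Lp p'x' Lp'.
have notlev k z : lev k z -> (n < k)%N -> z \notin p :: q.
  by move=> Lz nk; apply/negP => /levq[m mn /(lev_inj Lz)]; nat_lia.
apply: (@no_even n.+2 y (y' :: w :: rcons (rcons (p :: q) x') x)) => //; first (apply/andP; split).
- rewrite /= !rcons_path !last_rcons [edge y y']y'y [edge y' w]wy' [edge w p]pw pq lq /=.
  by rewrite [edge p' x']nbr_sym p'x' [edge x' x]nbr_sym x'x [edge x y]yx.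
- move: uq notlev; move: (p :: q) => S uS notlev.
  rewrite 3!cons_uniq 2!rcons_uniq uS !in_cons !mem_rcons !in_cons !mem_rcons !in_cons !negb_or.
  rewrite !(notlev _ _ Ly)// !(notlev _ _ Ly')//.
  rewrite !(notlev _ _ Lx)// !(notlev _ _ Lx')// !(notlev _ _ Lw)//.
  rewrite yy' (levNeS Ly Lw)// (levNeS Ly Lx)// (levNeS Ly Lx')// (levNeS Ly' Lx)//.
  by rewrite (levNeS Ly' Lw)// (levNeS Ly' Lx')// (eq_sym w x) xw wx' xx'.
- have nx' : x' \notin nbr y.
    by apply/negP => x'y; move: xx'; rewrite (@parent_unique n.+1 y x x') ?eqxx.
  move: levq; move: (p :: q) => S levq z.
  rewrite !in_cons !mem_rcons !in_cons !mem_rcons !in_cons.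
  move=> /orP[/eqP->|/orP[/eqP->|/orP[/eqP->|/orP[/eqP->|zq]]]] zy.
  + by left.
  + by move: nwy; rewrite zy.
  + by right; rewrite /= last_rcons.
  + by move: nx'; rewrite zy.
  + by have [m mn Lm] := levq _ zq; have := lev_nbr_le Ly Lm zy; nat_lia.
- by rewrite /= !size_rcons /= !negbK.
- by rewrite /= !size_rcons /=; nat_lia.
Qed.

Lemma nbr_levels n x y p : (n < N)%N -> lev n.+1 x -> p \in nbr x -> lev n p ->
  y \in nbr x -> y != p -> lev n.+1 y \/ lev n.+2 y.
Proof.
move=> nN Lx px Lp yx yp; have [m Lm /andP[m1 m2]] := lev_nbr Lx yx.
have [e|[e|e]] : m = n.+2 \/ m = n.+1 \/ m = n by nat_lia.
- by right; rewrite -e.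
- by left; rewrite -e.
by rewrite e in Lm; move: yp; rewrite (@parent_unique n x y p) ?eqxx.
Qed.

(** Without a child, [x], its parent and its [D.-1] other neighbours form a clique of [D.+1]
    vertices. [D3] gives each of those neighbours a second one, as [share_parent] needs. *)
Lemma has_child n x : (n < N)%N -> lev n.+1 x -> exists2 y, y \in nbr x & lev n.+2 y.
Proof.
move=> nN Lx; apply: contrapT => nc; have [p px Lp] := lev_parent Lx.
pose S := rem p (nbr x).
have SE : size S = D.-1 by rewrite size_rem// (lev_full _ Lx).
have memS z : (z \in S) = (z != p) && (z \in nbr x) by rewrite mem_rem_uniq.
have LS z : z \in S -> lev n.+1 z.
  rewrite memS => /andP[zp zx]; have [//|Lz] := nbr_levels nN Lx px Lp zx zp.
  by case: nc; exists z.
have Snbr z : z \in S -> z \in nbr x by rewrite memS => /andP[].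
have other z : z \in S -> exists2 z', z' \in S & z != z'.
  move=> zS; have : has (predC1 z) S.
    rewrite has_predC; apply/negP => /all_pred1P SE'.
    have D1 : (1 < D.-1)%N by move: D3; clear; lia.
    have : uniq (nseq D.-1 z) by rewrite -SE -SE'; exact: rem_uniq.
    by move: D1; case: D.-1 => [|[|k]] //=; rewrite inE eqxx.
  by move=> /hasP[z' z'S /= zz']; exists z' => //; rewrite eq_sym.
have SP z : z \in S -> p \in nbr z.
  move=> zS; have [z' z'S zz'] := other z zS.
  by apply: (@share_parent n x z z') => //; auto.
apply: (@no_clique (p :: x :: S)).
- rewrite /= !inE negb_or eq_sym (levNeS Lx Lp)// memS eqxx/= memS negb_and (nbr_irr x) orbT.
  exact: rem_uniq.
- by rewrite /= SE; move: D3; clear; lia.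
- have adjp z : z \in x :: S -> p \in nbr z by rewrite inE => /orP[/eqP->//|/SP].
  move=> a b; rewrite !inE => /or3P[/eqP->|/eqP->|aS] /or3P[/eqP->|/eqP->|bS]; rewrite ?eqxx// => ab.
  + by rewrite nbr_sym.
  + by rewrite nbr_sym SP.
  + exact: Snbr.
  + exact: SP.
  + by rewrite nbr_sym Snbr.
  + by apply: (@siblings_adj n x a b); auto.
Qed.

(** Two children have children of their own, distinct because parents are unique. If [y] is the only
    child, degree at least 3 gives [x] a neighbour [x'] on its own level; by [cousin], [y] then has
    no neighbour on its level, so its [D.-1] neighbours other than [x] are all grandchildren. *)
Lemma two_grandchildren n x : (n.+2 < N)%N -> lev n.+1 x ->
  exists z z', [/\ z != z', lev n.+3 z, lev n.+3 z',
    exists2 w, lev n.+2 w & (w \in nbr x) && (z \in nbr w) &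
    exists2 w, lev n.+2 w & (w \in nbr x) && (z' \in nbr w)].
Proof.
move=> nN Lx; have n1N := ltnW nN; have n0N' := ltnW n1N.
have [y yx Ly] := has_child n0N' Lx.
have [z0 z0y Lz0] := has_child n1N Ly.
have [[y' y'x [Ly' yy']]|H] := pselect (exists2 y', y' \in nbr x & lev n.+2 y' /\ y != y').
  have [z1 z1y Lz1] := has_child n1N Ly'.
  exists z0, z1; split => //; [|by exists y => //; rewrite yx|by exists y' => //; rewrite y'x].
  apply/eqP => e; move: yy'; rewrite (@parent_unique n.+2 z0 y y') ?eqxx//.
    by rewrite nbr_sym.
  by rewrite e nbr_sym.
have uy y' : y' \in nbr x -> lev n.+2 y' -> y' = y.
  by move=> ? ?; apply: contrapT => /eqP; rewrite eq_sym => ?; apply: H; exists y'.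
have [p px Lp] := lev_parent Lx.
have [x' x'x Lx'] : exists2 x', x' \in nbr x & lev n.+1 x'.
  have py : p != y by apply: (levNe Lp Ly); lia.
  have : (0 < size (rem y (rem p (nbr x))))%N.
    rewrite size_rem ?size_rem// ?(lev_full _ Lx)//; first by move: D3; clear; lia.
    by rewrite mem_rem_uniq// inE eq_sym py.
  case E : (rem _ _) => [//|x' t] _; exists x'.
    by apply: (@mem_rem _ p); apply: (@mem_rem _ y); rewrite E mem_head.
  have : x' \in rem y (rem p (nbr x)) by rewrite E mem_head.
  rewrite mem_rem_uniq ?rem_uniq// inE mem_rem_uniq// inE => /and3P[x'y x'p x'x].
  have [//|Lx'] := nbr_levels n0N' Lx px Lp x'x x'p.
  by move: x'y; rewrite (uy x')// eqxx.
have xy : x \in nbr y by rewrite nbr_sym.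
have child z : z \in nbr y -> z != x -> lev n.+3 z.
  move=> zy zx; have [Lz|//] := nbr_levels n1N Ly xy Lx zy zx.
  have xz : x \in nbr z by apply: (@cousin n x y x' z).
  have e : z = y by apply: uy => //; rewrite nbr_sym.
  by move: zy; rewrite e (negPf (nbr_irr y)).
have : (1 < size (rem x (nbr y)))%N.
  by rewrite size_rem// (lev_full _ Ly)//; move: D3; clear; lia.
have ur : uniq (rem x (nbr y)) by exact: rem_uniq.
case E : (rem _ _) ur => [//|z [//|z' t]] /= /andP[+ _] _.
rewrite inE negb_or => /andP[zz' _].
have [zr z'r] : z \in rem x (nbr y) /\ z' \in rem x (nbr y).
  by rewrite E !inE !eqxx orbT.
move: zr z'r; rewrite !mem_rem_uniq// !inE => /andP[zx zy] /andP[z'x z'y].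
exists z, z'; split => //; [exact: child|exact: child| |]; exists y => //; rewrite yx//.
Qed.

Lemma grandparent_unique n x x' w w' z : (n.+2 < N)%N -> lev n.+1 x -> lev n.+1 x' ->
  lev n.+2 w -> lev n.+2 w' -> lev n.+3 z -> w \in nbr x -> w' \in nbr x' ->
  z \in nbr w -> z \in nbr w' -> x = x'.
Proof.
move=> nN Lx Lx' Lw Lw' Lz wx w'x' zw zw'.
have ww' : w = w' by apply: (@parent_unique n.+2 z) => //; rewrite nbr_sym.
by apply: (@parent_unique n.+1 w) => //; rewrite 1?nbr_sym// 1?ww'// ltnW.
Qed.

Lemma double_level n s : (n.+2 < N)%N -> uniq s -> (forall x, x \in s -> lev n.+1 x) ->
  exists t, [/\ uniq t, size t = (size s).*2 & forall z, z \in t -> lev n.+3 z /\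
    exists x w, [/\ x \in s, lev n.+2 w, w \in nbr x & z \in nbr w]].
Proof.
move=> nN; elim: s => [|x s IH] /=; first by exists [::].
move=> /andP[xs us] Ls.
have [|t [ut st Ht]] := IH us; first by move=> y ys; apply: Ls; rewrite inE ys orbT.
have Lx : lev n.+1 x by apply: Ls; rewrite mem_head.
have [z [z' [zz' Lz Lz' [w Lw /andP[wx zw]] [w' Lw' /andP[w'x z'w']]]]] := two_grandchildren nN Lx.
have notin a b : lev n.+3 a -> lev n.+2 b -> b \in nbr x -> a \in nbr b -> a \notin t.
  move=> La Lb bx ab; apply/negP => /Ht[_ [x1 [b1 [x1s Lb1 b1x1 ab1]]]].
  move: xs; rewrite (@grandparent_unique n x x1 b b1 a) ?x1s//.
  by apply: Ls; rewrite inE x1s orbT.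
exists (z :: z' :: t); split.
- by rewrite /= inE negb_or zz' ut (notin z w)// (notin z' w').
- by rewrite /= st.
- move=> a; rewrite !inE => /or3P[/eqP->|/eqP->|/Ht[La [x1 [b [x1s Lb bx1 ab]]]]]; split => //.
  + by exists x, w; rewrite mem_head.
  + by exists x, w'; rewrite mem_head.
  + by exists x1, b; rewrite inE x1s orbT.
Qed.

Lemma stuck_growth k : (k.*2.+1 <= N)%N ->
  exists s, [/\ uniq s, size s = (2 ^ k)%N & forall x, x \in s -> lev k.*2.+1 x].
Proof.
elim: k => [|k IH] kN.
  have Lu : lev 0 u by apply/lev0.
  have := lev_full (leq0n _) Lu; case E : (nbr u) => [|x t]; first by move=> D0; move: D3; rewrite -D0.
  move=> _; exists [:: x]; split => // y; rewrite inE => /eqP->.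
  have xu : x \in nbr u by rewrite E mem_head.
  have [m Lx /andP[m1 _]] := lev_nbr Lu xu; case: m Lx m1 => [|[|m]] // Lx _.
  by move: (nbr_neq nbr_irr xu); rewrite (lev0 x).1// eqxx.
have [|s [us ss Ls]] := IH; first by nat_lia.
have [|t [ut st Ht]] := @double_level k.*2 s _ us Ls; first by nat_lia.
exists t; split => //; first by rewrite st ss expnS mul2n.
by move=> x /Ht[].
Qed.

End StuckGrowth.

(** * Borel enumeration of neighbours *)

Section BorelNeighbors.
Context {d : measure_display} {V : measurableType d} {R : realType}.
Implicit Types (adj : V -> V -> Prop) (h : V -> R) (nu : nat -> V -> V) (A B : set V).

(* [nu i x], [i < D], enumerates the neighbours of [x] without repetition;
   the unused indices are sent to [x] itself. *)
Record borel_nbr adj (D : nat) h nu : Prop := BorelNbr {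
  bn_h : measurable_fun setT h;
  bn_hinj : injective h;
  bn_nu : forall i, measurable_fun setT (nu i);
  bn_sym : forall x y, adj x y -> adj y x;
  bn_irr : forall x, ~ adj x x;
  bn_big : forall i x, (D <= i)%N -> nu i x = x;
  bn_adj : forall i x, nu i x <> x -> adj x (nu i x);
  bn_ex : forall x y, adj x y -> exists2 i, (i < D)%N & nu i x = y;
  bn_uniq : forall i j x, nu i x <> x -> nu i x = nu j x -> i = j }.

Lemma size_le_deg adj x (s : seq V) : finite_set (nbhd adj x) -> uniq s ->
  (forall y, y \in s -> adj x y) -> (size s <= deg adj x)%N.
Proof.
move=> fx us sx; rewrite /deg; apply: uniq_leq_size => // y ys.
by rewrite in_fset_set// inE; exact: sx.
Qed.

Lemma exists_borel_nbr adj D : @standard_borel d V R -> borel_graph adj ->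
  (forall x, finite_set (nbhd adj x) /\ (deg adj x <= D)%N) ->
  exists h nu, borel_nbr adj D h nu.
Proof.
move=> [h [B [mB [mh [hinj [hB himg]]]]]] [asym [airr madj]] degD.
(* [k] is a Borel left inverse of [h], constant off the range; through it the edge set becomes a
   Borel subset of the plane. *)
have /choice[k Hk] : forall r : R, exists v : V, (B r -> h v = r) /\ (~ B r -> v = point).
  move=> r; have [Br|nBr] := pselect (B r); last by exists point.
  by move: (Br); rewrite -hB => -[v _ hv]; exists v; split => // nBr; case: nBr; exists v.
have kh x : k (h x) = x.
  by apply: hinj; have [+ _] := Hk (h x); apply; rewrite -hB; exists x.
have mk : measurable_fun setT k.
  move=> _ Y mY; rewrite setTI.
  have [Yp|nYp] := pselect (Y point).
    have -> : k @^-1` Y = (h @` Y) `|` ~` B.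
      apply/seteqP; split => r /=.
        by have [Br Yk|nBr _] := pselect (B r); [left; exists (k r) => //; exact: (Hk r).1|right].
      by move=> [[v Yv <-]|nBr]; [rewrite kh|rewrite (Hk r).2].
    by apply: measurableU; [exact: himg|exact: measurableC].
  have -> : k @^-1` Y = h @` Y.
    apply/seteqP; split => r /=; last by move=> [v Yv <-]; rewrite kh.
    have [Br Yk|nBr] := pselect (B r); first by exists (k r) => //; exact: (Hk r).1.
    by rewrite (Hk r).2.
  exact: himg.
pose E := [set p : R * R | B p.1 /\ B p.2 /\ adj (k p.1) (k p.2)].
have mE : measurable E.
  have -> : E = (fst @^-1` B) `&` ((snd @^-1` B) `&`
      ((fun p => (k p.1, k p.2)) @^-1` [set p | adj p.1 p.2])) by [].
  apply: measurableI; first exact: measurable_preT.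
  apply: measurableI; first exact: measurable_preT.
  apply: measurable_preT => //.
  by apply: measurable_fun_pair; apply: measurableT_comp.
have Es : small_section D E.
  move=> x s us sE; have [fx dx] := degD (k x).
  apply: leq_trans dx; rewrite -(size_map k s); apply: size_le_deg => //.
    rewrite map_inj_in_uniq// => a b /sE[_ [Ba _]] /sE[_ [Bb _]] kab.
    by rewrite -((Hk a).1 Ba) -((Hk b).1 Bb) kab.
  by move=> _ /mapP[b /sE[_ [_ ?]] ->].
have [nu [De [mDe mnu nuP nuU]]] := lusin_novikov mE Es.
have Ead x y : E (h x, h y) <-> adj x y.
  rewrite /E/= !kh; split; first by case=> _ [].
  by move=> xy; rewrite -!hB; split; [exists x|split => //; exists y].
have EB r s : E (r, s) -> h (k s) = s by move=> [_ [Bs _]]; exact: (Hk s).1.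
pose nu' i x := if (i < D)%N && `[< De i (h x) >] then k (nu i (h x)) else x.
have nu'E i x : nu' i x <> x ->
    [/\ (i < D)%N, De i (h x), E (h x, nu i (h x)) & nu' i x = k (nu i (h x))].
  rewrite /nu'; case: ifP => // /andP[iD /asboolP Di] _; split => //.
  by apply/nuP; exists i.
exists h, nu'; split => //.
- move=> i; rewrite /nu'; case: (ltnP i D) => iD /=; last exact: measurable_id.
  apply: measurable_fun_ifT => //; last first.
    by apply: measurableT_comp => //; exact: measurableT_comp.
  apply: (measurable_fun_bool true); rewrite setTI.
  rewrite (_ : _ @^-1` _ = h @^-1` De i); first exact: measurable_preT.
  by apply/seteqP; split => x /=; [move=> /asboolP|move=> ?; apply/asboolP].
- by move=> i x Di; rewrite /nu' ltnNge Di.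
- by move=> i x /nu'E[iD Di Ei ->]; apply/Ead; rewrite (EB _ _ Ei).
- move=> x y xy; have /nuP[i [iD Di nui]] := (Ead x y).2 xy.
  exists i => //; rewrite /nu' iD/=; have -> : `[< De i (h x) >] by apply/asboolP.
  by rewrite nui kh.
- move=> i j x ix; have [iD Di Ei ei] := nu'E _ _ ix => eij.
  have jx : nu' j x <> x by rewrite -eij.
  have [jD Dj Ej ej] := nu'E _ _ jx.
  apply: (nuU (h x)) => //; rewrite -(EB _ _ Ei) -(EB _ _ Ej).
  by rewrite -ei -ej eij.
Qed.

Lemma measurable_bigcup_count (I : countType) (F : I -> set V) :
  (forall i, measurable (F i)) -> measurable (\bigcup_i F i).
Proof.
move=> mF; pose G n := if unpickle n is Some i then F i else set0.
rewrite (_ : \bigcup_i F i = \bigcup_n G n).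
  by apply: bigcupT_measurable => n; rewrite /G; case: unpickle.
apply/seteqP; split => x.
  by move=> [i _ Fi]; exists (pickle i) => //; rewrite /G pickleK.
by move=> [n _]; rewrite /G; case: unpickle => [i Fi|//]; exists i.
Qed.

Lemma measurable_bigcap_count (I : countType) (F : I -> set V) :
  (forall i, measurable (F i)) -> measurable (\bigcap_i F i).
Proof.
move=> mF; rewrite -[X in measurable X]setCK setC_bigcap; apply: measurableC.
by apply: measurable_bigcup_count => i; exact: measurableC.
Qed.

Fixpoint walk nu (s : seq nat) (x : V) : V :=
  if s is i :: s' then walk nu s' (nu i x) else x.

Lemma walk_cat nu s t x : walk nu (s ++ t) x = walk nu t (walk nu s x).
Proof. by elim: s x => //= i s IH x; exact: IH. Qed.

Lemma same_component_rcons adj x y z : same_component adj x y -> adj y z ->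
  same_component adj x z.
Proof.
move=> [n [p [p0 [pn pP]]]] yz; exists n.+1, (fun k => if (k <= n)%N then p k else z).
split => //; split; first by rewrite ltnn.
move=> i; rewrite ltnS => lin; rewrite lin; case: ltnP => ni; first exact: pP.
have -> : i = n by apply/eqP; rewrite eqn_leq lin.
by rewrite pn.
Qed.

Section Walks.
Variables (adj : V -> V -> Prop) (D : nat) (h : V -> R) (nu : nat -> V -> V).
Hypothesis G : borel_nbr adj D h nu.
Local Notation walk := (walk nu).

Lemma measurable_walk s : measurable_fun setT (walk s).
Proof.
elim: s => [|i s IH] /=; first exact: measurable_id.
by apply: measurableT_comp => //; exact: bn_nu G i.
Qed.

Lemma measurable_eqset (f g : V -> V) : measurable_fun setT f -> measurable_fun setT g ->
  measurable [set x | f x = g x].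
Proof.
move=> mf mg; have mh := bn_h G.
have := measurable_fun_eqr (measurableT_comp mh mf) (measurableT_comp mh mg).
move=> /(_ measurableT [set true]); rewrite setTI => /(_ Logic.I).
rewrite (_ : _ @^-1` _ = [set x | f x = g x])//.
by apply/seteqP; split => x /=; [move=> /eqP/(bn_hinj G)|move=> ->; rewrite eqxx].
Qed.

Lemma walk_component s x : same_component adj x (walk s x).
Proof.
elim/last_ind: s => [|s i IH]; first by exists 0%N, (fun=> x).
rewrite -cats1 walk_cat /=; have [->//|ne] := pselect (nu i (walk s x) = walk s x).
exact: same_component_rcons IH (bn_adj G ne).
Qed.

Lemma nu_rev i x : exists j, nu j (nu i x) = x.
Proof.
have [e|ne] := pselect (nu i x = x); first by exists i; rewrite e.
have [j _ Hj] := bn_ex G (bn_sym G (bn_adj G ne)); by exists j.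
Qed.

Lemma walk_rev s x : exists2 t, size t = size s & walk t (walk s x) = x.
Proof.
elim: s x => [|i s IH] x /=; first by exists [::].
have [t st Ht] := IH (nu i x); have [j Hj] := nu_rev i x.
by exists (rcons t j); rewrite ?size_rcons ?st// -cats1 walk_cat Ht.
Qed.

(** Walks can be retraced, so an image is a countable union over return walks; hence images of Borel
    sets are Borel. *)
Lemma walk_imageE s A : walk s @` A =
  \bigcup_t (walk t @^-1` A `&` [set y | walk s (walk t y) = y]).
Proof.
apply/seteqP; split => y.
  move=> [x Ax <-]; have [t _ Ht] := walk_rev s x.
  by exists t => //; split; rewrite /= Ht.
by move=> [t _ [/= At e]]; exists (walk t y).
Qed.

Lemma measurable_walk_image s A : measurable A -> measurable (walk s @` A).
Proof.
move=> mA; rewrite walk_imageE; apply: measurable_bigcup_count => t.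
apply: measurableI; first exact: measurable_preT (measurable_walk t) mA.
apply: (@measurable_eqset (walk s \o walk t) id); last exact: measurable_id.
by apply: measurableT_comp; exact: measurable_walk.
Qed.

(** The letter [D] stands still by [bn_big], so words of length exactly [n] also realise all shorter
    walks. *)
Definition letters := iota 0 D.+1.
Arguments letters : simpl never.

Fixpoint words n : seq (seq nat) := if n is m.+1 then
  [seq i :: s | i <- letters, s <- words m] else [:: [::]].

Lemma mem_words n s : (s \in words n) = (size s == n) && all (fun i => (i <= D)%N) s.
Proof.
have memL i : (i \in letters) = (i <= D)%N by rewrite mem_iota add0n ltnS.
elim: n s => [|n IH] s; first by case: s.
apply/allpairsP/idP => [[[j t] [jD tw ->]]|].
  by move: jD tw; rewrite [_.1]/= [_.2]/= memL IH /= eqSS andbCA => -> ->.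
case: s => [//|i s]; rewrite /= eqSS => /and3P[sn iD sD].
by exists (i, s); rewrite memL IH sn.
Qed.

Lemma uniq_words n : uniq (words n).
Proof.
elim: n => [//|n IH]; rewrite /words -/words; apply: allpairs_uniq => //.
  exact: iota_uniq.
by move=> [? ?] [? ?] _ _ /= [-> ->].
Qed.

Lemma words_walk n s : (size s <= n)%N -> exists2 t, t \in words n & forall x, walk t x = walk s x.
Proof.
move=> sn; exists (map (minn D) s ++ nseq (n - size s) D).
  rewrite mem_words size_cat size_map size_nseq subnKC// eqxx all_cat/=.
  apply/andP; split; last by apply/allP => i /nseqP[->].
  by apply/allP => _ /mapP[i _ ->]; rewrite geq_minl.
move=> x; rewrite walk_cat.
have nuD y : nu D y = y by apply: bn_big G _ _ _.
have -> y : walk (nseq (n - size s) D) y = y.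
  by elim: (n - size s)%N => //= k IH; rewrite nuD.
elim: s x {sn} => //= i s IH x; rewrite -IH; congr walk.
by case: (leqP D i) => Di //; rewrite nuD (bn_big G).
Qed.

Definition separated n A := forall x y, A x -> A y -> x <> y ->
  forall s, (size s <= n)%N -> walk s x <> y.

Lemma separatedS n A B : A `<=` B -> separated n B -> separated n A.
Proof. by move=> AB sB x y /AB Bx /AB By; exact: sB. Qed.

Lemma separated_inj n A s x y : separated n A -> (size s + size s <= n)%N ->
  A x -> A y -> walk s x = walk s y -> x = y.
Proof.
move=> sA sn Ax Ay e; apply: contrapT => xy; have [t ts Ht] := walk_rev s y.
by apply: (sA _ _ Ax Ay xy (s ++ t)); rewrite ?size_cat ?ts// walk_cat e.
Qed.

(** Each piece consists of the points of [I k] whose [n]-ball meets [I k] only in themselves. Balls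
    are finite and [h] is injective, so a small enough rational interval around [h x] captures
    [x]. *)
Lemma separated_cover n : exists Q : nat -> set V,
  [/\ forall k, measurable (Q k), forall k, separated n (Q k) & forall x, exists k, Q k x].
Proof.
pose c k := @rat_seq R (letter 0 k); pose e k := @inv1 R (letter 1 k).
pose I k := [set v : V | `|h v - c k| < e k].
have mI k : measurable (I k).
  have -> : I k = h @^-1` ball (c k) (e k).
    by rewrite -ball_normE; apply/seteqP; split => v /=; rewrite /I/= distrC.
  by apply: measurable_preT (bn_h G) _; apply: open_measurable; exact: ball_open.
exists (fun k => I k `&` \bigcap_s [set x | (size s <= n)%N -> walk s x = x \/ ~ I k (walk s x)]); split.
- move=> k; apply: measurableI => //; apply: measurable_bigcap_count => s.
  case: (leqP (size s) n) => sn.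
    rewrite (_ : [set _ | _] = [set x | walk s x = x] `|` ~` (walk s @^-1` I k)).
      apply: measurableU.
        by apply: measurable_eqset; [exact: measurable_walk|exact: measurable_id].
      by apply: measurableC; exact: measurable_preT (measurable_walk s) _.
    by apply/seteqP; split => x /=; [apply|move=> ? _].
  by rewrite (_ : [set _ | _] = setT)//; apply/seteqP; split.
- move=> k x y [Ix Hx] [Iy Hy] xy s sn e1; have [] := Hx s Logic.I sn; rewrite e1//.
  by move=> e2; apply: xy.
- move=> x; have [m Hm] := seq_separated [seq h (walk s x) | s <- words n].
  have [k0 Hk0] := dense_ratE (h x) m.+1.
  have mm : @inv1 R m.+1 < @inv1 R m by rewrite /inv1 ltf_pV2 ?posrE// ltr_nat.
  pose k := CodeSeq.code [:: k0; m].
  have ck : c k = @rat_seq R k0 by rewrite /c letter_code.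
  have ek : e k = @inv1 R m by rewrite /e letter_code.
  have Ix : I k x by rewrite /I/= ck ek; exact: le_lt_trans mm.
  exists k; split => // s _ /= /words_walk[t tn tE].
  have [->|/eqP ne] := pselect (walk s x = x); [by left|right].
  have [t0 t0n t0E] := @words_walk n [::] isT.
  have Hy : forall y, y != x -> y = walk t x -> 4 * @inv1 R m <= `|h y - h x|.
    move=> y yx yE; apply: Hm.
    - by rewrite yE; exact: (map_f (fun s => h (walk s x))).
    - by rewrite -{1}[x]/(walk [::] x) -t0E; exact: (map_f (fun s => h (walk s x))).
    - by apply: contraNN yx => /eqP/(bn_hinj G)/eqP.
  have := Hy _ ne (esym (tE x)).
  move: Ix; rewrite /I/= ck ek; move: (rat_seq _) (h x) (h _) => a b w.
  rewrite leNgt ltr_norml !ltr_norml => /andP[? ?] /negP H /andP[? ?].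
  by apply: H; apply/andP; split; lra.
Qed.

Variable mu : probability V R.
Hypothesis invmu : invariant_measure adj mu.

Lemma invariant_walk s A : measurable A -> {in A &, injective (walk s)} ->
  mu (walk s @` A) = mu A.
Proof.
move=> mA sA; apply/esym; apply: invmu => //; first exact: measurable_walk_image.
exists (walk s); split; first exact: measurable_funTS (measurable_walk s).
split; last by move=> x _; exact: walk_component.
by split.
Qed.

(** On a separated piece the walk is injective, so the preimage has the measure of its image, which
    lies in [A]. *)
Lemma null_walk_preimage s A : measurable A -> mu A = 0%E -> mu (walk s @^-1` A) = 0%E.
Proof.
move=> mA A0; have [Q [mQ sQ Qc]] := separated_cover (size s + size s).
have mS := measurable_preT (measurable_walk s) mA.
have /negligibleP : mu.-negligible (\bigcup_k (walk s @^-1` A `&` Q k)).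
  apply: negligible_bigcup => k; apply/negligibleP; first exact: measurableI.
  have mk : measurable (walk s @^-1` A `&` Q k) by exact: measurableI.
  apply: (eq_trans (esym (@invariant_walk s _ mk _))).
    by move=> x y /set_mem[_ Qx] /set_mem[_ Qy]; exact: separated_inj (sQ k) _ Qx Qy.
  apply: (subset_measure0 _ _ _ A0) => //; first exact: measurable_walk_image.
  by move=> _ [x [Ax _] <-].
rewrite -setI_bigcupr (_ : \bigcup_k Q k = setT) ?setIT.
  exact.
by apply/seteqP; split => // x _; have [k Qk] := Qc x; exists k.
Qed.

Lemma null_walk_saturation A : measurable A -> mu A = 0%E ->
  measurable (\bigcup_s (walk s @^-1` A)) /\ mu (\bigcup_s (walk s @^-1` A)) = 0%E.
Proof.
move=> mA A0.
have mS : measurable (\bigcup_s (walk s @^-1` A)).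
  by apply: measurable_bigcup_count => s; exact: measurable_preT (measurable_walk s) mA.
split => //; apply/negligibleP => //.
pose F n := if unpickle n is Some s then walk s @^-1` A else set0.
apply: (@negligibleS _ _ _ mu (\bigcup_n F n)); last first.
  apply: negligible_bigcup => n; rewrite /F; case: unpickle => [s|].
    apply/negligibleP; last exact: null_walk_preimage.
    exact: measurable_preT (measurable_walk s) mA.
  exact: negligible_set0.
by move=> x [s _ Hs]; exists (pickle s) => //; rewrite /F pickleK.
Qed.

End Walks.
End BorelNeighbors.

(** * Probability estimates and Ekeland's principle *)

Section ProbabilityLayer.
Context {d : measure_display} {V : measurableType d} {R : realType}.
Variable mu : probability V R.
Implicit Types (A B : set V).

Definition pr A : R := fine (mu A).

Lemma prE A : measurable A -> mu A = (pr A)%:E.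
Proof. by move=> mA; rewrite /pr fineK// fin_num_measure. Qed.

Lemma pr_ge0 A : 0 <= pr A.
Proof. by apply: fine_ge0; exact: measure_ge0. Qed.

Lemma pr0 : pr set0 = 0.
Proof. by rewrite /pr measure0. Qed.

Lemma prT : pr setT = 1.
Proof. by rewrite /pr probability_setT. Qed.

Lemma pr_le A B : measurable A -> measurable B -> A `<=` B -> pr A <= pr B.
Proof.
move=> mA mB AB; rewrite -lee_fin -!prE//.
by apply: le_measure => //; rewrite inE.
Qed.

Lemma pr_le1 A : measurable A -> pr A <= 1.
Proof. by move=> mA; rewrite -prT; apply: pr_le. Qed.

Lemma prU A B : measurable A -> measurable B -> A `&` B = set0 ->
  pr (A `|` B) = pr A + pr B.
Proof.
move=> mA mB AB; apply: EFin_inj; rewrite EFinD -!prE//; last exact: measurableU.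
by rewrite measureU.
Qed.

Lemma pr_split A B : measurable A -> measurable B -> pr A = pr (A `&` B) + pr (A `\` B).
Proof.
move=> mA mB; rewrite -(@prU (A `&` B) (A `\` B)) ?setUIDK//.
- exact: measurableI.
- exact: measurableD.
- by apply/seteqP; split => x // [[_ Bx] [_ nBx]].
Qed.

Lemma prU_le A B : measurable A -> measurable B -> pr (A `|` B) <= pr A + pr B.
Proof.
move=> mA mB; have mD : measurable (B `\` A) by exact: measurableD.
have -> : A `|` B = A `|` (B `\` A).
  apply/seteqP; split => x; last by move=> [|[]]; [left|right].
  by move=> [|Bx]; [left|have [Ax|nAx] := pselect (A x); [left|right]].
rewrite prU//; last by apply/seteqP; split => x // [Ax [_ nAx]].
by rewrite lerD2l; apply: pr_le => // x [].
Qed.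

Lemma pr_eq0P A : measurable A -> pr A = 0 <-> mu A = 0%E.
Proof. by move=> mA; rewrite prE//; split => [->//|[]]. Qed.

Lemma pr_bigcup_le (B : nat -> set V) (c : R) : (forall n, measurable (B n)) ->
  (forall n, B n `<=` B n.+1) -> (forall n, pr (B n) <= c) -> pr (\bigcup_n B n) <= c.
Proof.
move=> mB BS Bc; have mU : measurable (\bigcup_n B n) by exact: bigcupT_measurable.
rewrite -lee_fin -prE//.
have nB : {homo B : n m / (n <= m)%N >-> (n <= m)%O}.
  by apply/nondecreasing_seqP => n; apply/subsetPset.
have cB := nondecreasing_cvg_mu mB mU (mu := mu) nB.
rewrite -(cvg_lim _ cB)//; apply: lime_le; first by apply: cvgP; exact: cB.
by near=> n; rewrite /= prE// lee_fin.
Unshelve. all: by end_near. Qed.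

Lemma pr_bigcap_ge (B : nat -> set V) (c : R) : (forall n, measurable (B n)) ->
  (forall n, B n.+1 `<=` B n) -> (forall n, c <= pr (B n)) -> c <= pr (\bigcap_n B n).
Proof.
move=> mB BS Bc.
have prC A : measurable A -> pr (~` A) = 1 - pr A.
  by move=> mA; rewrite -prT (pr_split measurableT mA) setTI setTD addrC addKr.
have mI : measurable (\bigcap_n B n) by exact: bigcapT_measurable.
suff : pr (\bigcup_n ~` B n) <= 1 - c by rewrite -setC_bigcap prC//; lra.
apply: pr_bigcup_le => n; first exact: measurableC.
  exact: subsetC.
by rewrite prC// lerD2l lerN2.
Qed.

Lemma pr_null_cover A (Q : nat -> set V) : measurable A -> (forall k, measurable (Q k)) ->
  (forall x, A x -> exists k, Q k x) -> (forall k, pr (A `&` Q k) = 0) -> pr A = 0.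
Proof.
move=> mA mQ cQ AQ; apply/pr_eq0P => //; apply/negligibleP => //.
apply: (@negligibleS _ _ _ mu (\bigcup_k (A `&` Q k))).
  by move=> x Ax; have [k Qk] := cQ x Ax; exists k.
apply: negligible_bigcup => k; apply/negligibleP; first exact: measurableI.
by apply/pr_eq0P => //; exact: measurableI.
Qed.

Lemma pr_count (I : Type) (L : seq I) (F : I -> set V) (H : set V) (c : nat) :
  (forall i, measurable (F i)) -> measurable H ->
  (forall x, H x -> (c <= count (fun i => `[< F i x >]) L)%N) ->
  c%:R * pr H <= \sum_(i <- L) pr (F i `&` H).
Proof.
move=> mF; elim: L H c => [|i L IH] H c mH Hc.
  rewrite big_nil; have [[x Hx]|H0] := pselect (exists x, H x).
    by have := Hc x Hx; rewrite leqn0 => /eqP->; rewrite mul0r.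
  have -> : H = set0 by apply/seteqP; split => // x Hx; case: H0; exists x.
  by rewrite pr0 mulr0.
rewrite big_cons.
have split_ : forall j, pr (F j `&` H) = pr (F j `&` (H `&` F i)) + pr (F j `&` (H `\` F i)).
  by move=> j; rewrite (@pr_split _ (F i))//; [rewrite setIA setIDA|exact: measurableI].
rewrite (eq_bigr _ (fun j _ => split_ j)) big_split /=.
have m1 : measurable (H `&` F i) by exact: measurableI.
have m2 : measurable (H `\` F i) by exact: measurableD.
rewrite (pr_split mH (mF i)) mulrDr.
have h2 : c%:R * pr (H `\` F i) <= \sum_(j <- L) pr (F j `&` (H `\` F i)).
  by apply: IH => // x [Hx nFx]; have := Hc x Hx => /=; rewrite asboolF.
have h1 : c.-1%:R * pr (H `&` F i) <= \sum_(j <- L) pr (F j `&` (H `&` F i)).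
  by apply: IH => // x [Hx Fx]; have := Hc x Hx => /=; rewrite asboolT// add1n; case: (c).
have -> : F i `&` H = H `&` F i by rewrite setIC.
have h3 : c%:R * pr (H `&` F i) <= pr (H `&` F i) + c.-1%:R * pr (H `&` F i).
  have := pr_ge0 (H `&` F i); case: (c) => [|c'] p0 /=; first by rewrite !mul0r addr0.
  by rewrite -{2}[pr _]mul1r -mulrDl -natr1 addrC.
by lra.
Qed.

Lemma pr_big_disjoint (I : eqType) (L : seq I) (F : I -> set V) :
  (forall i, measurable (F i)) -> uniq L ->
  (forall i j, i \in L -> j \in L -> i != j -> F i `&` F j = set0) ->
  measurable (\big[setU/set0]_(i <- L) F i) /\
  pr (\big[setU/set0]_(i <- L) F i) = \sum_(i <- L) pr (F i).
Proof.
move=> mF; elim: L => [|i L IH] /=; first by rewrite !big_nil pr0; split.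
move=> /andP[iL uL] dF; rewrite !big_cons.
have [|m1 <-] := IH uL.
  by move=> j k jL kL; apply: dF; rewrite inE ?jL ?kL orbT.
split; first exact: measurableU.
apply: prU => //; rewrite big_distrr /=; rewrite big_seq big1// => j jL.
apply: dF; rewrite ?mem_head//; first by rewrite inE jL orbT.
by apply: contraNneq iL => ->.
Qed.

(** Cut [A] by the values of [h]. Since [h] is injective, the level set at the critical value
    [sup S] is at most one point, hence null, and the distribution function does not jump over
    [delta]. *)
Lemma pr_subset (h : V -> R) A (delta : R) : measurable_fun setT h -> injective h ->
  atomless mu -> measurable A -> 0 <= delta -> delta <= pr A ->
  exists B, [/\ measurable B, B `<=` A & pr B = delta].
Proof.
move=> mh hi at0 mA d0; rewrite le_eqVlt => /orP[/eqP->|dA]; first by exists A; split => // x.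
move: d0; rewrite le_eqVlt => /orP[/eqP<-|d0]; first by exists set0; split => //; exact: pr0.
pose L t := A `&` [set x | h x <= t].
have mL t : measurable (L t).
  apply: measurableI => //; rewrite (_ : [set x | _] = h @^-1` `]-oo, t]).
    exact: measurable_preT.
  by apply/seteqP; split => x /=; rewrite in_itv.
pose S := [set t | pr (L t) <= delta].
have Smono s t : s <= t -> S t -> S s.
  move=> st; apply: le_trans; apply: pr_le => // x [Ax /= hx]; split => //=.
  exact: le_trans hx st.
have [t0 tS] : exists t, S t.
  apply: contrapT => nS; have : delta <= pr (\bigcap_n L (- n%:R)).
    apply: pr_bigcap_ge => // n.
      by move=> x [Ax /= hx]; split => //=; apply: le_trans hx _; rewrite lerN2 ler_nat.
    by apply: ltW; rewrite ltNge; apply/negP => H; apply: nS; exists (- n%:R).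
  rewrite (_ : \bigcap_n _ = set0) ?pr0; first by rewrite leNgt d0.
  apply/seteqP; split => // x Hx.
  have [_ /=] := Hx (Num.truncn `|h x|).+1 Logic.I; rewrite leNgt => /negP; apply.
  rewrite ltrNl; apply: (le_lt_trans _ (truncnS_gt _)).
  by rewrite -normrN; exact: ler_norm.
have ubS : has_ubound S.
  apply: contrapT => nS; have : pr (\bigcup_n L n%:R) <= delta.
    apply: pr_bigcup_le => // n.
      by move=> x [Ax /= hx]; split => //=; apply: le_trans hx _; rewrite ler_nat.
    apply: contrapT => H; apply: nS; exists n%:R => s Ss.
    by rewrite leNgt; apply/negP => ns; apply: H; apply: Smono Ss; exact: ltW.
  rewrite (_ : \bigcup_n _ = A); first by rewrite leNgt dA.
  apply/seteqP; split => x; first by move=> [n _ []].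
  move=> Ax; exists (Num.truncn `|h x|).+1 => //; split => //=.
  by apply: ltW; apply: (le_lt_trans (ler_norm _) (truncnS_gt _)).
have supS : has_sup S by split => //; exists t0.
pose B := A `&` [set x | h x < sup S].
have mB : measurable B.
  apply: measurableI => //; rewrite (_ : [set x | _] = h @^-1` `]-oo, sup S[).
    exact: measurable_preT.
  by apply/seteqP; split => x /=; rewrite in_itv.
have inv1_small (e : R) : 0 < e -> exists n, @inv1 R n < e.
  move=> e0; exists (Num.truncn e^-1).
  rewrite /inv1 -[X in _ < X]invrK ltf_pV2 ?posrE ?invr_gt0//; exact: truncnS_gt.
have inv1_mono n : @inv1 R n.+1 <= @inv1 R n.
  by rewrite /inv1 lef_pV2 ?posrE// ler_nat.
have Ble : pr B <= delta.
  have -> : B = \bigcup_n L (sup S - @inv1 R n).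
    apply/seteqP; split => x; last first.
      move=> [n _ [Ax /= hx]]; split => //=; apply: le_lt_trans hx _.
      by have := @inv1_gt0 R n; lra.
    move=> [Ax /= hx]; have [n Hn] := inv1_small (sup S - h x) ltac:(lra).
    by exists n => //; split => //=; lra.
  apply: pr_bigcup_le => // n.
    by move=> x [Ax /= hx]; split => //=; have := inv1_mono n; lra.
  have [s Ss ss] := sup_adherent (@inv1_gt0 R n) supS.
  by apply: Smono Ss; exact: ltW.
have Lge : delta <= pr (L (sup S)).
  have -> : L (sup S) = \bigcap_n L (sup S + @inv1 R n).
    apply/seteqP; split => x.
      by move=> [Ax /= hx] n _; split => //=; have := @inv1_gt0 R n; lra.
    move=> Hx; split; first by have [] := Hx 0%N Logic.I.
    rewrite /= leNgt; apply/negP => hx.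
    have [n Hn] := inv1_small (h x - sup S) ltac:(lra).
    by have [_ /=] := Hx n Logic.I; lra.
  apply: pr_bigcap_ge => // n.
    by move=> x [Ax /= hx]; split => //=; have := inv1_mono n; lra.
  apply: ltW; rewrite ltNge; apply/negP => H.
  have := ub_le_sup ubS H; have := @inv1_gt0 R n; lra.
exists B; split => //; first by move=> x [].
apply/eqP; rewrite eq_le Ble/=; apply: le_trans Lge _.
have mD : measurable (L (sup S) `\` B) by exact: measurableD.
rewrite (pr_split (mL _) mB) (_ : pr (_ `\` B) = 0) ?addr0.
  by apply: pr_le => //; exact: measurableI.
apply/pr_eq0P => //.
have hD x y : (L (sup S) `\` B) x -> (L (sup S) `\` B) y -> x = y.
  have H z : (L (sup S) `\` B) z -> h z = sup S.
    move=> [[Az /= hz] nBz]; apply/eqP; rewrite eq_le hz/= leNgt; apply/negP => H.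
    by apply: nBz.
  by move=> /H hx /H hy; apply: hi; rewrite hx hy.
have [[x Dx]|D0] := pselect (exists x, (L (sup S) `\` B) x).
  rewrite (_ : _ `\` _ = [set x]); first exact: at0.
  by apply/seteqP; split => y /= => [Dy|->//]; exact: hD.
by rewrite (_ : _ `\` _ = set0) ?measure0//; apply/seteqP; split => // x Dx; case: D0; exists x.
Qed.

End ProbabilityLayer.

(** * Ekeland's variational principle *)

Section Ekeland.
Context {R : realType} (X : Type) (K : X -> Prop) (dist : X -> X -> R) (E : X -> R).
Variables (k c : R).
Hypothesis k0 : 0 < k.
Hypothesis c0 : 0 <= c.
Hypothesis dist0 : forall f, K f -> dist f f <= 0.
Hypothesis dist_tri : forall f g h, K f -> K g -> K h -> dist f h <= dist f g + dist g h.
Hypothesis E0 : forall f, K f -> 0 <= E f.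
Hypothesis E_lip : forall f g, K f -> K g -> E g <= E f + c * dist f g.
Hypothesis complete : forall (u : nat -> X) (e : nat -> R) (L : R), (forall n, K (u n)) ->
  (forall n, dist (u n) (u n.+1) <= e n - e n.+1) -> (forall n, L <= e n) ->
  (forall eps, 0 < eps -> exists n, e n < L + eps) ->
  exists2 f, K f & forall n, dist (u n) f <= e n - L.

(** Lipschitz continuity of [E] stands in for semicontinuity, and [complete] has the telescoping
    form that the sequence of near-minimisers supplies, with [e] equal to [E / k] along it. The
    conclusion compares values only, since [dist] does not separate colourings that agree almost
    everywhere. *)
Lemma ekeland f0 : K f0 -> exists f, [/\ K f, k * dist f0 f <= E f0 - E f &
  forall g, K g -> k * dist f g <= E f - E g -> E f <= E g].
Proof.
move=> Kf0; pose S f := [set g | K g /\ k * dist f g <= E f - E g].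
have Srefl f : K f -> S f f.
  by move=> Kf; split => //; rewrite subrr pmulr_rle0// dist0.
have Strans f g h : K f -> S f g -> S g h -> S f h.
  move=> Kf [Kg fg] [Kh gh]; split => //.
  have := dist_tri Kf Kg Kh; rewrite -(ler_pM2l k0) mulrDr; lra.
pose I f := inf [set E g | g in S f].
have IS f : K f -> has_inf [set E g | g in S f].
  move=> Kf; split; first by exists (E f), f => //; exact: Srefl.
  by exists 0 => _ [g [Kg _] <-]; exact: E0.
have Ile f g : K f -> S f g -> I f <= E g.
  by move=> Kf Sg; apply: ge_inf; [exact: (IS f Kf).2|exists g].
(* Each step closes at least half of the gap to the infimum over [S f], so these infima approach the
   limiting value. *)
have /choice[nx Hnx] : forall f, exists g, K f -> S f g /\ E g <= (E f + I f) / 2.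
  move=> f; have [Kf|nKf] := pselect (K f); last by exists f.
  have [e|ne] := eqVneq (I f) (E f).
    by exists f => _; split; [exact: Srefl|rewrite e; lra].
  have IE : I f < E f by rewrite lt_neqAle ne; exact: Ile (Srefl f Kf).
  have [_ [g Sg <-] Hg] := inf_adherent (eps := (E f - I f) / 2) ltac:(lra) (IS f Kf).
  by exists g => _; split => //; rewrite -/(I f) in Hg; lra.
pose u n := iter n nx f0.
have Ku n : K (u n) by elim: n => [//|n IH]; have [[]] := Hnx _ IH.
have uS n : S (u n) (u n.+1) by have [] := Hnx _ (Ku n).
pose M := inf [set E (u n) | n in setT].
have ME : has_inf [set E (u n) | n in setT].
  by split; [exists (E f0), 0%N|exists 0 => _ [n _ <-]; exact: E0].
have Mle n : M <= E (u n) by apply: ge_inf; [exact: ME.2|exists n].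
have close (e : R) : 0 < e -> exists n, E (u n) < M + e.
  by move=> e0; have [_ [n _ <-] H] := inf_adherent e0 ME; exists n.
have [f Kf Hf] : exists2 f, K f & forall n, dist (u n) f <= E (u n) / k - M / k.
  apply: complete => // [n|n|e e0]; last 2 first.
  - by rewrite ler_pM2r ?invr_gt0.
  - have [n Hn] := close (k * e) (mulr_gt0 k0 e0); exists n.
    by rewrite ltr_pdivrMr// mulrDl divfK ?gt_eqF// [e * k]mulrC.
  by rewrite -mulrBl ler_pdivlMr// mulrC; case: (uS n).
have {}Hf n : k * dist (u n) f <= E (u n) - M.
  by have := Hf n; rewrite -mulrBl ler_pdivlMr// mulrC.
have EfM : E f <= M.
  rewrite leNgt; apply/negP => H.
  have q0 : 0 < 1 + c / k by rewrite ltr_pwDl// divr_ge0// ltW.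
  have d0 : 0 < E f - M by lra.
  have [n Hn] := close _ (divr_gt0 d0 q0).
  have h1 := E_lip (Ku n) Kf.
  have h2 : c * dist (u n) f <= c / k * (E (u n) - M).
    by rewrite -mulrA ler_wpM2l// mulrC ler_pdivlMr// mulrC.
  have : (1 + c / k) * (E (u n) - M) < E f - M.
    by rewrite mulrC -ltr_pdivlMr//; lra.
  by rewrite mulrDl mul1r; lra.
have fS n : S (u n) f by split => //; have := Hf n; lra.
exists f; split => //; first by case: (fS 0%N).
move=> g Kg Hg; rewrite leNgt; apply/negP => gf.
have gS n : S (u n) g by apply: Strans (fS n) _.
have [n Hn] := close (E f - E g) ltac:(lra).
have [_ h1] := Hnx _ (Ku n); have := Ile _ _ (Ku n) (gS n); have := Mle n.+1.
by rewrite /u iterS -/(u n); lra.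
Qed.

End Ekeland.

(** * Recolouring patterns *)

Section Colorings.
Context {d : measure_display} {V : measurableType d} {R : realType}.
Variables (adj : V -> V -> Prop) (D : nat) (h : V -> R) (nu : nat -> V -> V).
Hypothesis G : borel_nbr adj D h nu.
Variable mu : probability V R.
Hypothesis invmu : invariant_measure adj mu.
Local Notation walk := (walk nu).
Local Notation C := (option 'I_D).
Local Notation pr := (pr mu).
Implicit Types (f g : V -> C) (A : set V) (x y u : V).

Definition nbrs x : seq V := [seq nu i x | i <- iota 0 D & nu i x != x].

Lemma mem_nbrs x y : reflect (adj x y) (y \in nbrs x).
Proof.
apply: (iffP mapP) => [[i]|xy].
  by rewrite mem_filter => /andP[/eqP ix _] ->; exact: (bn_adj G ix).
have [i iD iy] := bn_ex G xy; exists i => //.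
rewrite mem_filter mem_iota/= add0n iD andbT; apply/eqP => e.
by apply: (bn_irr G (x := x)); rewrite -{2}e iy.
Qed.

Lemma nbrs_uniq x : uniq (nbrs x).
Proof.
rewrite map_inj_in_uniq ?filter_uniq ?iota_uniq// => i j.
rewrite !mem_filter => /andP[/eqP ix _] _; exact: (bn_uniq G ix).
Qed.

Lemma nbrs_sym x y : (y \in nbrs x) = (x \in nbrs y).
Proof. by apply/mem_nbrs/mem_nbrs; exact: (bn_sym G). Qed.

Lemma nbrs_irr x : x \notin nbrs x.
Proof. by apply/mem_nbrs; exact: (bn_irr G). Qed.

Lemma nbrs_size x : (size (nbrs x) <= D)%N.
Proof. by rewrite size_map size_filter (leq_trans (count_size _ _))// size_iota. Qed.

Lemma nu_nbrs i x : nu i x != x -> nu i x \in nbrs x.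
Proof. by move=> /eqP ix; apply/mem_nbrs; exact: (bn_adj G ix). Qed.

Lemma nbrs_nu x y : y \in nbrs x -> exists i, nu i x = y.
Proof. by move=> /mem_nbrs xy; have [i _ <-] := bn_ex G xy; exists i. Qed.

Definition mcol f := forall c, measurable [set x | f x = c].

Definition cdist f g := pr [set x | f x <> g x].

Definition mass f (c : C) := pr [set x | f x = c].

Lemma measurable_mcol f (Z : V -> V) c : mcol f -> measurable_fun setT Z ->
  measurable [set u | f (Z u) = c].
Proof. by move=> mf mZ; exact: (measurable_preT mZ (mf c)). Qed.

Lemma measurable_neq f g : mcol f -> mcol g -> measurable [set x | f x <> g x].
Proof.
move=> mf mg; rewrite (_ : [set _ | _] = \bigcup_(c : C) ([set x | f x = c] `\` [set x | g x = c])).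
  by apply: measurable_bigcup_count => c; exact: measurableD.
apply/seteqP; split => x /=; first by move=> fg; exists (f x) => //; split => //= e; rewrite e in fg.
by move=> [c _ [/= -> gc] e]; apply: gc.
Qed.

Lemma cdistxx f : cdist f f = 0.
Proof. by rewrite /cdist (_ : [set _ | _] = set0) ?pr0//; apply/seteqP; split. Qed.

Lemma cdist_tri f g k : mcol f -> mcol g -> mcol k -> cdist f k <= cdist f g + cdist g k.
Proof.
move=> mf mg mk; apply: le_trans (prU_le _ _ _); [|exact: measurable_neq|exact: measurable_neq].
apply: pr_le; [exact: measurable_neq|by apply: measurableU; exact: measurable_neq|].
by move=> x /= fk; have [e|ne] := pselect (f x = g x); [right; rewrite -e|left].
Qed.

Lemma mass_lip f g c : mcol f -> mcol g -> mass g c <= mass f c + cdist f g.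
Proof.
move=> mf mg; apply: le_trans (prU_le _ _ _) => //; last exact: measurable_neq.
apply: pr_le => //; first by apply: measurableU => //; exact: measurable_neq.
move=> x /= gc; have [e|ne] := pselect (f x = g x); first by left; rewrite e.
by right.
Qed.

(** The limit colours only points whose colour is eventually constant. Properness thus passes to the
    limit, and a point can lose its colour only if it changes again and again, which the total
    change controls. *)
Lemma coloring_limit (u : nat -> V -> C) (e : nat -> R) (L : R) :
  (forall n, mcol (u n)) ->
  (forall n, cdist (u n) (u n.+1) <= e n - e n.+1) -> (forall n, L <= e n) ->
  exists f, [/\ mcol f, forall n, cdist (u n) f <= e n - L &
    forall x a, f x = Some a -> exists n, forall m, (n <= m)%N -> u m x = Some a].
Proof.
move=> mu_ ue Le.
pose ev x a := exists n, forall m, (n <= m)%N -> u m x = Some a.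
have ev_uniq x a b : ev x a -> ev x b -> a = b.
  move=> [n Hn] [m Hm]; have := Hn (maxn n m) (leq_maxl _ _).
  by rewrite Hm ?leq_maxr// => -[].
have /choice[f Hf] : forall x, exists c : C, forall a, c = Some a <-> ev x a.
  move=> x; have [[a Ha]|nev] := pselect (exists a, ev x a).
    by exists (Some a) => b; split => [[<-]//|/(ev_uniq _ _ _ Ha) ->].
  by exists None => a; split => // Ha; case: nev; exists a.
have mS a : measurable [set x | f x = Some a].
  rewrite (_ : [set _ | _] = \bigcup_n \bigcap_m [set x | (n <= m)%N -> u m x = Some a]).
    apply: bigcupT_measurable => n; apply: bigcapT_measurable => m.
    case: (leqP n m) => nm.
      rewrite (_ : [set _ | _] = [set x | u m x = Some a]); first exact: mu_.
      by apply/seteqP; split => x /=; [apply|move=> ? _].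
    by rewrite (_ : [set _ | _] = setT)//; apply/seteqP; split.
  apply/seteqP; split => x /=.
    by move=> /Hf[n Hn]; exists n => // m _; exact: Hn.
  by move=> [n _ Hn]; apply/Hf; exists n => m; exact: Hn.
have mf : mcol f.
  move=> [a|//]; first exact: mS.
  rewrite (_ : [set _ | _] = ~` \bigcup_(a : 'I_D) [set x | f x = Some a]).
    by apply: measurableC; exact: measurable_bigcup_count.
  apply/seteqP; split => x /=; first by move=> fx [a _ /=]; rewrite fx.
  by case E : (f x) => [a|//] H; case: H; exists a.
exists f; split => //; last by move=> x a /Hf.
move=> n; pose B j := [set x | exists2 k, (k < j)%N & u (n + k)%N x <> u (n + k).+1 x].
have BE j : B j.+1 = B j `|` [set x | u (n + j)%N x <> u (n + j).+1 x].
  apply/seteqP; split => x /=.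
    move=> [k]; rewrite ltnS leq_eqVlt => /orP[/eqP->|kj] Hk; first by right.
    by left; exists k.
  by move=> [[k kj Hk]|Hj]; [exists k => //; exact: ltnW|exists j].
have mB j : measurable (B j).
  elim: j => [|j IH]; last by rewrite BE; apply: measurableU => //; exact: measurable_neq.
  by rewrite (_ : B 0%N = set0)//; apply/seteqP; split => // x [].
have BP j : pr (B j) <= e n - e (n + j)%N.
  elim: j => [|j IH].
    rewrite addn0 subrr (_ : B 0%N = set0); first by rewrite pr0.
    by apply/seteqP; split => // x [].
  rewrite BE; apply: le_trans (prU_le _ _ _) _ => //; first exact: measurable_neq.
  by have := ue (n + j)%N; rewrite addnS /cdist; lra.
have : pr (\bigcup_j B j) <= e n - L.
  apply: pr_bigcup_le => // j; first by move=> x; rewrite BE; left.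
  by have := BP j; have := Le (n + j)%N; lra.
apply: le_trans; apply: pr_le; [exact: measurable_neq|exact: bigcupT_measurable|].
move=> x /= ufx; apply: contrapT => nB.
have cst j : u (n + j)%N x = u n x.
  elim: j => [|j IH]; first by rewrite addn0.
  rewrite addnS -IH; apply: contrapT => H; apply: nB; exists j.+1 => //; exists j => // e1.
  by apply: H.
apply: ufx; case E : (u n x) => [a|].
  by apply/esym/Hf; exists n => m nm; rewrite -(subnKC nm) cst.
case F : (f x) => [a|//]; move/Hf : F => [m Hm].
by have := Hm (n + m)%N (leq_addl _ _); rewrite cst E.
Qed.

(* A pattern recolours, around a base point [u], the endpoint of each listed walk. *)
Definition pattern := seq (seq nat * C).

Fixpoint ow f (p : pattern) u y : C :=
  if p is (w, c) :: p' then if y == walk w u then c else ow f p' u y else f y.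

Definition pos (p : pattern) u := [seq walk w.1 u | w <- p].

(* Recolouring by [p] around [u] is allowed, and the old colours are [o]. *)
Definition site f (p : pattern) (o : seq C) u :=
  [/\ proper nbrs (ow f p u), uniq (pos p u) & map f (pos p u) = o].

Lemma ow_notin f p u y : y \notin pos p u -> ow f p u y = f y.
Proof.
by elim: p => [|[w c] p IH] //=; rewrite inE negb_or => /andP[/negPf-> /IH].
Qed.

Lemma ow_mem f p u w c : uniq (pos p u) -> (w, c) \in p -> ow f p u (walk w u) = c.
Proof.
elim: p => [|[w' c'] p IH] //= /andP[np up]; rewrite inE => /orP[/eqP[-> ->]|wp].
  by rewrite eqxx.
case: eqVneq => [e|_]; last exact: IH.
by move: np; rewrite -e => /negP; case; apply/mapP; exists (w, c).
Qed.

Lemma ow_eq f g p u y : f y = g y -> ow f p u y = ow g p u y.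
Proof. by move=> e; elim: p => [|[w c] p IH] //=; rewrite IH. Qed.

Lemma measurable_ow f p (Z : V -> V) c : mcol f -> measurable_fun setT Z ->
  measurable [set u | ow f p u (Z u) = c].
Proof.
move=> mf mZ; elim: p => [|[w c'] p IH] /=; first exact: measurable_mcol.
have mE : measurable [set u | Z u = walk w u].
  by apply: (measurable_eqset G) => //; exact: (measurable_walk G w).
rewrite (_ : [set _ | _] = ([set u | Z u = walk w u] `&` [set u | c' = c]) `|`
   ([set u | ow f p u (Z u) = c] `\` [set u | Z u = walk w u])).
  apply: measurableU; last exact: measurableD.
  apply: measurableI => //; have [e|e] := pselect (c' = c).
    by rewrite (_ : [set _ | _] = setT)//; apply/seteqP; split.
  by rewrite (_ : [set _ | _] = set0)//; apply/seteqP; split.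
apply/seteqP; split => u /=; case: eqVneq => e.
- by left.
- by right; split => //; exact/eqP.
- by move=> [[]|[]].
- by move=> [[/eqP]|[]//]; rewrite (negPf e).
Qed.

(** Only edges at the pattern need testing and [nu] enumerates them, so properness becomes a
    countable, hence measurable, condition on [u]. *)
Lemma site_properP f p u : proper nbrs f -> proper nbrs (ow f p u) <->
  forall w, w \in map fst p -> forall i, ow f p u (walk w u) <> None ->
    ow f p u (walk w u) = ow f p u (nu i (walk w u)) -> nu i (walk w u) = walk w u.
Proof.
move=> pf; split.
  move=> pw w wp i nN e; apply: contrapT => /eqP ne.
  exact: (pw _ _ (nu_nbrs ne) nN e).
move=> H x y xy nN e.
have memw z : z \in pos p u -> exists2 w, w \in map fst p & z = walk w u.
  by move=> /mapP[[w c] wp ->]; exists w => //; apply/mapP; exists (w, c).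
have [xp|xp] := boolP (x \in pos p u).
  have [w wp xE] := memw _ xp; have [i iy] := nbrs_nu xy.
  have := H w wp i; rewrite -xE iy => /(_ nN e) yx.
  by move: xy; rewrite yx (negPf (nbrs_irr x)).
have [yp|yp] := boolP (y \in pos p u).
  have [w wp yE] := memw _ yp; have [i ix] : exists i, nu i y = x.
    by apply: nbrs_nu; rewrite nbrs_sym.
  have := H w wp i; rewrite -yE ix -e => /(_ nN erefl) yx.
  by move: xy; rewrite yx (negPf (nbrs_irr y)).
by move: nN e; rewrite !ow_notin//; exact: pf.
Qed.

Lemma measurable_site f p o : mcol f -> proper nbrs f -> measurable [set u | site f p o u].
Proof.
move=> mf pf; have mw := measurable_walk G.
rewrite (_ : [set _ | _] = [set u | proper nbrs (ow f p u)] `&`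
  ([set u | uniq (pos p u)] `&` [set u | map f (pos p u) = o])); last first.
  by apply/seteqP; split => u /=; [move=> [? ? ?]|move=> [? []]].
apply: measurableI; last apply: measurableI.
- rewrite (_ : [set _ | _] = \bigcap_(wi : seq nat * nat) [set u | wi.1 \in map fst p ->
     ow f p u (walk wi.1 u) <> None -> ow f p u (walk wi.1 u) = ow f p u (nu wi.2 (walk wi.1 u)) ->
     nu wi.2 (walk wi.1 u) = walk wi.1 u]); last first.
    apply/seteqP; split => u /=.
      by move=> /(site_properP _ _ pf) H [w i] _ /= wp; exact: H.
    by move=> H; apply/(site_properP _ _ pf) => w wp i; exact: (H (w, i) Logic.I wp).
  apply: measurable_bigcap_count => -[w i] /=.
  have mi : measurable_fun setT (fun u => nu i (walk w u)).
    by apply: measurableT_comp => //; exact: (bn_nu G i).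
  rewrite (_ : [set _ | _] = ~` ([set u | w \in map fst p] `&`
     ((\bigcup_(c : C) ([set u | ow f p u (walk w u) = c] `&`
         ([set u | ow f p u (nu i (walk w u)) = c] `\` [set u | c = None])))
     `\` [set u | nu i (walk w u) = walk w u]))).
    have mcst (P : Prop) : measurable [set u : V | P].
      have [t|t] := pselect P.
        by rewrite (_ : [set _ | _] = setT)//; apply/seteqP; split.
      by rewrite (_ : [set _ | _] = set0)//; apply/seteqP; split.
    apply: measurableC; apply: measurableI => //; apply: measurableD.
      apply: measurable_bigcup_count => c; apply: measurableI; first exact: measurable_ow.
      by apply: measurableD => //; exact: measurable_ow.
    by apply: (measurable_eqset G).
  apply/seteqP; split => u /= H.
    by move=> [wp [[c _ [/= e1 [e2 cN]]] ne]]; apply: ne; apply: H => //; rewrite e1.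
  move=> wp nN e; apply: contrapT => ne; apply: H; split => //; split => //.
  by exists (ow f p u (walk w u)).
- elim: p => [|[w c] p IH] /=.
    by rewrite (_ : [set _ | _] = setT)//; apply/seteqP; split.
  rewrite (_ : [set _ | _] = [set u | uniq (pos p u)] `\` [set u | walk w u \in pos p u]).
    apply: measurableD => //; elim: p {IH} => [|[w' c'] p IH] /=.
      by rewrite (_ : [set _ | _] = set0)//; apply/seteqP; split.
    rewrite (_ : [set _ | _] = [set u | walk w u = walk w' u] `|` [set u | walk w u \in pos p u]).
      by apply: measurableU => //; apply: (measurable_eqset G).
    apply/seteqP; split => u /=; rewrite inE; first by move=> /orP[/eqP|]; [left|right].
    by move=> [->|->]; rewrite ?eqxx// orbT.
  apply/seteqP; split => u /=; first by move=> /andP[/negP ? ?].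
  by move=> [-> /negP ->].
- elim: p o => [|[w c] p IH] [|c0 o] /=.
  + by rewrite (_ : [set _ | _] = setT)//; apply/seteqP; split.
  + by rewrite (_ : [set _ | _] = set0)//; apply/seteqP; split.
  + by rewrite (_ : [set _ | _] = set0)//; apply/seteqP; split.
  + rewrite (_ : [set _ | _] = [set u | f (walk w u) = c0] `&` [set u | map f (pos p u) = o]).
      by apply: measurableI => //; exact: measurable_mcol.
    by apply/seteqP; split => u /=; [move=> [-> ->]|move=> [-> ->]].
Qed.

Definition near (r : nat) u y := exists2 s, (size s <= r)%N & walk s u = y.

Lemma near_sym r u y : near r u y -> near r y u.
Proof.
move=> [s sr <-]; have [t ts e] := walk_rev G s u; exists t => //.
by rewrite ts.
Qed.

Lemma near_trans r r' u y z : near r u y -> near r' y z -> near (r + r') u z.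
Proof.
move=> [s sr <-] [t tr <-]; exists (s ++ t); last by rewrite walk_cat.
by rewrite size_cat leq_add.
Qed.

Lemma near_nbr x y : y \in nbrs x -> near 1 x y.
Proof. by move=> /nbrs_nu[i <-]; exists [:: i]. Qed.

Lemma near_pos r p u y : all (fun wc => size wc.1 <= r)%N p -> y \in pos p u -> near r u y.
Proof. by move=> /allP H /mapP[wc /H sr ->]; exists wc.1. Qed.

Lemma site_local f g p o r u : all (fun wc => size wc.1 <= r)%N p -> proper nbrs g ->
  (forall y, near r.+1 u y -> f y = g y) -> site f p o u -> site g p o u.
Proof.
move=> pr_ pg fg [pw up fo].
have fg' y : near r u y -> f y = g y.
  by move=> [s sr e]; apply: fg; exists s => //; exact: leqW.
split => //; last first.
  by rewrite -fo; apply/eq_in_map => y yp; apply/esym/fg'; exact: (near_pos pr_ yp).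
have E y : near r.+1 u y -> ow g p u y = ow f p u y by move=> ny; rewrite (ow_eq _ _ (fg _ ny)).
have near1 x y : x \in pos p u -> y \in nbrs x -> near r.+1 u y.
  move=> xp xy; rewrite -addn1; apply: near_trans (near_nbr xy); exact: (near_pos pr_ xp).
have near0 x : x \in pos p u -> near r.+1 u x.
  by move=> /(near_pos pr_)[s sr e]; exists s => //; exact: leqW.
move=> x y xy.
have [xp|xp] := boolP (x \in pos p u).
  by rewrite (E x (near0 _ xp)) (E y (near1 _ _ xp xy)); exact: pw.
have [yp|yp] := boolP (y \in pos p u); last by rewrite !ow_notin//; exact: pg.
have yx : x \in nbrs y by rewrite nbrs_sym.
by rewrite (E y (near0 _ yp)) (E x (near1 _ _ yp yx)); exact: pw.
Qed.

(** Separation by [(r + r).+1] keeps the copies disjoint with no edge between them, so all can be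
    recoloured at once. By invariance each position of the pattern sweeps out a set of measure
    [pr A]. *)
Lemma apply_pattern f p o r A : mcol f -> proper nbrs f ->
  all (fun wc => size wc.1 <= r)%N p -> measurable A -> (forall u, A u -> site f p o u) ->
  separated nu (r + r).+1 A ->
  exists g, [/\ mcol g, proper nbrs g,
    forall y, (forall u, A u -> ~ near r u y) -> g y = f y,
    cdist f g <= (size p)%:R * pr A &
    forall c, mass g c = mass f c + pr A * ((count_mem c (map snd p))%:R - (count_mem c o)%:R)].
Proof.
move=> mf pf pr_ mA As sA.
have uniqA u v y k : A u -> A v -> near r u y -> near k y v -> (k <= r.+1)%N -> u = v.
  move=> Au Av uy yv kr; apply: contrapT => uv.
  have [s ss e] := near_trans uy yv; apply: (sA _ _ Au Av uv s) => //.
  by rewrite (leq_trans ss)// -addnS leq_add2l.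
have posn u y : y \in pos p u -> near r u y by exact: near_pos.
have /choice[g Hg] : forall y, exists c : C,
    (forall u, A u -> y \in pos p u -> c = ow f p u y) /\
    ((forall u, A u -> y \notin pos p u) -> c = f y).
  move=> y; have [[u [Au yu]]|ny] := pselect (exists u, A u /\ y \in pos p u).
    exists (ow f p u y); split; last by move=> /(_ u Au); rewrite yu.
    move=> v Av yv; have -> // : u = v.
    by apply: (uniqA u v y r) => //; [exact: posn|apply: near_sym; exact: posn].
  exists (f y); split => // u Au yu; case: ny; by exists u.
have gE u y : A u -> near r.+1 u y -> (forall v, A v -> y \in pos p v -> u = v) -> g y = ow f p u y.
  move=> Au uy H; have [yu|yu] := boolP (y \in pos p u); first exact: (Hg y).1.
  rewrite ow_notin//; apply: (Hg y).2 => v Av; apply/negP => yv.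
  by move: yu; rewrite (H v Av yv) yv.
have pg : proper nbrs g.
  have key u x y : A u -> x \in pos p u -> y \in nbrs x -> g x = ow f p u x /\ g y = ow f p u y.
    move=> Au xu xy; split; first exact: (Hg x).1.
    apply: gE => //.
      by rewrite -addn1; apply: near_trans (posn _ _ xu) (near_nbr xy).
    move=> v Av yv; apply: (uniqA u v x (1 + r)) => //; first exact: posn.
    by apply: near_trans (near_nbr xy) _; apply: near_sym; exact: posn.
  move=> x y xy; have [[u [Au xu]]|nx] := pselect (exists u, A u /\ x \in pos p u).
    have [-> ->] := key u x y Au xu xy; have [pw _ _] := As u Au; exact: pw.
  have [[u [Au yu]]|ny] := pselect (exists u, A u /\ y \in pos p u).
    have yx : x \in nbrs y by rewrite nbrs_sym.
    have [-> ->] := key u y x Au yu yx; have [pw _ _] := As u Au; exact: pw.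
  rewrite (Hg x).2; last by move=> u Au; apply/negP => xu; apply: nx; exists u.
  rewrite (Hg y).2; first exact: pf.
  by move=> u Au; apply/negP => yu; apply: ny; exists u.
pose L := iota 0 (size p); pose W i := (nth ([::], None) p i).1.
pose T i := walk (W i) @` A.
have memW i : i \in L -> nth ([::], None) p i \in p.
  by rewrite mem_iota add0n => /andP[_ ip]; rewrite mem_nth.
have Wr i : i \in L -> (size (W i) <= r)%N by move=> /memW; move/allP: pr_; apply.
have mT i : measurable (T i) by exact: (measurable_walk_image G (W i) mA).
have posW u i : i \in L -> walk (W i) u = nth u (pos p u) i.
  by rewrite mem_iota add0n => /andP[_ ip]; rewrite (nth_map ([::], None)).
have injT i x y : i \in L -> A x -> A y -> walk (W i) x = walk (W i) y -> x = y.
  move=> iL Ax Ay; apply: (separated_inj G sA _ Ax Ay); apply: leqW.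
  by apply: leq_add; exact: Wr.
have prTi i : i \in L -> pr (T i) = pr A.
  move=> iL; rewrite /pr (invariant_walk G invmu)// => x y /set_mem Ax /set_mem Ay.
  exact: injT.
have dT i j : i \in L -> j \in L -> i != j -> T i `&` T j = set0.
  move=> iL jL ij; apply/seteqP; split => // y [[u Au e1] [v Av e2]].
  have uv : u = v.
    apply: (uniqA u v y r) => //; first by exists (W i); rewrite ?Wr.
    by apply: near_sym; exists (W j); rewrite ?Wr.
  have [_ up _] := As u Au; move: e1; rewrite -e2 -uv posW// posW// => /eqP.
  rewrite nth_uniq ?(negPf ij)// size_map; first by move: iL; rewrite mem_iota add0n.
  by move: jL; rewrite mem_iota add0n.
have [mTT prTT] := pr_big_disjoint mu mT (iota_uniq 0 (size p)) dT.
set TT := \big[_/_]_(_ <- _) _ in mTT prTT.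
have memTT (L' : seq nat) y : (\big[setU/set0]_(i <- L') T i) y <-> exists2 i, i \in L' & T i y.
  elim: L' => [|i L' IH]; first by rewrite big_nil; split => // -[].
  rewrite big_cons; split.
    by move=> [Ti|/IH[j jL Tj]]; [exists i; rewrite ?mem_head|exists j; rewrite ?inE ?jL ?orbT].
  move=> [j]; rewrite inE => /orP[/eqP->|jL] Tj; first by left.
  by right; apply/IH; exists j.
have countE (k : V -> C) (q : seq C) c : (forall c', measurable [set x | k x = c']) -> size q = size p ->
    (forall u i, A u -> i \in L -> k (walk (W i) u) = nth None q i) ->
    pr [set x | k x = c] = pr ([set x | k x = c] `\` TT) + pr A * (count_mem c q)%:R.
  move=> mk sq Hk; rewrite (pr_split mu (mk c) mTT) addrC; congr (_ + _).
  pose L' := [seq i <- L | nth None q i == c].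
  have -> : [set x | k x = c] `&` TT = \big[setU/set0]_(i <- L') T i.
    apply/seteqP; split => y.
      move=> [/= ky /memTT[i iL [u Au e]]]; apply/memTT; exists i; last by exists u.
      by rewrite mem_filter iL andbT -(Hk u i Au iL) e ky.
    move=> /memTT[i]; rewrite mem_filter => /andP[/eqP qi iL] [u Au e].
    split; first by rewrite /= -e Hk.
    by apply/memTT; exists i => //; exists u.
  have sub i : i \in L' -> i \in L by rewrite mem_filter => /andP[].
  have [_ ->] : measurable (\big[setU/set0]_(i <- L') T i) /\
     pr (\big[setU/set0]_(i <- L') T i) = \sum_(i <- L') pr (T i).
    apply: pr_big_disjoint => //; first by rewrite filter_uniq// iota_uniq.
    by move=> i j /sub iL /sub jL; exact: dT.
  rewrite (eq_big_seq (fun=> pr A)); last by move=> i /sub; exact: prTi.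
  rewrite big_const_seq count_predT iter_addr_0 -[LHS]mulr_natr; congr (_ * _%:R).
  rewrite size_filter -[in RHS](mkseq_nth None q) sq /mkseq count_map.
  by apply: eq_count => i.
have gT u i : A u -> i \in L -> g (walk (W i) u) = nth None (map snd p) i.
  move=> Au iL; have [_ up _] := As u Au.
  have ip : (i < size p)%N by move: iL; rewrite mem_iota add0n.
  rewrite ((Hg _).1 u Au); last by rewrite posW// mem_nth// size_map.
  rewrite (nth_map ([::], None))//; apply: ow_mem => //.
  by rewrite /W -surjective_pairing memW.
have fT u i : A u -> i \in L -> f (walk (W i) u) = nth None o i.
  move=> Au iL; have [_ up <-] := As u Au.
  have ip : (i < size p)%N by move: iL; rewrite mem_iota add0n.
  by rewrite (nth_map u) ?size_map// posW.
have so : A !=set0 -> size o = size p.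
  by move=> [u Au]; have [_ _ <-] := As u Au; rewrite !size_map.
have notTT y : ~ TT y -> g y = f y.
  move=> nT; apply: (Hg y).2 => u Au; apply/negP => /mapP[wc wp e]; apply: nT.
  apply/memTT; exists (index wc p); first by rewrite mem_iota add0n index_mem.
  by exists u => //; rewrite /W nth_index.
have mg : mcol g.
  move=> c; rewrite (_ : [set _ | _] = ([set x | f x = c] `\` TT) `|`
     \big[setU/set0]_(i <- [seq i <- L | nth None (map snd p) i == c]) T i).
    apply: measurableU; first exact: measurableD.
    by apply: big_ind => //; exact: measurableU.
  apply/seteqP; split => y /=.
    have [/memTT[i iL [u Au e]]|nT] := pselect (TT y) => gc; last by left; rewrite -notTT.
    right; apply/memTT; exists i; last by exists u.
    by rewrite mem_filter iL andbT -(gT u i Au iL) e gc.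
  move=> [[fc nT]|/memTT[i]]; first by rewrite notTT.
  by rewrite mem_filter => /andP[/eqP <- iL] [u Au <-]; rewrite gT.
exists g; split => //.
- move=> y H; apply: (Hg y).2 => u Au; apply/negP => yu; apply: (H u Au); exact: posn.
- apply: le_trans (_ : pr TT <= _).
    apply: pr_le => //; first exact: measurable_neq.
    by move=> y /= fg; apply: contrapT => nT; apply: fg; rewrite notTT.
  rewrite prTT (eq_big_seq (fun=> pr A)) => [|i iL]; last exact: prTi.
  by rewrite big_const_seq count_predT iter_addr_0 size_iota mulr_natl.
- move=> c; have [A0|A0] := pselect (A !=set0); last first.
    have -> : pr A = 0.
      rewrite (_ : A = set0) ?pr0//; apply/seteqP; split => // u Au; by apply: A0; exists u.
    rewrite mul0r addr0 /mass; congr pr; apply/seteqP; split => y /= <-.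
      by rewrite notTT// => /memTT[i _ [u Au _]]; apply: A0; exists u.
    by rewrite notTT// => /memTT[i _ [u Au _]]; apply: A0; exists u.
  rewrite /mass (countE g (map snd p) c) ?size_map// (countE f o c) ?so//.
  have -> : [set x | g x = c] `\` TT = [set x | f x = c] `\` TT.
    by apply/seteqP; split => y [/= e nT]; split => //=; rewrite -e notTT.
  by rewrite mulrBr; lra.
Qed.

End Colorings.

(** * Brooks' theorem *)

Section HoleFix.
Context {V : eqType} (nbr : V -> seq V) (D : nat).
Hypothesis nbr_uniq : forall x, uniq (nbr x).
Hypothesis nbr_sym : forall x y, (y \in nbr x) = (x \in nbr y).
Hypothesis nbr_irr : forall x, x \notin nbr x.
Hypothesis nbr_size : forall x, (size (nbr x) <= D)%N.
Implicit Types (f g : V -> option 'I_D) (p ps : seq V).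

(** A hole moved next to another hole sees an uncoloured neighbour and is no longer full; so a stuck
    hole has no other hole within reach. *)
Lemma stuck_no_hole p f u : proper nbr f -> f u = None -> path (edge nbr) u p ->
  stuck nbr (size p) f u -> f (last u p) = None -> last u p = u.
Proof.
elim: p f u => [//|w p IH] f u pf fu /= /andP[wu pp] S fl.
have Hf := stuck0 S; have [_ fN _] := fullP nbr_size Hf.
have [pf' fw] := proper_shift nbr_sym nbr_irr nbr_size pf fu Hf wu.
apply: contrapT => /eqP lu.
have lw : last w p != w by apply/eqP => e; apply: (fN w wu); rewrite -e.
have : last w p = w.
  apply: (IH (shift f u w)) => //; first exact: (stuck_shift wu S).
  by rewrite /shift (negPf lu) (negPf lw).
by move/eqP: lw.
Qed.

Lemma hole_color f u : proper nbr f -> ~ full nbr f u ->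
  exists g, [/\ proper nbr g, forall z, z != u -> g z = f z & g u <> None].
Proof.
move=> pf nf; have [a Ha] : exists a, forall y, y \in nbr u -> f y <> Some a.
  apply: contrapT => H; apply: nf => a; apply: contrapT => Ha; apply: H; exists a => y yu fy.
  by apply: Ha; exists y.
exists (fun z => if z == u then Some a else f z); split; last by rewrite eqxx.
  move=> x y yx; have [xu|xu] := eqVneq x u.
    have [yu|yu] := eqVneq y u; first by move: yx; rewrite xu yu (negPf (nbr_irr u)).
    by move=> _ e; apply: (Ha y); rewrite ?e// -xu.
  have [yu|yu] := eqVneq y u; last exact: pf.
  by move=> _; apply: Ha; rewrite nbr_sym -yu.
by move=> z /negPf ->.
Qed.

(** Walks may revisit vertices, so the changed vertices are recorded as a duplicate-free [ps]. All
    of them end up coloured, which makes the repair a pattern that fills at least one hole. *)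
Lemma hole_fix p f u : proper nbr f -> f u = None -> path (edge nbr) u p ->
  ~ full nbr (shiftw f u p) (last u p) ->
  exists ps g, [/\ uniq ps, u \in ps, {subset ps <= u :: p}, proper nbr g &
    (forall z, z \notin ps -> g z = f z) /\ (forall z, z \in ps -> g z <> None)].
Proof.
have base f' u' q : proper nbr f' -> ~ full nbr f' u' ->
    exists ps g, [/\ uniq ps, u' \in ps, {subset ps <= u' :: q}, proper nbr g &
    (forall z, z \notin ps -> g z = f' z) /\ (forall z, z \in ps -> g z <> None)].
  move=> pf /(hole_color pf)[g [pg g1 g2]]; exists [:: u'], g; split => //.
  - by rewrite mem_head.
  - by move=> z; rewrite !inE => ->.
  - by split => z; rewrite inE; [exact: g1|move=> /eqP->].
elim: p f u => [|w p IH] f u pf fu; first by move=> _; exact: base.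
move=> /= /andP[wu pp] nf.
have [Hf|nHf] := pselect (full nbr f u); last exact: base.
have [_ fN _] := fullP nbr_size Hf.
have [pf' fw] := proper_shift nbr_sym nbr_irr nbr_size pf fu Hf wu.
have [ps [g [ups wps sps pg [g1 g2]]]] := IH _ _ pf' fw pp nf.
have sub z : z \in ps -> z \in [:: u, w & p] by move=> /sps; rewrite !inE => ->; rewrite orbT.
have g1' z : z \notin ps -> z != u -> g z = f z.
  move=> zps zu; rewrite g1// /shift (negPf zu); case: eqVneq => // zw.
  by move: zps; rewrite zw wps.
have [ups'|ups'] := boolP (u \in ps).
  exists ps, g; split => //; split => // z zps; apply: g1' => //.
  by apply: contraNneq zps => ->.
exists (u :: ps), g; split => //.
- by rewrite /= ups'.
- by rewrite mem_head.
- by move=> z; rewrite inE => /orP[/eqP->|/sub//]; rewrite mem_head.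
- split => z; first by rewrite inE negb_or => /andP[zu zps]; exact: g1'.
  rewrite inE => /orP[/eqP->|/g2//].
  by rewrite g1// /shift eqxx; exact: fN.
Qed.

End HoleFix.

(** * Brooks' theorem without measurability *)

Section FiniteBrooks.
Context {V : choiceType} (nbr : V -> seq V) (D : nat).
Hypothesis nbr_uniq : forall x, uniq (nbr x).
Hypothesis nbr_sym : forall x y, (y \in nbr x) = (x \in nbr y).
Hypothesis nbr_irr : forall x, x \notin nbr x.
Hypothesis nbr_size : forall x, (size (nbr x) <= D)%N.
Hypothesis D3 : (3 <= D)%N.
Hypothesis no_clique : forall s, uniq s -> size s = D.+1 ->
  ~ {in s &, forall x y, x != y -> y \in nbr x}.

(** Vertices are added one at a time. A new vertex that cannot be repaired is stuck in the graph
    induced on [x :: F], and growth would put [2 ^ size F] distinct vertices into [F]. *)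
Lemma finite_brooks (F : seq V) : exists f : V -> option 'I_D,
  forall x, x \in F -> f x <> None /\ forall y, y \in F -> y \in nbr x -> f x <> f y.
Proof.
elim: F => [|x F [f Hf]]; first by exists (fun=> None).
have [xF|xF] := boolP (x \in F).
  exists f => z; rewrite inE => /orP[/eqP->|/Hf[zN Hz]].
    have [xN Hx] := Hf _ xF; split => // y; rewrite inE => /orP[/eqP->|]; last exact: Hx.
    by rewrite (negPf (nbr_irr x)).
  by split => // y; rewrite inE => /orP[/eqP->|]; apply: Hz.
pose nF z := if z \in x :: F then [seq y <- nbr z | y \in x :: F] else [::].
have nFE z y : (y \in nF z) = [&& z \in x :: F, y \in x :: F & y \in nbr z].
  by rewrite /nF; case: ifP => //; rewrite mem_filter.
have nF_uniq z : uniq (nF z) by rewrite /nF; case: ifP => // _; rewrite filter_uniq.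
have nF_sym z y : (y \in nF z) = (z \in nF y).
  rewrite !nFE (nbr_sym z y). by rewrite andbCA.
have nF_irr z : z \notin nF z by rewrite nFE (negPf (nbr_irr z)) !andbF.
have nF_size z : (size (nF z) <= D)%N.
  rewrite /nF; case: ifP => // _; apply: leq_trans (nbr_size z).
  by rewrite size_filter count_size.
have nF_clique s : uniq s -> size s = D.+1 -> ~ {in s &, forall x y, x != y -> y \in nF x}.
  move=> us ss H; apply: (no_clique us ss) => a b as_ bs ab.
  by have := H a b as_ bs ab; rewrite nFE => /and3P[].
pose f1 z := if z \in F then f z else None.
have f1x : f1 x = None by rewrite /f1 (negPf xF).
have pf1 : proper nF f1.
  move=> z y; rewrite nFE /f1 => /and3P[_ _ yz].
  case: ifP => // zF; have [zN H] := Hf _ zF; case: ifP => // yF _.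
  exact: H.
pose k := size F; pose N := k.*2.+1; pose n0 := (N + (N.*2 + 8) * (N.*2 + 8))%N.
have nstuck : ~ stuck nF n0 f1 x.
  move=> S; have [||s [us ss Hs]] :=
    stuck_growth nF_uniq nF_sym nF_irr nF_size D3 nF_clique pf1 f1x S (N := N) _ (k := k) => //.
    exact: leqnn.
  have : (size s <= size F)%N.
    apply: uniq_leq_size => // y /Hs Ly.
    have [w yw Lw] := lev_parent nF_sym Ly.
    have : y \in x :: F by move: yw; rewrite nF_sym nFE => /and3P[].
    rewrite inE => /orP[/eqP yx|//]; move: Ly; rewrite yx => Lx.
    have L0 : lev nF x 0 x by apply/lev0.
    by have := lev_inj Lx L0.
  by rewrite ss leqNgt ltn_expl.
have [p [pp pn nf]] : exists p, [/\ path (edge nF) x p, (size p <= n0)%N &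
    ~ full nF (shiftw f1 x p) (last x p)].
  apply: contrapT => H; apply: nstuck => p pp pn; apply: contrapT => nf; apply: H.
  by exists p.
have [ps [g [_ xps _ pg [g1 g2]]]] := hole_fix nF_sym nF_irr nF_size pf1 f1x pp nf.
have gN z : z \in x :: F -> g z <> None.
  move=> zF; have [/g2//|zps] := boolP (z \in ps); rewrite g1// /f1.
  move: zF; rewrite inE => /orP[/eqP zx|zF]; first by move: zps; rewrite zx xps.
  by rewrite zF; have [] := Hf _ zF.
exists g => z zF; split; first exact: gN.
by move=> y yF yz; apply: pg; [rewrite nFE zF yF|exact: gN].
Qed.

(** Compactness: an ultrafilter containing the colourings proper on each finite set decides every
    colour. *)
Lemma brooks : exists f : V -> 'I_D, forall x y, y \in nbr x -> f x <> f y.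
Proof.
pose P (F : seq V) := [set f : V -> option 'I_D |
  forall x, x \in F -> f x <> None /\ forall y, y \in F -> y \in nbr x -> f x <> f y].
pose B : set_system (V -> option 'I_D) := [set S | exists F, P F `<=` S].
have PS F F' : {subset F <= F'} -> P F' `<=` P F.
  move=> sF f Hf x /sF xF; have [fN H] := Hf x xF; split => // y /sF; exact: H.
have FB : Filter B.
  split.
  - by exists [::].
  - move=> S T [F FS] [F' FT]; exists (F ++ F') => f Hf; split.
      by apply: FS; apply: PS Hf => z zF; rewrite mem_cat zF.
    by apply: FT; apply: PS Hf => z zF; rewrite mem_cat zF orbT.
  - by move=> S T ST [F FS]; exists F; exact: (subset_trans FS ST).
have PB : ProperFilter B.
  by split => // -[F F0]; have [f Hf] := finite_brooks F; exact: (F0 f Hf).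
have [U [UU BU]] := ultraFilterLemma PB.
have BP F : U (P F) by apply: BU; exists F.
have pick x : exists a : 'I_D, U [set g | g x = Some a].
  apply: contrapT => H.
  have : U (P [:: x] `&` \bigcap_(a : 'I_D) [set g | g x <> Some a]).
    apply: filterI; first exact: BP.
    have : \forall g \near U, forall a : 'I_D, g x <> Some a.
      apply: filter_forall => a.
      have [Ua|//] := in_ultra_setVsetC [set g : V -> option 'I_D | g x = Some a] UU.
      by case: H; exists a.
    by apply: filterS => g Hg a _; exact: Hg.
  move=> /filter_ex[g [Hg1 Hg2]]; have [] := Hg1 x (mem_head _ _).
  by case E : (g x) => [a|//] _ _; exact: (Hg2 a Logic.I).
have /choice[f Hf] := pick; exists f => x y yx fxy.
have : U (P [:: x; y] `&` ([set g | g x = Some (f x)] `&` [set g | g y = Some (f y)])).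
  by apply: filterI => //; apply: filterI.
move=> /filter_ex[g [Hg [/= gx gy]]].
have [_ /(_ y)] := Hg x (mem_head _ _); rewrite !inE eqxx orbT => /(_ isT yx).
by rewrite gx gy fxy.
Qed.

End FiniteBrooks.

(** * Measurable colouring off a null set *)

Section MeasurableBrooks.
Context {d : measure_display} {V : measurableType d} {R : realType}.
Variables (adj : V -> V -> Prop) (D : nat) (h : V -> R) (nu : nat -> V -> V).
Hypothesis G : borel_nbr adj D h nu.
Variable mu : probability V R.
Hypothesis invmu : invariant_measure adj mu.
Hypothesis D3 : (3 <= D)%N.
Hypothesis noclique : ~ has_clique adj D.+1.
Local Notation walk := (walk nu).
Local Notation nbrs := (nbrs D nu).
Local Notation C := (option 'I_D).
Local Notation pr := (pr mu).
Local Notation mass := (mass mu).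
Local Notation cdist := (cdist mu).
Implicit Types (f g : V -> C) (A : set V) (x y u : V).

Definition pcol f := mcol f /\ proper nbrs f.

Lemma nbrs_no_clique s : uniq s -> size s = D.+1 ->
  ~ {in s &, forall x y, x != y -> y \in nbrs x}.
Proof.
move=> us ss H; apply: noclique; exists s; split => //; split => // x y xs ys xy.
by apply/(mem_nbrs G); exact: H.
Qed.

Lemma walk_near p u : path (edge nbrs) u p -> near nu (size p) u (last u p).
Proof.
elim: p u => [|w p IH] u /=; first by exists [::].
by move=> /andP[uw /IH]; rewrite -add1n; apply: near_trans; exact: (near_nbr G uw).
Qed.

Lemma near_path r u y : near nu r u y ->
  exists2 p, path (edge nbrs) u p & (size p <= r)%N /\ last u p = y.
Proof.
move=> [s sr <-]; elim: s r u sr => [|i s IH] r u; first by exists [::].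
case: r => //= r sr; have [p pp [ps pl]] := IH r (nu i u) sr.
have [e|ne] := eqVneq (nu i u) u.
  rewrite /= e in pp pl *; exists p => //; split => //; exact: leqW.
exists (nu i u :: p); last by split.
by rewrite /= pp andbT; exact: (nu_nbrs G ne).
Qed.

Lemma size_bound (p : pattern D) : exists r, all (fun wc => size wc.1 <= r)%N p.
Proof.
elim: p => [|[w c] p [r Hr]]; first by exists 0%N.
exists (maxn (size w) r) => /=; rewrite leq_maxl/=.
by apply: sub_all Hr => wc; rewrite leq_max orbC => ->.
Qed.

Lemma separated_piece n A : measurable A -> 0 < pr A ->
  exists B, [/\ measurable B, B `<=` A, separated nu n B & 0 < pr B].
Proof.
move=> mA A0; have [Q [mQ sQ cQ]] := separated_cover G n.
apply: contrapT => H; move: A0; rewrite (@pr_null_cover _ _ _ mu A Q)// ?ltxx//.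
move=> k; apply: contrapT => /eqP ne; apply: H; exists (A `&` Q k); split.
- exact: measurableI.
- by move=> x [].
- by apply: separatedS (sQ k) => x [].
- by rewrite lt_neqAle eq_sym ne; exact: pr_ge0.
Qed.

Lemma null_patterns (N : pattern D -> seq C -> Prop) f : mcol f -> proper nbrs f ->
  (forall p o, N p o -> pr [set u | site nu f p o u] = 0) ->
  exists Z, [/\ measurable Z, pr Z = 0 &
    forall u p o, N p o -> site nu f p o u -> Z u].
Proof.
move=> mf pf N0; pose F (po : pattern D * seq C) := [set u | N po.1 po.2 /\ site nu f po.1 po.2 u].
have mF po : measurable (F po).
  have [Np|nNp] := pselect (N po.1 po.2).
    rewrite (_ : F po = [set u | site nu f po.1 po.2 u]); first exact: (measurable_site G).
    by apply/seteqP; split => u; [case|split].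
  by rewrite (_ : F po = set0)//; apply/seteqP; split => u //; case.
have mZ : measurable (\bigcup_po F po) by exact: measurable_bigcup_count.
exists (\bigcup_po F po); split => //; last by move=> u p o Np Su; exists (p, o).
apply: (@pr_null_cover _ _ _ mu _ (fun n => if unpickle n is Some po then F po else set0)) => //.
- by move=> n; case: unpickle.
- by move=> u [po _ Fu]; exists (pickle po); rewrite pickleK.
- move=> n; case: unpickle => [po|]; last by rewrite setI0 pr0.
  have [Np|nNp] := pselect (N po.1 po.2).
    apply/eqP; rewrite eq_le pr_ge0 andbT -(N0 _ _ Np); apply: pr_le.
    + exact: measurableI.
    + exact: (measurable_site G).
    + by move=> u [_ []].
  by rewrite (_ : _ `&` _ = set0) ?pr0//; apply/seteqP; split => u // [_ []].
Qed.

(** The rate is [n.+1%:R^-1] because a repair along a walk of length at most [n] changes at most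
    [n.+1] vertices and fills at least one hole. Beyond that rate no repair survives on a set of
    positive measure. *)
Lemma brooks_stage n f0 : pcol f0 -> exists f, [/\ pcol f,
  cdist f0 f <= n.+1%:R * (mass f0 None - mass f None) &
  exists Z, [/\ measurable Z, pr Z = 0 & forall u, ~ Z u -> f u = None -> stuck nbrs n f u]].
Proof.
move=> Kf0; have n0 : 0 < (n.+1%:R)^-1 :> R by rewrite invr_gt0.
have [|||||f [Kf df fmin]] := @ekeland R (V -> C) pcol cdist (fun f => mass f None)
   (n.+1%:R^-1) 1 n0 ler01 _ _ _ _ _ f0 Kf0.
- by move=> f _; rewrite cdistxx.
- by move=> f g k [mf _] [mg _] [mk _]; exact: cdist_tri.
- by move=> f _; exact: pr_ge0.
- by move=> f g [mf _] [mg _]; rewrite mul1r; exact: mass_lip.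
- move=> u e L Ku ue Le _; have [f [mf df fE]] := coloring_limit (fun n => (Ku n).1) ue Le.
  exists f => //; split => // x y yx; case E : (f x) => [a|//] _ /esym F.
  have [m1 H1] := fE _ _ E; have [m2 H2] := fE _ _ F.
  have [_ pu] := Ku (maxn m1 m2); apply: (pu x y yx).
    by rewrite H1 ?leq_maxl.
  by rewrite H1 ?leq_maxl// H2 ?leq_maxr.
have [mf pf] := Kf; exists f; split => //.
  by move: df; rewrite -(ler_pM2l (x := n.+1%:R))// mulrA mulfV ?mul1r// pnatr_eq0.
pose N (p : pattern D) (o : seq C) :=
  [/\ (size p <= n.+1)%N, None \notin map snd p & None \in o].
have [p o [pn pN oN]|Z [mZ Z0 HZ]] := @null_patterns N f mf pf.
  have mS := measurable_site G p o mf pf.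
  apply: contrapT => /eqP ne.
  have S0 : 0 < pr [set u | site nu f p o u] by rewrite lt_neqAle eq_sym ne; exact: pr_ge0.
  have [r pr_] := size_bound p.
  have [A [mA AS sA A0]] := separated_piece (r + r).+1 mS S0.
  have [g [mg pg _ dg mass_g]] := apply_pattern G invmu mf pf pr_ mA AS sA.
  have c0 : count_mem None (map snd p) = 0%N by exact/count_memPn.
  have c1 : 1 <= (count_mem None o)%:R :> R by rewrite ler1n -has_count has_pred1.
  have gm : mass g None <= mass f None - pr A.
    rewrite mass_g c0 sub0r mulrN lerD2l lerN2.
    by rewrite -[X in X <= _]mulr1 ler_pM2l.
  have /= H := fmin g (conj mg pg).
  have dg' : n.+1%:R^-1 * cdist f g <= pr A.
    rewrite mulrC ler_pdivrMr// mulrC; apply: le_trans dg _.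
    by rewrite ler_wpM2r ?pr_ge0// ler_nat.
  have : mass f None <= mass g None by apply: H; apply: le_trans dg' _; lra.
  by lra.
exists Z; split => // u nZ fu p pp pn; apply: contrapT => nf; apply: nZ.
have [ps [g [ups uin sps pg [g1 g2]]]] := hole_fix (nbrs_sym G) (nbrs_irr G) (@nbrs_size _ _ _ nu) pf fu pp nf.
have /choice[w Hw] : forall z, exists s, z \in ps -> walk s u = z.
  move=> z; have [zps|_] := boolP (z \in ps); last by exists [::].
  have [s _ <-] : near nu (size p) u z.
    have := sps z zps; rewrite inE => /orP[/eqP->|zp]; first by exists [::].
    case/splitPr: zp pp {pn nf sps} => p1 p2; rewrite cat_path => /andP[pp1 /= /andP[e _]].
    have : path (edge nbrs) u (rcons p1 z) by rewrite rcons_path pp1.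
    move=> /walk_near; rewrite last_rcons => -[s ss <-]; exists s => //.
    by apply: leq_trans ss _; rewrite size_rcons size_cat/= addnS ltnS leq_addr.
  by exists s.
pose q : pattern D := [seq (w z, g z) | z <- ps].
have posq : pos nu q u = ps.
  rewrite /pos -map_comp -[RHS]map_id; apply/eq_in_map => z zps /=; exact: Hw.
apply: (HZ u q (map f ps)).
- split.
  + rewrite size_map (leq_trans (uniq_leq_size ups sps))//.
  + by rewrite -map_comp; apply/mapP => -[z zps /= /esym]; exact: g2.
  + by rewrite -fu; exact: map_f.
- split; rewrite ?posq//.
  have -> // : ow nu f q u = g.
  apply: funext => y; have [yps|yps] := boolP (y \in ps).
    rewrite -{1}(Hw y yps); apply: ow_mem; first by rewrite posq.
    by apply/mapP; exists y.
  by rewrite ow_notin ?posq// g1.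
Qed.

(* Stuck holes are far apart and have large balls, so they form a small set. *)
Lemma stuck_mass k f Z : pcol f -> measurable Z -> pr Z = 0 ->
  (forall u, ~ Z u -> f u = None ->
    stuck nbrs (k.*2.+1 + (k.*2.+1.*2 + 8) * (k.*2.+1.*2 + 8)) f u) ->
  2 ^+ k * mass f None <= 1.
Proof.
move=> [mf pf] mZ Z0; set n := (X in stuck _ X) => HZ.
pose H := [set x | f x = None] `\` Z; have mH : measurable H by exact: measurableD.
have -> : mass f None = pr H.
  rewrite /mass (pr_split mu (mf None) mZ) (_ : pr (_ `&` _) = 0) ?add0r//.
  apply/eqP; rewrite eq_le pr_ge0 andbT -Z0; apply: pr_le => //; exact: measurableI.
pose m := k.*2.+1.
have apart u v y : H u -> H v -> near nu m u y -> near nu m v y -> u = v.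
  move=> [fu nZu] [fv _] uy vy; have Su := HZ u nZu fu.
  have [p pp [ps pl]] := near_path (near_trans uy (near_sym G vy)).
  rewrite -pl; apply/esym; apply: (stuck_no_hole (nbrs_sym G) (nbrs_irr G) (@nbrs_size _ _ _ nu) pf fu pp).
    by apply: stuckS Su; apply: leq_trans ps _; rewrite /n /m; nia.
  by rewrite pl.
have ball u : H u -> exists s, [/\ uniq s, size s = (2 ^ k)%N & forall y, y \in s -> near nu m u y].
  move=> [fu nZu]; have Su := HZ u nZu fu.
  have [|s [us ss Hs]] := stuck_growth (nbrs_uniq G) (nbrs_sym G) (nbrs_irr G) (@nbrs_size _ _ _ nu)
     D3 nbrs_no_clique pf fu Su (N := m) _ (k := k) (leqnn _).
    exact: leqnn.
  exists s; split => // y /Hs[[p [pp <- pm]] _]; rewrite /m -pm; exact: walk_near.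
pose W := words D m.
have memW s : s \in W -> size s = m by rewrite mem_words => /andP[/eqP].
(* [F s] keeps the holes for which no earlier word has the same endpoint as [s], so that [cF] counts
   distinct endpoints. *)
pose F s := H `&` \bigcap_(t in [set t | (index t W < index s W)%N]) [set x | walk t x <> walk s x].
have mF s : measurable (F s).
  apply: measurableI => //.
  rewrite (_ : bigcap _ _ = \bigcap_(t : seq nat) [set x | (index t W < index s W)%N -> walk t x <> walk s x]).
    apply: measurable_bigcap_count => t; case: (ltnP (index t W) (index s W)) => ts.
      rewrite (_ : [set _ | _] = ~` [set x | walk t x = walk s x]).
        apply: measurableC; apply: (measurable_eqset G); exact: (measurable_walk G).
      by apply/seteqP; split => x /=; [exact|move=> ? _].
    by rewrite (_ : [set _ | _] = setT)//; apply/seteqP; split.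
  by apply/seteqP; split => x /= Hx t; [move=> _; exact: Hx|exact: (Hx t Logic.I)].
have cF x : H x -> (2 ^ k <= count (fun s => `[< F s x >]) W)%N.
  move=> Hx; have [s [us <- Hs]] := ball x Hx.
  rewrite -size_filter -(size_map (fun t => walk t x)); apply: uniq_leq_size => // y /Hs[t tm ty].
  have [t' t'W t'E] := words_walk G tm.
  have hasW : has (fun s => walk s x == y) W.
    by apply/hasP; exists t' => //; rewrite t'E ty.
  pose i := find (fun s => walk s x == y) W; pose s0 := nth [::] W i.
  have iW : (i < size W)%N by rewrite -has_find.
  have s0W : s0 \in W by rewrite mem_nth.
  have s0y : walk s0 x = y by apply/eqP; exact: (nth_find [::] hasW).
  apply/mapP; exists s0 => //; rewrite mem_filter s0W andbT; apply/asboolP; split => // t1 /= t1s.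
  rewrite index_uniq ?uniq_words// in t1s.
  have := before_find [::] t1s; rewrite nth_index; first by move=> /eqP; rewrite s0y.
  by rewrite -index_mem (ltn_trans t1s).
have := pr_count mu mF mH cF; rewrite natrX; move=> /le_trans; apply.
have dF s t : s \in W -> t \in W -> s != t -> walk s @` F s `&` walk t @` F t = set0.
  move=> sW tW st; apply/seteqP; split => // y [[u [Hu Fu] e1] [v [Hv Fv] e2]].
  have uv : u = v.
    by apply: (apart u v y) => //; [exists s => //; rewrite memW|exists t => //; rewrite memW].
  case: (ltngtP (index s W) (index t W)) => ist.
  - by apply: (Fv s ist); rewrite -{1}uv e1.
  - by apply: (Fu t ist); rewrite {1}uv e1.
  - by move/eqP: st; apply; rewrite -(nth_index [::] sW) ist nth_index.
have mI s : measurable (walk s @` F s) by exact: (measurable_walk_image G).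
have [mU prU_] := pr_big_disjoint mu mI (uniq_words D m) dF.
apply: le_trans (pr_le1 mu mU); rewrite prU_.
rewrite !big_seq; apply: ler_sum => s sW.
have -> : pr (walk s @` F s) = pr (F s).
  rewrite /pr (invariant_walk G invmu)// => x y /set_mem[Hx _] /set_mem[Hy _] e.
  by apply: (apart x y (walk s x)) => //; [exists s|exists s]; rewrite ?memW.
by apply: pr_le => //; exact: measurableI.
Qed.

(** Bernoulli's inequality for the ratio 4/3. *)
Lemma geometric_decay (k : nat) : (3 / 4) ^+ k * (1 + k%:R / 3) <= 1 :> R.
Proof.
elim: k => [|k IH]; first by rewrite expr0 mul0r addr0 mul1r.
have q0 : 0 < (3 / 4) ^+ k :> R by rewrite exprn_gt0//; lra.
apply: le_trans IH; rewrite exprSr -mulrA ler_pM2l//.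
have k0 : 0 <= k%:R :> R by [].
by rewrite -[k.+1%:R]natr1; lra.
Qed.

Lemma small_of_geometric (x c : R) : 0 <= c ->
  (forall k, x <= c * (3 / 4) ^+ k) -> x <= 0.
Proof.
move=> c0 H; rewrite leNgt; apply/negP => x0.
pose k := (Num.truncn (3 * c / x)).+1.
have hk : 3 * c / x < k%:R by exact: truncnS_gt.
have k0 : 0 <= k%:R :> R by [].
have q0 : 0 < 1 + k%:R / 3 :> R by lra.
have := H k; have := geometric_decay k; set q := _ ^+ k => h1 h2.
have : x * (1 + k%:R / 3) <= c.
  apply: le_trans (_ : c * q * (1 + k%:R / 3) <= _); first by rewrite ler_pM2r.
  by rewrite -mulrA -[X in _ <= X]mulr1 ler_wpM2l.
rewrite ltr_pdivrMr// in hk.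
by rewrite mulrDr mulr1 mulrA; lra.
Qed.

Lemma stage_size_bound k :
  ((k.+1.*2.+1 + (k.+1.*2.+1.*2 + 8) * (k.+1.*2.+1.*2 + 8)).+1)%:R <= 290 * (3 / 2) ^+ k :> R.
Proof.
(* In [j^2 + 4 j + 10] the linear and constant terms grow by exactly 3/2 from [j] to [j.+1], so the
   induction closes. The factor 29 is the least integer that dominates [16 k^2 + 114 k + 200]
   coefficient by coefficient. *)
have poly_bound (j : nat) : 29 * j%:R ^+ 2 + 116 * j%:R + 290 <= 290 * (3 / 2) ^+ j :> R.
  elim: j => [|j IH]; first by rewrite expr0 expr0n/=; lra.
  rewrite [(3 / 2) ^+ _]exprSr mulrA; have j0 : 0 <= j%:R :> R by [].
  have : (29 * j%:R ^+ 2 + 116 * j%:R + 290) * (3 / 2) <= 290 * (3 / 2) ^+ j * (3 / 2) :> R.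
    by rewrite ler_pM2r//; lra.
  move=> H; apply: le_trans H; rewrite -[j.+1%:R]natr1 !expr2; nra.
apply: le_trans (poly_bound k).
have -> : ((k.+1.*2.+1 + (k.+1.*2.+1.*2 + 8) * (k.+1.*2.+1.*2 + 8)).+1 =
   16 * (k * k) + 114 * k + 200)%N by rewrite -!muln2; nia.
have k0 : 0 <= k%:R :> R by [].
by rewrite !natrD !natrM expr2; nra.
Qed.

Lemma stage_size_geometric : exists2 c : R, 0 <= c & forall k,
  ((k.+1.*2.+1 + (k.+1.*2.+1.*2 + 8) * (k.+1.*2.+1.*2 + 8)).+1)%:R <= c * (3 / 2) ^+ k.
Proof. by exists 290; [exact: ler0n|exact: stage_size_bound]. Qed.

Lemma pcol_limit (u : nat -> V -> C) (e : nat -> R) (L : R) : (forall n, pcol (u n)) ->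
  (forall n, cdist (u n) (u n.+1) <= e n - e n.+1) -> (forall n, L <= e n) ->
  exists f, pcol f /\ forall n, cdist (u n) f <= e n - L.
Proof.
move=> Ku ue Le; have [f [mf df fE]] := coloring_limit (fun k => (Ku k).1) ue Le.
exists f; split => //; split => // x y yx; case E : (f x) => [a|//] _ /esym F.
have [m1 H1] := fE _ _ E; have [m2 H2] := fE _ _ F.
have [_ pu] := Ku (maxn m1 m2); apply: (pu x y yx).
  by rewrite H1 ?leq_maxl.
by rewrite H1 ?leq_maxl// H2 ?leq_maxr.
Qed.

Lemma measurable_brooks : exists f, pcol f /\ mass f None = 0.
Proof.
have q34 : 0 <= 3 / 4 :> R by lra.
have q12 : 0 <= 1 / 2 :> R by lra.
have q1234 : 1 / 2 <= 3 / 4 :> R by lra.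
have q3 : 3 / 2 * (1 / 2) = 3 / 4 :> R by lra.
have [c c0 Hc] := stage_size_geometric.
have tele (x : R) : c * x = 4 * c * x - 4 * c * (x * (3 / 4)) by lra.
have last_bound (a b e m : R) : a <= b -> m <= a -> e <= 4 * c * b -> m + e <= (1 + 4 * c) * b by lra.
have c4 : 0 <= 4 * c by lra.
have c41 : 0 <= 1 + 4 * c by lra.
pose n k := (k.*2.+1 + (k.*2.+1.*2 + 8) * (k.*2.+1.*2 + 8))%N.
have /choice[nx Hnx] : forall kf : nat * (V -> C), exists g, pcol kf.2 -> [/\ pcol g,
    cdist kf.2 g <= (n kf.1).+1%:R * (mass kf.2 None - mass g None) & 2 ^+ kf.1 * mass g None <= 1].
  move=> [k f] /=; have [Kf|nKf] := pselect (pcol f); last by exists f.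
  have [g [Kg dg [Z [mZ Z0 HZ]]]] := brooks_stage (n k) Kf.
  by exists g => _; split => //; exact: (stuck_mass Kg mZ Z0 HZ).
pose u := fix u k := nx (k, if k is k'.+1 then u k' else cst None).
have K0 : pcol (cst None).
  split => [a|//]; have [<-|nc] := pselect (None = a).
    by rewrite (_ : [set _ | _] = setT)//; apply/seteqP; split.
  by rewrite (_ : [set _ | _] = set0)//; apply/seteqP; split.
have Ku k : pcol (u k).
  by elim: k => [|k IH]; [have [] := Hnx (0%N, cst None) K0|have [] := Hnx (k.+1, u k) IH].
have mu_ k : 2 ^+ k * mass (u k) None <= 1.
  by case: k => [|k]; [have [] := Hnx (0%N, cst None) K0|have [] := Hnx (k.+1, u k) (Ku k)].
have half k : mass (u k) None <= (1 / 2) ^+ k.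
  rewrite div1r exprVn -[X in _ <= X]mul1r ler_pdivlMr ?exprn_gt0// mulrC; exact: mu_.
(* Stage [k.+1] changes at most its size, bounded by [c] times [(3/2)^k], times the mass [(1/2)^k]
   left by stage [k]. [e k] is the tail from [k] on of the resulting series of ratio 3/4. *)
pose e k : R := 4 * c * (3 / 4) ^+ k.
have e0 k : 0 <= e k by apply: mulr_ge0 => //; exact: exprn_ge0.
have ue k : cdist (u k) (u k.+1) <= e k - e k.+1.
  have [_ dk _] := Hnx (k.+1, u k) (Ku k).
  apply: le_trans dk _; apply: le_trans (_ : (n k.+1).+1%:R * (1 / 2) ^+ k <= _).
    rewrite ler_wpM2l// (le_trans _ (half k))//= lerBlDr lerDl; exact: pr_ge0.
  apply: le_trans (_ : c * (3 / 2) ^+ k * (1 / 2) ^+ k <= _).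
    by apply: ler_wpM2r (Hc k); exact: exprn_ge0.
  by rewrite -mulrA -exprMn q3 /e exprSr -tele.
have [f [Kf df]] := pcol_limit Ku ue e0; have [mf _] := Kf.
exists f; split => //.
apply/eqP; rewrite eq_le pr_ge0 andbT; apply: (@small_of_geometric _ (1 + 4 * c)) => // k.
apply: le_trans (mass_lip mu None (Ku k).1 mf) _.
apply: (last_bound ((1 / 2) ^+ k)); [by rewrite lerXn2r ?nnegrE|exact: half|].
by have := df k; rewrite subr0.
Qed.

End MeasurableBrooks.

(** * Mass transport *)

Section MassTransport.
Context {d : measure_display} {V : measurableType d} {R : realType}.
Variable mu : probability V R.
Local Notation pr := (pr mu).
Implicit Types (phi psi : V -> nat) (A : set V).

Definition mnat phi := forall k, measurable [set x | phi x = k].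

Definition bnat phi := mnat phi /\ exists M, forall x, (phi x <= M)%N.

Definition expect phi : R := fine (\int[mu]_x ((phi x)%:R)%:E)%E.

Lemma mnat_set phi (Q : set nat) : mnat phi -> measurable [set x | Q (phi x)].
Proof.
move=> mp; rewrite (_ : [set _ | _] = \bigcup_(k in Q) [set x | phi x = k]).
  rewrite bigcup_mkcond; apply: bigcupT_measurable => k; case: ifP => // _.
by apply/seteqP; split => x /=; [move=> Qx; exists (phi x)|move=> [k Qk e]; rewrite e].
Qed.

Lemma measurable_mnat phi : mnat phi ->
  measurable_fun setT (fun x => ((phi x)%:R : R)%:E).
Proof.
move=> mp _ Y mY; rewrite setTI.
exact: (@mnat_set phi [set k | Y (k%:R)%:E] mp).
Qed.

Lemma mnat2 (F : nat -> nat -> nat) phi psi : mnat phi -> mnat psi ->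
  mnat (fun x => F (phi x) (psi x)).
Proof.
move=> m1 m2 k.
rewrite (_ : [set _ | _] = \bigcup_(a : nat) ([set x | phi x = a] `&` [set x | F a (psi x) = k])).
  apply: bigcupT_measurable => a; apply: measurableI => //.
  exact: (@mnat_set psi [set b | F a b = k] m2).
apply/seteqP; split => x /=; first by move=> e; exists (phi x).
by move=> [a _ [/= <-]].
Qed.

Lemma mnat_cst c : mnat (fun=> c).
Proof.
move=> k; have [e|e] := pselect (c = k).
  by rewrite (_ : [set _ | _] = setT)//; apply/seteqP; split.
by rewrite (_ : [set _ | _] = set0)//; apply/seteqP; split.
Qed.

Lemma mnat_bool (P : pred V) : measurable [set x | P x] -> mnat (fun x => P x : nat).
Proof.
move=> mP [|[|k]].
- rewrite (_ : [set _ | _] = ~` [set x | P x]); first exact: measurableC.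
  by apply/seteqP; split => x /=; case: (P x).
- by rewrite (_ : [set _ | _] = [set x | P x])//; apply/seteqP; split => x /=; case: (P x).
- by rewrite (_ : [set _ | _] = set0)//; apply/seteqP; split => x /=; case: (P x).
Qed.

Lemma bnat2 (F : nat -> nat -> nat) phi psi : bnat phi -> bnat psi ->
  bnat (fun x => F (phi x) (psi x)).
Proof.
move=> [m1 [M1 b1]] [m2 [M2 b2]]; split; first exact: mnat2.
exists (\max_(a < M1.+1) \max_(b < M2.+1) F a b)%N => x.
apply: leq_trans (leq_bigmax (Ordinal (b1 x : (phi x < M1.+1)%N))).
exact: (leq_bigmax (Ordinal (b2 x : (psi x < M2.+1)%N))).
Qed.

Lemma bnat_cst c : bnat (fun=> c).
Proof. by split; [exact: mnat_cst|exists c]. Qed.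

Lemma bnat_bool (P : pred V) : measurable [set x | P x] -> bnat (fun x => P x : nat).
Proof. by move=> mP; split; [exact: mnat_bool|exists 1%N => x; case: (P x)]. Qed.

Lemma bnat_sum (I : Type) (L : seq I) (F : I -> V -> nat) : (forall i, bnat (F i)) ->
  bnat (fun x => \sum_(i <- L) F i x)%N.
Proof.
move=> bF; elim: L => [|i L IH].
  by rewrite (_ : (fun _ => _) = fun=> 0%N); [exact: bnat_cst|apply/funext => x; rewrite big_nil].
rewrite (_ : (fun _ => _) = fun x => (F i x + \sum_(i <- L) F i x)%N).
  exact: bnat2.
by apply/funext => x; rewrite big_cons.
Qed.

Lemma expectE phi : bnat phi ->
  (\int[mu]_x ((phi x)%:R)%:E)%E = (expect phi)%:E.
Proof.
move=> [mp [M Mp]]; rewrite /expect fineK// ge0_fin_numE; last by apply: integral_ge0 => x _; rewrite lee_fin.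
apply: (@le_lt_trans _ _ (\int[mu]_x (cst (M%:R : R)%:E) x)%E).
  apply: ge0_le_integral => //.
  - exact (measurable_mnat mp).
  - by move=> x _; rewrite lee_fin ler_nat Mp.
rewrite integral_cst// [X in (_ * X)%E](_ : _ = 1%E); last exact: probability_setT.
by rewrite mule1 ltry.
Qed.

Lemma expect_le phi psi : bnat phi -> bnat psi -> (forall x, (phi x <= psi x)%N) ->
  expect phi <= expect psi.
Proof.
move=> bp bq le; rewrite -lee_fin -!expectE//; apply: ge0_le_integral => //.
- exact (measurable_mnat (proj1 bp)).
- exact (measurable_mnat (proj1 bq)).
- by move=> x _; rewrite lee_fin ler_nat.
Qed.

Lemma expectD phi psi : bnat phi -> bnat psi ->
  expect (fun x => phi x + psi x)%N = expect phi + expect psi.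
Proof.
move=> bp bq; apply: EFin_inj; rewrite EFinD -!expectE//; last exact: bnat2.
rewrite -ge0_integralD//; first by apply: eq_integral => x _; rewrite natrD EFinD.
- exact (measurable_mnat (proj1 bp)).
- exact (measurable_mnat (proj1 bq)).
Qed.

Lemma expectM c phi : bnat phi -> expect (fun x => c * phi x)%N = c%:R * expect phi.
Proof.
move=> bp; elim: c => [|c IH].
  by rewrite mul0r /expect (_ : (fun x => _) = cst 0%E) ?integral0.
rewrite -natr1 mulrDl mul1r -IH -expectD//; last by apply: (bnat2 muln) => //; exact: bnat_cst.
by congr expect; apply/funext => x; rewrite mulSn addnC.
Qed.

Lemma expect_bool (P : pred V) : measurable [set x | P x] ->
  expect (fun x => P x : nat) = pr [set x | P x].
Proof.
move=> mP; rewrite /expect /pr; congr fine.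
rewrite -[X in _ = mu X]setIT; apply: etrans (integral_indic mu measurableT mP).
apply: eq_integral => x _; rewrite indicE; congr (_%:R)%:E.
by case: (boolP (P x)) => Px; [rewrite mem_set|rewrite memNset//; exact/negP].
Qed.

Lemma expect_sum (I : Type) (L : seq I) (F : I -> V -> nat) : (forall i, bnat (F i)) ->
  expect (fun x => \sum_(i <- L) F i x)%N = \sum_(i <- L) expect (F i).
Proof.
move=> bF; elim: L => [|i L IH].
  rewrite big_nil -(mul0r (expect (fun=> 0%N))) -[0 in RHS]/(0%:R) -expectM; last exact: bnat_cst.
  by congr expect; apply/funext => x; rewrite big_nil.
rewrite big_cons -IH -expectD//; last exact: bnat_sum.
by congr expect; apply/funext => x; rewrite big_cons.
Qed.

Lemma sum_layers (a M : nat) : (a <= M)%N -> (\sum_(k <- iota 0 M) (k < a) = a)%N.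
Proof.
move=> aM; rewrite -(subnKC aM) iotaD big_cat /= add0n.
rewrite [X in (X + _)%N](_ : _ = a) ?[X in (_ + X)%N](_ : _ = 0%N) ?addn0//.
  by rewrite big_seq big1// => k; rewrite mem_iota => /andP[ak _]; rewrite ltnNge ak.
rewrite big_seq (eq_bigr (fun=> 1%N)); last by move=> k; rewrite mem_iota => /andP[_ ->].
by rewrite -big_seq sum1_size size_iota.
Qed.

(** Invariance of [mu] concerns sets; cutting into layers transfers it to functions. *)
Lemma expect_layers phi M : bnat phi -> (forall x, (phi x <= M)%N) ->
  expect phi = \sum_(k <- iota 0 M) pr [set x | (k < phi x)%N].
Proof.
move=> bp Mp; have mk k : measurable [set x | (k < phi x)%N].
  by have [mp _] := bp; exact: (@mnat_set phi [set a | (k < a)%N] mp).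
rewrite -(eq_bigr _ (fun k _ => expect_bool (mk k))) -expect_sum; last first.
  by move=> k; exact: bnat_bool.
congr expect; apply/funext => x.
by rewrite sum_layers.
Qed.

Variables (adj : V -> V -> Prop) (D : nat) (h : V -> R) (nu : nat -> V -> V).
Hypothesis G : borel_nbr adj D h nu.
Hypothesis invmu : invariant_measure adj mu.
Local Notation nbrs := (nbrs D nu).

(** Split by the index [i] of [y] among the neighbours of [x] and the index [j] of [x] among those
    of [y]. There step [i] is injective with inverse step [j], and carries the layers of [a i j]
    onto those of [b i j]. *)
Lemma mass_transport (w : V -> V -> nat) (M : nat) : (forall x y, (w x y <= M)%N) ->
  (forall i, mnat (fun x => w x (nu i x))) -> (forall j, mnat (fun y => w (nu j y) y)) ->
  expect (fun x => \sum_(y <- nbrs x) w x y)%N = expect (fun y => \sum_(x <- nbrs y) w x y)%N.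
Proof.
move=> wM m1 m2.
pose a i j x := (((nu i x != x) && (nu j (nu i x) == x)) * w x (nu i x))%N.
pose b i j y := (((nu j y != y) && (nu i (nu j y) == y)) * w (nu j y) y)%N.
have mnu := bn_nu G.
have mE i j : measurable [set x | (nu i x != x) && (nu j (nu i x) == x)].
  rewrite (_ : [set _ | _] = [set x | nu j (nu i x) = x] `\` [set x | nu i x = x]).
    apply: measurableD; apply: (measurable_eqset G) => //; try exact: measurable_id.
    exact: measurableT_comp.
  apply/seteqP; split => x /=; first by move=> /andP[/eqP ? /eqP].
  by move=> [-> /eqP ->]; rewrite eqxx.
have ba i j : bnat (a i j).
  split; first by apply: (mnat2 muln) => //; exact: mnat_bool.
  by exists M => x; rewrite /a; case: (_ && _); rewrite ?mul1n ?mul0n.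
have bb i j : bnat (b i j).
  split; first by apply: (mnat2 muln) => //; exact: mnat_bool.
  by exists M => x; rewrite /b; case: (_ && _); rewrite ?mul1n ?mul0n.
have ab i j : expect (a i j) = expect (b i j).
  rewrite (@expect_layers _ M)//; last first.
    by move=> x; rewrite /a; case: (_ && _); rewrite ?mul1n ?mul0n.
  rewrite (@expect_layers (b i j) M)//; last first.
    by move=> x; rewrite /b; case: (_ && _); rewrite ?mul1n ?mul0n.
  apply: eq_bigr => k _.
  have mA : measurable [set x | (k < a i j x)%N].
    by have [mp _] := ba i j; exact: (@mnat_set _ [set n | (k < n)%N] mp).
  have aE x : (k < a i j x)%N -> [/\ nu i x != x, nu j (nu i x) = x & (k < w x (nu i x))%N].
    rewrite /a; case: (boolP (nu i x != x)) => //= _; case: eqP => //= e.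
    by rewrite mul1n.
  have -> : [set y | (k < b i j y)%N] = walk nu [:: i] @` [set x | (k < a i j x)%N].
    apply/seteqP; split => y /=.
      rewrite {1}/b; case: (boolP (nu j y != y)) => //= jy; case: eqP => //= e.
      rewrite mul1n => kw; exists (nu j y) => //; rewrite /a e.
      by rewrite eq_sym jy eqxx mul1n.
    move=> [x /aE[ix jx kw] <-]; rewrite /b jx !eqxx eq_sym ix /= mul1n.
    exact: kw.
  rewrite /pr (invariant_walk G invmu)// => x y /set_mem/aE[_ xj _] /set_mem/aE[_ yj _] /= e.
  by rewrite -xj e yj.
have sumE (F : V -> nat) x : (\sum_(y <- nbrs x) F y = \sum_(i <- iota 0 D) (nu i x != x) * F (nu i x))%N.
  rewrite big_map big_filter big_mkcond; apply: eq_bigr => i _.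
  by case: (nu i x != x); rewrite ?mul1n ?mul0n.
have one i x : nu i x != x -> (\sum_(j <- iota 0 D) (nu j (nu i x) == x) = 1)%N.
  move=> ix; have xz : adj (nu i x) x by apply: (bn_sym G); apply: (bn_adj G); exact/eqP.
  have [j jD je] := bn_ex G xz.
  rewrite (bigD1_seq j) ?iota_uniq ?mem_iota//= je eqxx big1// => k kj.
  case: eqP => // ke; case/eqP: kj; apply: (bn_uniq G (x := nu i x)).
    by rewrite ke => e; move: ix; rewrite -e eqxx.
  by rewrite ke je.
have LE : (fun x => \sum_(y <- nbrs x) w x y)%N =
    (fun x => \sum_(i <- iota 0 D) \sum_(j <- iota 0 D) a i j x)%N.
  apply/funext => x; rewrite sumE; apply: eq_bigr => i _; rewrite /a -big_distrl /=.
  case: (boolP (nu i x != x)) => /= ix; last by rewrite big1 ?mul0n.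
  by rewrite one.
have RE : (fun y => \sum_(x <- nbrs y) w x y)%N =
    (fun y => \sum_(j <- iota 0 D) \sum_(i <- iota 0 D) b i j y)%N.
  apply/funext => y; rewrite sumE; apply: eq_bigr => j _; rewrite /b -big_distrl /=.
  case: (boolP (nu j y != y)) => /= jy; last by rewrite big1 ?mul0n.
  by rewrite one.
rewrite LE RE expect_sum; last by move=> i; exact: bnat_sum.
rewrite (eq_bigr _ (fun i _ => expect_sum _ (ba i))) exchange_big /=.
rewrite expect_sum; last by move=> j; apply: bnat_sum => i; exact: bb.
apply: eq_bigr => j _; rewrite expect_sum; last by move=> i; exact: bb.
by apply: eq_bigr => i _.
Qed.

End MassTransport.

(** * Colourings of locally minimal excess *)

Section Recoloring.
Context {d : measure_display} {V : measurableType d} {R : realType}.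
Variables (adj : V -> V -> Prop) (D : nat) (h : V -> R) (nu : nat -> V -> V).
Hypothesis G : borel_nbr adj D h nu.
Variable mu : probability V R.
Hypothesis invmu : invariant_measure adj mu.
Hypothesis at0 : atomless mu.
Local Notation walk := (walk nu).
Local Notation nbrs := (nbrs D nu).
Local Notation C := (option 'I_D).
Local Notation pr := (pr mu).
Local Notation mass := (mass mu).
Local Notation cdist := (cdist mu).
Local Notation pcol := (pcol nu).
Local Notation site := (site nu).
Implicit Types (f g : V -> C) (A : set V) (x y u : V).

Definition net (c : C) (po : pattern D * seq C) : R :=
  (count_mem c (map snd po.1))%:R - (count_mem c po.2)%:R.

Definition good f (po : pattern D * seq C) :=
  (size po.1 <= 3)%N /\ 0 < pr [set u | site f po.1 po.2 u].

Lemma pr_big_le (I : Type) (L : seq I) (F : I -> set V) (e : R) :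
  (forall i, measurable (F i)) -> (forall i, pr (F i) <= e) ->
  measurable (\big[setU/set0]_(i <- L) F i) /\
  pr (\big[setU/set0]_(i <- L) F i) <= (size L)%:R * e.
Proof.
move=> mF le; elim: L => [|i L [m1 IH]]; first by rewrite !big_nil pr0 mul0r.
rewrite !big_cons; split; first exact: measurableU.
apply: le_trans (prU_le mu (mF i) m1) _.
by rewrite -natr1 mulrDl mul1r addrC lerD.
Qed.

(** The patterns are applied in turn. [B] collects the bases near which the colouring has changed;
    its measure is at most proportional to [delta], so for small [delta] each pattern still has
    enough unspoilt sites. *)
Lemma apply_patterns f (L : seq (pattern D * seq C)) r : pcol f ->
  {in L, forall po, good f po /\ all (fun wc => size wc.1 <= r)%N po.1} ->
  exists2 delta0, 0 < delta0 & forall delta, 0 <= delta -> delta <= delta0 ->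
  exists g B, [/\ pcol g, measurable B,
    forall u, ~ B u -> forall y, near nu r.+1 u y -> g y = f y,
    pr B <= (size L * size (words D (r + r.+1)))%:R * delta /\
    cdist f g <= (3 * size L)%:R * delta &
    forall c, mass g c = mass f c + delta * \sum_(po <- L) net c po].
Proof.
move=> Kf; elim: L => [|[p o] L IH] HL.
  exists 1 => // delta d0 d1; exists f, set0; split => //.
    by rewrite pr0 muln0 cdistxx !mul0r.
  by move=> c; rewrite big_nil mulr0 addr0.
have [|d1 d10 {}IH] := IH; first by move=> po poL; apply: HL; rewrite inE poL orbT.
have [[/= p3 sp] pr_] := HL _ (mem_head _ _); rewrite /= in pr_.
have [mf pf] := Kf.
(* A copy of radius [r] affects legality at bases up to [r + r.+1] from its own base; twice this
   distance makes walks of that length injective on [T]. *)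
have [T [mT Ts sT T0]] := separated_piece G (r + r.+1 + (r + r.+1)) (measurable_site G p o mf pf) sp.
set W := size (words D (r + r.+1)) in IH *.
have k0 : 0 < (size L * W).+1%:R :> R by rewrite ltr0n.
exists (Num.min d1 (pr T / (size L * W).+1%:R)).
  by rewrite lt_min d10 divr_gt0.
move=> delta de0; rewrite le_min => /andP[dd1]; rewrite ler_pdivlMr// => dT.
have [g [B [Kg mB gB [prB dg] mg]]] := IH _ de0 dd1.
have mTB : measurable (T `\` B) by exact: measurableD.
have dTB : delta <= pr (T `\` B).
  have : pr (T `&` B) <= pr B by apply: pr_le => //; exact: measurableI.
  have := pr_split mu mT mB; move: dT prB; rewrite -natr1 mulrDr mulr1 [delta * _]mulrC.
  by move: (_ * delta) => t; lra.
have [A [mA AT prA]] := pr_subset (bn_h G) (bn_hinj G) at0 mTB de0 dTB.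
have sAN : separated nu (r + r.+1 + (r + r.+1)) A by apply: separatedS sT => u /AT[].
have sA : separated nu (r + r).+1 A.
  move=> x y Ax Ay xy s ss; apply: sAN => //; apply: leq_trans ss _.
  by rewrite -addnS leq_addr.
have [mg0 pg] := Kg.
have As u : A u -> site g p o u.
  move=> /AT[Tu Bu]; apply: (site_local G pr_ pg _ (Ts _ Tu)) => y ny; rewrite (gB u)//.
have [g' [mg' pg' gE dg' mg'E]] := apply_pattern G invmu mg0 pg pr_ mA As sA.
pose F t := if size t == (r + r.+1)%N then walk t @` A else set0.
have [||mU prU_] := @pr_big_le _ (words D (r + r.+1)) F delta.
- by move=> t; rewrite /F; case: ifP => // _; exact: (measurable_walk_image G).
- move=> t; rewrite /F; case: eqP => [ts|_]; last by rewrite pr0.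
  rewrite -prA /pr (invariant_walk G invmu)// => x y /set_mem Ax /set_mem Ay.
  by apply: (separated_inj G sAN); rewrite ?ts.
exists g', (B `|` \big[setU/set0]_(t <- words D (r + r.+1)) F t); split.
- by split.
- exact: measurableU.
- move=> u /not_orP[nB nU] y ny; rewrite -(gB u nB y ny); apply: gE => a Aa ay.
  apply: nU; have [s ss e] := near_trans ay (near_sym G ny).
  have [t tw tE] := words_walk G ss.
  rewrite -bigcup_seq; exists t => //=; move: (tw); rewrite mem_words /F => /andP[-> _].
  by exists a => //; rewrite tE.
- split.
    apply: le_trans (prU_le mu mB mU) _.
    by rewrite mulSn natrD mulrDl addrC lerD.
  apply: le_trans (cdist_tri mu mf mg0 mg') _; rewrite mulnS natrD mulrDl [leRHS]addrC.
  apply: lerD dg _; apply: le_trans dg' _.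
  rewrite prA; apply: ler_wpM2r => //; rewrite -[3]/(3%:R) ler_nat; exact: p3.
- by move=> c; rewrite mg'E mg prA big_cons /net; ring.
Qed.

Definition hinge (m t : R) := Num.max (m - t) 0.

(** The one-sided derivative of [hinge] in its first argument, at [m] in the direction [v]. *)
Definition slope (m t v : R) := if t < m then v else if m < t then 0 else Num.max v 0.

Lemma hinge_slope (m t v : R) : exists2 d1, 0 < d1 & forall delta, 0 <= delta -> delta <= d1 ->
  hinge (m + delta * v) t <= hinge m t + delta * slope m t v.
Proof.
have v0 : 0 < 1 + `|v| by rewrite ltr_pwDl.
have vn : - `|v| <= v <= `|v| by rewrite -ler_norml.
rewrite /hinge /slope; case: (ltgtP t m) => tm.
- exists ((m - t) / (1 + `|v|)); first by rewrite divr_gt0// subr_gt0.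
  move=> delta d0; rewrite ler_pdivlMr// => dm.
  have -> : Num.max (m - t) 0 = m - t by apply/max_idPl; lra.
  rewrite ge_max; move: vn => /andP[v1 v2]; apply/andP; split; first by lra.
  have := ler_wpM2l d0 v1; lra.
- exists ((t - m) / (1 + `|v|)); first by rewrite divr_gt0// subr_gt0.
  move=> delta d0; rewrite ler_pdivlMr// => dm.
  have -> : Num.max (m - t) 0 = 0 by apply/max_idPr; lra.
  rewrite ge_max; move: vn => /andP[v1 v2]; apply/andP; split; last by lra.
  have := ler_wpM2l d0 v2; lra.
- exists 1 => // delta d0 _; rewrite -tm subrr maxxx add0r addrAC subrr add0r.
  by rewrite maxr_pMr// mulr0.
Qed.

Lemma uniform_small (I : finType) (P : I -> R -> Prop) :
  (forall i, exists2 d1, 0 < d1 & forall delta, 0 <= delta -> delta <= d1 -> P i delta) ->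
  exists2 d1, 0 < d1 & forall delta, 0 <= delta -> delta <= d1 -> forall i, P i delta.
Proof.
move=> HP; suff [d1 d10 Hd1] : exists2 d1, 0 < d1 & forall delta, 0 <= delta -> delta <= d1 ->
    {in enum I, forall i, P i delta}.
  by exists d1 => // delta d0 dd i; apply: Hd1; rewrite ?mem_enum.
elim: (enum I) => [|i s [d1 d10 IH]]; first by exists 1.
have [d2 d20 Hi] := HP i; exists (Num.min d1 d2); first by rewrite lt_min d10.
move=> delta d0; rewrite le_min => /andP[dd1 dd2] j.
by rewrite inE => /orP[/eqP->|]; [exact: Hi|exact: IH].
Qed.

Definition excess f : R := \sum_(a : 'I_D) hinge (mass f (Some a)) D%:R^-1.

Lemma excess_ge0 f : 0 <= excess f.
Proof. by apply: sumr_ge0 => a _; rewrite le_max lexx orbT. Qed.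

Lemma excess_lip f g : mcol f -> mcol g -> excess g <= excess f + D%:R * cdist f g.
Proof.
move=> mf mg; have -> : D%:R * cdist f g = \sum_(a : 'I_D) cdist f g by rewrite sumr_const card_ord mulr_natl.
rewrite -big_split /=.
apply: ler_sum => a _; have := mass_lip mu (Some a) mf mg; rewrite /hinge.
have := pr_ge0 mu [set x | f x <> g x]; rewrite -/(cdist f g).
rewrite ge_max; move: (mass _ _) (mass _ _) (cdist _ _) => m1 m2 t t0 le.
have h1 : m1 - D%:R^-1 <= Num.max (m1 - D%:R^-1) 0 by rewrite le_max lexx.
have h2 : 0 <= Num.max (m1 - D%:R^-1) 0 by rewrite le_max lexx orbT.
by apply/andP; split; lra.
Qed.

Lemma mass_sum f : mcol f -> \sum_(a : 'I_D) mass f (Some a) + mass f None = 1.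
Proof.
move=> mf.
have [|||m1 E] := @pr_big_disjoint _ _ _ mu _ (index_enum 'I_D) (fun a => [set x | f x = Some a]).
- by move=> a; exact: mf.
- exact: index_enum_uniq.
- move=> a b _ _ ab; apply/seteqP; split => x //= [-> []] /eqP.
  by rewrite (negPf ab).
rewrite -{}E -(prT mu) -prU//.
  congr (pr _); rewrite -bigcup_seq; apply/seteqP; split => x // _.
  case E : (f x) => [a|]; [left|by right]; exists a => //=.
  by rewrite mem_index_enum.
by apply/seteqP; split => x //; rewrite -bigcup_seq => -[[a _ /= ->]].
Qed.

Lemma improve f L : pcol f -> {in L, forall po, good f po} ->
  \sum_(po <- L) net None po = 0 ->
  \sum_(a : 'I_D) slope (mass f (Some a)) D%:R^-1 (\sum_(po <- L) net (Some a) po) <= - 1 ->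
  exists delta g, [/\ 0 < delta, pcol g, mass g None = mass f None,
    cdist f g <= (3 * size L)%:R * delta & excess g <= excess f - delta].
Proof.
move=> Kf gL N0 S1.
have [r Hr] : exists r, {in L, forall po, all (fun wc => size wc.1 <= r)%N po.1}.
  elim: (L) => [|po L' [r IH]]; first by exists 0%N.
  have [r' Hr'] := size_bound po.1; exists (maxn r r') => po'.
  by rewrite inE => /orP[/eqP->|/IH H]; [apply: sub_all Hr'|apply: sub_all H] => wc wr;
    rewrite leq_max wr ?orbT.
have [|d1 d10 H1] := @apply_patterns f L r Kf; first by move=> po poL; split; [exact: gL|exact: Hr].
have [d2 d20 H2] := uniform_small (fun a => hinge_slope (mass f (Some a)) D%:R^-1
  (\sum_(po <- L) net (Some a) po)).
have d0 : 0 < Num.min d1 d2 by rewrite lt_min d10.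
exists (Num.min d1 d2).
have [|g [B [Kg _ _ [_ dg] mg]]] := H1 _ (ltW d0); first by rewrite ge_min lexx.
exists g; split => //; first by rewrite mg N0 mulr0 addr0.
rewrite /excess (eq_bigr (fun a => hinge (mass f (Some a) + Num.min d1 d2 *
  \sum_(po <- L) net (Some a) po) D%:R^-1)); last by move=> a _; rewrite mg.
apply: le_trans (ler_sum _ (fun a _ => H2 _ (ltW d0) _ a)) _.
  by rewrite ge_min lexx orbT.
rewrite big_split /= lerD2l -mulr_sumr -[leRHS]mulr1 mulNr -mulrN.
by rewrite ler_wpM2l// ltW.
Qed.

Definition transfer f (a b : 'I_D) := exists po, good f po /\
  forall c, net c po = (c == Some b)%:R - (c == Some a)%:R.

Definition big_color f (a : 'I_D) := D%:R^-1 < mass f (Some a).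

(* Chains of transfers have length at most [D], so two of them and one more pattern
   involve at most [2D + 1] patterns: this is where [rate] below comes from. *)
Definition reach f (b : 'I_D) : bool :=
  [exists a, big_color f a && connect (fun a b => `[<transfer f a b>]) a b].

Lemma reach_transfer f a b : reach f a -> transfer f a b -> reach f b.
Proof.
move=> /existsP[a0 /andP[ba ca]] ab; apply/existsP; exists a0; rewrite ba /=.
by apply: connect_trans ca _; apply: connect1; apply/asboolP.
Qed.

Lemma reach_chain f b : reach f b -> exists a L, [/\ big_color f a, (size L <= D)%N,
  {in L, forall po, good f po} &
  forall c, \sum_(po <- L) net c po = (c == Some b)%:R - (c == Some a)%:R].
Proof.
move=> /existsP[a /andP[ba /connectP[p0 pp ->]]].
case/shortenP: pp => p pp up _; exists a.
have: (size p <= D)%N.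
  apply: ltnW; have := card_uniqP up; rewrite /= => <-.
  by rewrite -[leqRHS]card_ord max_card.
have [L [<- gL NL]] : exists L, [/\ size L = size p, {in L, forall po, good f po} &
    forall c, \sum_(po <- L) net c po = (c == Some (last a p))%:R - (c == Some a)%:R].
  elim: p a {ba p0 up} pp => [|b' p IH] a /=.
    by exists [::]; split => // c; rewrite big_nil subrr.
  move=> /andP[/asboolP[po [gpo Npo]] /IH[L [sL gL NL]]]; exists (po :: L).
  split; first by rewrite /= sL.
    by move=> po'; rewrite inE => /orP[/eqP->//|]; exact: gL.
  by move=> c; rewrite big_cons Npo NL; ring.
by exists L.
Qed.

Definition rate : R := ((3 * (D + D).+1)%:R)^-1.

Definition optimal f := forall g, pcol g -> mass g None = 0 ->
  rate * cdist f g <= excess f - excess g -> excess f <= excess g.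

Lemma exists_optimal f0 : pcol f0 -> mass f0 None = 0 ->
  exists f, [/\ pcol f, mass f None = 0 & optimal f].
Proof.
move=> K0 N0; pose K f := pcol f /\ mass f None = 0.
have k0 : 0 < rate by rewrite invr_gt0 ltr0n.
have [||||||f [[Kf Nf] _ Of]] := @ekeland R (V -> C) K cdist excess rate D%:R k0 _ _ _ _ _ _ f0 (conj K0 N0).
- exact: ler0n.
- by move=> f _; rewrite cdistxx.
- by move=> f g f' [[? _] _] [[? _] _] [[? _] _]; exact: cdist_tri.
- by move=> f _; exact: excess_ge0.
- by move=> f g [[? _] _] [[? _] _]; exact: excess_lip.
- move=> u e L Ku ue Le Lsup.
  have [f [Kf df]] := pcol_limit (fun n => (Ku n).1) ue Le.
  exists f => //; split => //; apply/eqP; rewrite eq_le pr_ge0 andbT.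
  apply/ler_addgt0Pl => eps eps0; rewrite addr0; have [n Hn] := Lsup _ eps0.
  have := mass_lip mu None (Ku n).1.1 Kf.1; rewrite (Ku n).2 add0r => /le_trans; apply.
  by apply: le_trans (df n) _; rewrite lerBlDl ltW.
by exists f; split => // g Kg Ng; exact: Of.
Qed.

Section Optimum.
Variable f : V -> C.
Hypothesis Kf : pcol f.
Hypothesis Nf : mass f None = 0.
Hypothesis Of : optimal f.
Local Notation t := (D%:R^-1 : R).

Lemma no_improvement L : (size L <= (D + D).+1)%N -> {in L, forall po, good f po} ->
  \sum_(po <- L) net None po = 0 ->
  \sum_(a : 'I_D) slope (mass f (Some a)) t (\sum_(po <- L) net (Some a) po) <= - 1 -> False.
Proof.
move=> sL gL N0 S1; have [delta [g [d0 Kg Ng dg Eg]]] := improve Kf gL N0 S1.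
have : excess f <= excess g.
  apply: Of => //; first by rewrite Ng.
  rewrite /rate mulrC ler_pdivrMr ?ltr0n//; apply: le_trans dg _.
  apply: le_trans (_ : (3 * (D + D).+1)%:R * delta <= _).
    by rewrite ler_wpM2r ?ler_nat ?leq_mul2l ?sL ?orbT// ltW.
  by rewrite mulrC ler_wpM2r// lerBrDr addrC -lerBrDr.
by lra.
Qed.

Lemma sum_delta (b : 'I_D) : \sum_(a : 'I_D) (Some a == Some b)%:R = 1 :> R.
Proof.
rewrite (bigD1 b)//= eqxx big1 ?addr0// => a /negPf ab.
by rewrite (inj_eq Some_inj) ab.
Qed.

(** Otherwise a chain from a big colour [a] to [b] improves: losing mass at [a] has slope -1, and
    gaining it at the underfull [b] costs nothing. *)
Lemma reach_large b : reach f b -> t <= mass f (Some b).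
Proof.
move=> /reach_chain[a [L [ba sL gL NL]]]; rewrite leNgt; apply/negP => bs.
apply: (@no_improvement L) => //.
- by rewrite (leq_trans sL)// leqW// leq_addr.
- by rewrite NL subrr.
apply: (@le_trans _ _ (\sum_(c : 'I_D) - (Some c == Some a)%:R)); last first.
  by rewrite sumrN sum_delta.
apply: ler_sum => c _; rewrite NL /slope !(inj_eq Some_inj).
have [->|cb] := eqVneq c b.
  rewrite ltNge (ltW bs) /= bs; case: eqP => [e|_]; last by rewrite oppr0.
  by move: ba; rewrite /big_color -e ltNge (ltW bs).
rewrite sub0r; have [->|_] := eqVneq c a; first by rewrite [t < _]ba.
by rewrite oppr0 maxxx !if_same.
Qed.

(** With chains refilling [Y1] and [Y2], the net effect is a gain at [X] and at [W] and a loss at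
    each of [a1] and [a2]. The gain at the underfull [W] is free, so the total slope is at most 1 -
    2. *)
Lemma small_pattern_null W X Y1 Y2 w1 w2 w3 : mass f (Some W) < t -> reach f Y1 -> reach f Y2 ->
  pr [set u | site f [:: (w1, Some X); (w2, Some W); (w3, Some W)]
    [:: Some W; Some Y1; Some Y2] u] = 0.
Proof.
move=> Ws /reach_chain[a1 [L1 [b1 s1 g1 N1]]] /reach_chain[a2 [L2 [b2 s2 g2 N2]]].
apply/eqP; rewrite eq_le pr_ge0 andbT leNgt; apply/negP => Sp.
set po : pattern D * seq C := ([:: (w1, Some X); (w2, Some W); (w3, Some W)],
  [:: Some W; Some Y1; Some Y2]).
have NE c : \sum_(po <- po :: (L1 ++ L2)) net c po =
    (c == Some X)%:R + (c == Some W)%:R - (c == Some a1)%:R - (c == Some a2)%:R.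
  rewrite big_cons big_cat /= N1 N2 /net /= !natrD ![Some _ == c]eq_sym; ring.
apply: (@no_improvement (po :: (L1 ++ L2))).
- by rewrite /= size_cat ltnS leq_add.
- move=> po'; rewrite inE mem_cat => /orP[/eqP->//|/orP[]]; [exact: g1|exact: g2].
- by rewrite NE; lra.
apply: (@le_trans _ _ (\sum_(c : 'I_D) ((Some c == Some X)%:R -
   (Some c == Some a1)%:R - (Some c == Some a2)%:R))); last first.
  by rewrite !big_split /= !sumrN !sum_delta; lra.
apply: ler_sum => c _; rewrite NE /slope !(inj_eq Some_inj).
have aW a : big_color f a -> (W == a) = false.
  by move=> ba; apply/eqP => e; move: ba; rewrite /big_color -e ltNge (ltW Ws).
have [->|cW] := eqVneq c W.
  by rewrite ltNge (ltW Ws) /= Ws (aW _ b1) (aW _ b2) !subr0.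
have [->|_] := eqVneq c a1; first by rewrite [t < _]b1 addr0.
have [->|_] := eqVneq c a2; first by rewrite [t < _]b2 addr0.
have [t0 t1] : 0 <= (c == X)%:R :> R /\ Num.max ((c == X)%:R : R) 0 = (c == X)%:R.
  by split => //; apply/max_idPl.
by rewrite addr0 !subr0 t1; case: ltgtP.
Qed.

End Optimum.

(** The bad sites and the holes lie in a null set, and its saturation under walks is uncoloured. On
    the component of a point that stays coloured nothing changes, so no new site appears there. *)
Lemma clean f (N : pattern D -> seq C -> Prop) : pcol f -> mass f None = 0 ->
  (forall p o, N p o -> pr [set u | site f p o u] = 0) ->
  exists g, [/\ pcol g, mass g None = 0, forall a, mass g (Some a) = mass f (Some a),
    forall x y, y \in nbrs x -> g y = None -> g x = None &
    forall u p o, N p o -> g u <> None -> ~ site g p o u].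
Proof.
move=> Kf Nf N0; have [mf pf] := Kf.
have [Z [mZ Z0 ZN]] := null_patterns G mf pf N0.
have mZ1 : measurable (Z `|` [set x | f x = None]) by exact: measurableU.
have Z10 : mu (Z `|` [set x | f x = None]) = 0%E.
  apply/pr_eq0P => //; apply/eqP; rewrite eq_le pr_ge0 andbT.
  apply: le_trans (prU_le mu mZ (mf None)) _.
  by rewrite Z0 [pr [set x | _]]Nf addr0.
have [mS S0] := null_walk_saturation G invmu mZ1 Z10.
set S := \bigcup_s _ in mS S0; pose g x := if `[< S x >] then None else f x.
have SE x y r : near nu r x y -> S y -> S x.
  by move=> [s _ <-] [s' _ Zs]; exists (s ++ s') => //=; rewrite walk_cat.
have gN x : S x -> g x = None by move=> Sx; rewrite /g asboolT.
have gE x : ~ S x -> g x = f x by move=> Sx; rewrite /g asboolF.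
have fS x : f x = None -> S x by move=> fx; exists [::] => //; right.
have Sg x : g x = None -> S x by move=> gx; apply: contrapT => /[dup] /gE; rewrite gx => /esym/fS.
have mg : mcol g.
  move=> [a|].
    rewrite (_ : [set _ | _] = [set x | f x = Some a] `\` S); first exact: measurableD.
    apply/seteqP; split => x /=; first by rewrite /g; case: asboolP.
    by move=> [fx /gE->].
  by rewrite (_ : [set _ | _] = S)//; apply/seteqP; split => x /=; [exact: Sg|exact: gN].
have pg : proper nbrs g.
  move=> x y xy; rewrite /g; case: asboolP => // nSx fx.
  case: asboolP => [Sy|_]; last exact: pf.
  by case: nSx; apply: SE Sy; exact: (near_nbr G xy).
exists g; split => //.
- rewrite /mass (_ : [set _ | _] = S); first by apply/pr_eq0P.
  by apply/seteqP; split => x /=; [exact: Sg|exact: gN].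
- move=> a; rewrite /mass [RHS](@pr_split _ _ _ mu _ S)//.
  rewrite [X in X + _](_ : _ = 0) ?add0r.
    congr (pr _); apply/seteqP; split => x /=; first by rewrite /g; case: asboolP.
    by move=> [fx /gE->].
  apply/eqP; rewrite eq_le pr_ge0 andbT.
  have <- : pr S = 0 by apply/pr_eq0P.
  by apply: pr_le => //; exact: measurableI.
- by move=> x y xy /Sg Sy; apply: gN; apply: SE Sy; exact: (near_nbr G xy).
- move=> u p o Np gu su; have [r pr_] := size_bound p.
  have nSu : ~ S u by move=> /gN.
  apply: nSu; exists [::] => //; left; apply: ZN Np _.
  apply: (site_local G pr_ pf _ su) => y uy; apply: gE => Sy.
  exact: (gu (gN _ (SE _ _ _ uy Sy))).
Qed.

Lemma equitable_or_split f0 : (0 < D)%N -> pcol f0 -> mass f0 None = 0 ->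
  exists f, [/\ pcol f, mass f None = 0,
    forall x y, y \in nbrs x -> f y = None -> f x = None &
    (forall a, mass f (Some a) = D%:R^-1) \/
    exists (S : pred 'I_D) (W : 'I_D), [/\ exists a, S a, ~~ S W,
      mass f (Some W) <= D%:R^-1, forall a, S a -> D%:R^-1 <= mass f (Some a) &
      (forall u p o a b, S a -> ~~ S b -> (size p <= 3)%N ->
        (forall c, net c (p, o) = (c == Some b)%:R - (c == Some a)%:R) ->
        f u <> None -> ~ site f p o u) /\
      (forall u w1 w2 w3 X Y1 Y2, S Y1 -> S Y2 -> f u <> None ->
        ~ site f [:: (w1, Some X); (w2, Some W); (w3, Some W)]
          [:: Some W; Some Y1; Some Y2] u)]].
Proof.
move=> D0 K0 N0; have [f [Kf Nf Of]] := exists_optimal K0 N0.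
have [mf _] := Kf.
pose N p o := (exists a b, [/\ reach f a, ~~ reach f b, (size p <= 3)%N &
    forall c, net c (p, o) = (c == Some b)%:R - (c == Some a)%:R]) \/
  exists W X Y1 Y2 w1 w2 w3, [/\ mass f (Some W) < D%:R^-1, reach f Y1, reach f Y2,
    p = [:: (w1, Some X); (w2, Some W); (w3, Some W)] & o = [:: Some W; Some Y1; Some Y2]].
have [p o|f' [Kf' Nf' mE cl HN]] := @clean f N Kf Nf.
  move=> [[a [b [ra rb p3 pn]]]|[W [X [Y1 [Y2 [w1 [w2 [w3 [Ws r1 r2 -> ->]]]]]]]]]; last first.
    exact: small_pattern_null.
  apply/eqP; rewrite eq_le pr_ge0 andbT leNgt; apply/negP => Sp.
  by move/negP: rb; apply; apply: reach_transfer ra _; exists (p, o).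
exists f'; split => //.
have sumD : \sum_(a : 'I_D) (mass f (Some a) - D%:R^-1) = 0.
  rewrite big_split /= sumrN sumr_const card_ord -[_ *+ D]mulr_natl divff ?pnatr_eq0 -?lt0n//.
  by have := mass_sum mf; rewrite Nf addr0 => ->; rewrite subrr.
have [[b bb]|nb] := pselect (exists b, big_color f b); [right|left].
  have [W Ws] : exists W, mass f (Some W) < D%:R^-1.
    apply: contrapT => nW; have le a : 0 <= mass f (Some a) - D%:R^-1.
      by rewrite subr_ge0 leNgt; apply/negP => aW; apply: nW; exists a.
    have : mass f (Some b) - D%:R^-1 <= 0.
      by rewrite -sumD (bigD1 b)//= lerDl sumr_ge0.
    by rewrite subr_le0 leNgt => /negP; apply.
  exists (reach f), W; split.
  - by exists b; apply/existsP; exists b; rewrite bb connect0.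
  - by apply/negP => /(reach_large Kf Nf Of); rewrite leNgt Ws.
  - by rewrite mE ltW.
  - by move=> a ra; rewrite mE; exact: (reach_large Kf Nf Of).
  - split.
      move=> u p o a b' ra rb p3 pn; apply: HN; left; exists a, b'.
      by split.
    move=> u w1 w2 w3 X Y1 Y2 r1 r2; apply: HN; right.
    by exists W, X, Y1, Y2, w1, w2, w3.
have le a : mass f (Some a) - D%:R^-1 <= 0.
  by rewrite subr_le0 leNgt; apply/negP => ab; apply: nb; exists a.
move=> a; rewrite mE; apply/eqP; rewrite eq_le -subr_le0 le -subr_ge0 /=.
move: sumD; rewrite (bigD1 a)//= => /eqP; rewrite addr_eq0 => /eqP->.
by rewrite oppr_ge0 sumr_le0.
Qed.

End Recoloring.

(** * Degree counting *)

Section Counting.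
Context {d : measure_display} {V : measurableType d} {R : realType}.
Variables (adj : V -> V -> Prop) (D : nat) (h : V -> R) (nu : nat -> V -> V).
Hypothesis G : borel_nbr adj D h nu.
Variable mu : probability V R.
Hypothesis invmu : invariant_measure adj mu.
Hypothesis D0 : (0 < D)%N.
Local Notation nbrs := (nbrs D nu).
Local Notation C := (option 'I_D).
Local Notation pr := (pr mu).
Local Notation mass := (mass mu).
Local Notation pcol := (pcol nu).
Local Notation site := (site nu).
Local Notation expect := (expect mu).
Local Notation bnat := (@bnat d V).
Implicit Types (x y z w : V) (phi psi : V -> nat) (P Q : pred V).

Definition nsum phi x := (\sum_(y <- nbrs x) phi y)%N.

Lemma nsum_count P x : nsum (fun y => P y : nat) x = count P (nbrs x).
Proof. by rewrite /nsum -sum1_count [RHS]big_mkcond; apply: eq_bigr => y _; case: (P y). Qed.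

Lemma bnat_nu phi i : bnat phi -> bnat (fun x => phi (nu i x)).
Proof.
move=> [mp [M Mp]]; split; last by exists M.
by move=> k; exact: (measurable_preT (bn_nu G i) (mp k)).
Qed.

Lemma bnat_nsum phi : bnat phi -> bnat (nsum phi).
Proof.
move=> bp; rewrite (_ : nsum phi = fun x => (\sum_(i <- iota 0 D) (nu i x != x) * phi (nu i x))%N).
  apply: bnat_sum => i; apply: (bnat2 muln); last exact: bnat_nu.
  apply: bnat_bool; rewrite (_ : [set _ | _] = ~` [set x | nu i x = x]).
    apply: measurableC; apply: (measurable_eqset G); [exact: (bn_nu G)|exact: measurable_id].
  by apply/seteqP; split => x /= /eqP.
apply/funext => x; rewrite /nsum big_map big_filter big_mkcond; apply: eq_bigr => i _.
by case: (nu i x != x); rewrite ?mul1n ?mul0n.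
Qed.

Lemma transport phi psi : bnat phi -> bnat psi ->
  expect (fun x => phi x * nsum psi x)%N = expect (fun y => psi y * nsum phi y)%N.
Proof.
move=> bp bq; have [_ [M1 H1]] := bp; have [_ [M2 H2]] := bq.
rewrite (_ : (fun x => _) = fun x => \sum_(y <- nbrs x) (phi x * psi y))%N; last first.
  by apply/funext => x; rewrite big_distrr.
have w1 x y : (phi x * psi y <= M1 * M2)%N by rewrite leq_mul.
have w2 i : mnat (fun x => phi x * psi (nu i x))%N.
  by apply: (mnat2 muln); [exact: bp.1|exact: (bnat_nu i bq).1].
have w3 i : mnat (fun x => phi (nu i x) * psi x)%N.
  by apply: (mnat2 muln); [exact: (bnat_nu i bp).1|exact: bq.1].
rewrite (mass_transport G invmu w1 w2 w3); congr expect; apply/funext => y.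
by rewrite /nsum big_distrr; apply: eq_bigr => x _; rewrite mulnC.
Qed.

Variable f : V -> C.
Hypothesis Kf : pcol f.
Variables (S : pred 'I_D) (W : 'I_D).
Hypothesis S0 : exists a, S a.
Hypothesis SW : ~~ S W.
Hypothesis WM : mass f (Some W) <= D%:R^-1.
Hypothesis SM : forall a, S a -> D%:R^-1 <= mass f (Some a).
Hypothesis no_transfer : forall u p o a b, S a -> ~~ S b -> (size p <= 3)%N ->
  (forall c, net c (p, o) = (c == Some b)%:R - (c == Some a)%:R :> R) ->
  f u <> None -> ~ site f p o u.
Hypothesis no_triple : forall u (w1 w2 w3 : seq nat) X Y1 Y2, S Y1 -> S Y2 -> f u <> None ->
  ~ site f [:: (w1, Some X); (w2, Some W); (w3, Some W)] [:: Some W; Some Y1; Some Y2] u.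

Definition inS x := if f x is Some a then S a else false.
Definition outS x := if f x is Some a then ~~ S a else false.
Definition isW x := f x == Some W.

Lemma measurable_color_pred (Q : pred C) : measurable [set x | Q (f x)].
Proof.
have [mf _] := Kf; rewrite (_ : [set _ | _] = \bigcup_(c in [set c | Q c]) [set x | f x = c]).
  by apply: fin_bigcup_measurable => [|c _]; [exact: finite_finset|exact: mf].
by apply/seteqP; split => x /=; [move=> Qx; exists (f x)|move=> [c Qc /= ->]].
Qed.

Lemma bnat_color_pred (Q : pred C) : bnat (fun x => Q (f x) : nat).
Proof. by apply: bnat_bool; exact: measurable_color_pred. Qed.

Lemma proper_ow p u : (forall x, x \in pos nu p u -> forall y, y \in nbrs x ->
    ow nu f p u x <> ow nu f p u y) -> proper nbrs (ow nu f p u).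
Proof.
move=> H; apply/(site_properP G _ _ Kf.2) => w wp i _ e; apply: contrapT => /eqP ne.
apply: (H (walk nu w u) _ _ (nu_nbrs G ne) e).
by case/mapP: wp => wc wcp ->; apply: map_f.
Qed.

(** Otherwise recolouring [z] alone with [b] is a transfer out of [S]. *)
Lemma sees_out z b : inS z -> ~~ S b -> exists2 y, y \in nbrs z & f y = Some b.
Proof.
rewrite /inS; case E : (f z) => [a|//] Sa Sb; apply: contrapT => H.
apply: (@no_transfer z [:: ([::], Some b)] [:: Some a] a b) => //.
- by move=> c; rewrite /net /= ![Some _ == c]eq_sym !addn0.
- by rewrite E.
split => //; last by rewrite /= E.
apply: proper_ow => x; rewrite /pos /= inE => /eqP-> y zy; rewrite eqxx.
case: eqP => [yz|_]; first by move: zy; rewrite yz (negPf (nbrs_irr G z)).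
by move=> e; apply: H; exists y.
Qed.

(** Otherwise [z] can take colour [b] and [w] colour [b']: a transfer from the colour of [z] to [b']
    in which [b] keeps its mass. *)
Lemma unique_sees z w b b' : inS z -> w \in nbrs z -> f w = Some b -> ~~ S b ->
  (forall y, y \in nbrs z -> f y = Some b -> y = w) -> ~~ S b' -> b' != b ->
  exists2 y, y \in nbrs w & f y = Some b'.
Proof.
rewrite /inS; case E : (f z) => [a|//] Sa zw fw Sb uw Sb' bb'; apply: contrapT => H.
have [i iw] := nbrs_nu G zw.
have wz : w != z by apply: contraTneq zw => ->; exact: (nbrs_irr G).
apply: (@no_transfer z [:: ([::], Some b); ([:: i], Some b')] [:: Some a; Some b] a b') => //.
- by move=> c; rewrite /net /= ![Some _ == c]eq_sym !addn0 !natrD; ring.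
- by rewrite E.
split; last 2 first.
- by rewrite /pos /= iw inE eq_sym wz.
- by rewrite /= iw E fw.
apply: proper_ow => x; rewrite /pos /= iw !inE => /orP[]/eqP-> y.
  rewrite eqxx => zy.
  have /negPf-> : y != z by apply: contraTneq zy => ->; exact: (nbrs_irr G).
  case: eqP => [_ [e]|yw e]; first by rewrite e eqxx in bb'.
  by apply: yw; exact: uw.
rewrite (negPf wz) eqxx => wy; case: eqP => [_ [e]|_]; first by rewrite e eqxx in bb'.
have /negPf-> : y != w by apply: contraTneq wy => ->; exact: (nbrs_irr G).
by move=> e; apply: H; exists y.
Qed.

(** If they were not adjacent, [z1] and [z2] could both take colour [W] and [w] a free colour [X],
    the pattern excluded by [no_triple]. *)
Lemma single_adjacent w z1 z2 : f w = Some W -> z1 \in nbrs w -> z2 \in nbrs w ->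
  inS z1 -> inS z2 -> (forall y, y \in nbrs z1 -> f y = Some W -> y = w) ->
  (forall y, y \in nbrs z2 -> f y = Some W -> y = w) -> z1 != z2 -> z2 \in nbrs z1.
Proof.
move=> fw wz1 wz2; rewrite /inS; case E1 : (f z1) => [Y1|//]; case E2 : (f z2) => [Y2|//].
move=> S1 S2 u1 u2 z12; apply/negPn/negP => nz.
have [i iz] := nbrs_nu G wz1; have [j jz] := nbrs_nu G wz2.
have w1 : z1 != w by apply: contraTneq wz1 => ->; exact: (nbrs_irr G).
have w2 : z2 != w by apply: contraTneq wz2 => ->; exact: (nbrs_irr G).
have YW a : S a -> Some W != Some a :> C.
  by move=> Sa; apply: contraNneq SW => -[->].
have [X [XW HX]] : exists X, X != W /\
    forall y, y \in nbrs w -> y != z1 -> y != z2 -> f y != Some X.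
  (* At most [D - 2] neighbours of [w] keep their colour, so some [X] other than [W] is free. *)
  pose s := rem z2 (rem z1 (nbrs w)).
  have us : uniq (rem z1 (nbrs w)) by rewrite rem_uniq// (nbrs_uniq G).
  have ss : (size (Some W :: map f s) < D)%N.
    have z2s : z2 \in rem z1 (nbrs w) by rewrite mem_rem_uniq ?(nbrs_uniq G)// inE eq_sym z12.
    have := nbrs_size D nu w; rewrite /= size_map /s size_rem// size_rem//.
    have : (0 < size (nbrs w))%N by case: (nbrs w) wz1.
    have : (0 < size (rem z1 (nbrs w)))%N by case: (rem z1 _) z2s.
    rewrite size_rem//; move: (size _) D0 => n; lia.
  have [X HX] : exists X : 'I_D, Some X \notin Some W :: map f s.
    apply: contrapT => nX; move: ss; apply/negP; rewrite -leqNgt.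
    have uD : uniq (map Some (enum 'I_D)) by rewrite map_inj_uniq ?enum_uniq//; exact: Some_inj.
    rewrite -[leqLHS](size_enum_ord) -(size_map Some); apply: uniq_leq_size => // _ /mapP[a _ ->].
    by apply: contrapT => /negP na; apply: nX; exists a.
  move: HX; rewrite inE negb_or => /andP[XW Xs]; exists X; split; first by apply: contraNneq XW => ->.
  move=> y wy y1 y2; apply: contraNneq Xs => <-; apply: map_f.
  by rewrite /s mem_rem_uniq// inE y2 /= mem_rem_uniq ?(nbrs_uniq G)// inE y1.
have XW' : Some X != Some W :> C by apply: contraNneq XW => -[->].
apply: (@no_triple w [::] [:: i] [:: j] X Y1 Y2) => //; first by rewrite fw.
split; last 2 first.
- by rewrite /pos /= iz jz !inE !negb_or ![w == _]eq_sym w1 w2 z12.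
- by rewrite /= iz jz fw E1 E2.
apply: proper_ow => x; rewrite /pos /= iz jz !inE => /or3P[]/eqP-> y.
- rewrite eqxx => wy.
  have /negPf-> : y != w by apply: contraTneq wy => ->; exact: (nbrs_irr G).
  case: eqP => [_|/eqP y1]; first exact/eqP.
  case: eqP => [_|/eqP y2]; first exact/eqP.
  by apply/eqP; rewrite eq_sym; exact: HX.
- rewrite (negPf w1) eqxx => zy; case: eqP => [_|yw]; first by apply/eqP; rewrite eq_sym.
  have /negPf-> : y != z1 by apply: contraTneq zy => ->; exact: (nbrs_irr G).
  have /negPf-> : y != z2 by apply: contraTneq zy => ->.
  by move=> e; apply: yw; exact: u1.
- rewrite (negPf w2) eq_sym (negPf z12) eqxx => zy; case: eqP => [_|yw]; first by apply/eqP; rewrite eq_sym.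
  have /negPf-> : y != z1 by apply: contraTneq zy => ->; rewrite (nbrs_sym G).
  have /negPf-> : y != z2 by apply: contraTneq zy => ->; exact: (nbrs_irr G).
  by move=> e; apply: yw; exact: u2.
Qed.

Local Notation c := #|S|.
Local Notation q := #|predC S|.

Lemma cq : (c + q = D)%N.
Proof. by rewrite cardC card_ord. Qed.

Lemma inS_outS x : ~~ (inS x && outS x).
Proof. by rewrite /inS /outS; case: (f x) => // a; rewrite andbN. Qed.

Lemma in_out_deg x : (count inS (nbrs x) + count outS (nbrs x) <= size (nbrs x))%N.
Proof.
elim: (nbrs x) => //= y s IH; have := inS_outS y.
move: (count inS s) (count outS s) (size s) IH => a b n.
by case: (inS y); case: (outS y) => //= le _; lia.
Qed.

Lemma count_colors (P : pred V) (T : pred 'I_D) (s : seq V) :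
  (forall b, T b -> exists2 y, y \in s & P y /\ f y = Some b) -> (#|T| <= count P s)%N.
Proof.
move=> HT; rewrite -size_filter -(size_map f) cardE -(size_map Some).
apply: uniq_leq_size; first by rewrite map_inj_uniq ?enum_uniq//; exact: Some_inj.
move=> x /mapP[b]; rewrite mem_enum => /HT[y ys [Py <-]] ->.
by apply: map_f; rewrite mem_filter Py.
Qed.

Lemma inS_count_out z : inS z -> (q <= count outS (nbrs z))%N.
Proof.
move=> Sz; apply: count_colors => b Sb; have [y yz fy] := sees_out Sz Sb.
by exists y => //; rewrite /outS fy.
Qed.

(* If [z] in [S] has a unique neighbour [w] of its colour, then [w] is rich; at least
   [2 q - D] of the [q] colours outside [S] occur exactly once around [z]. *)
Definition rich w := [&& outS w, (count inS (nbrs w) <= c.+1)%N & (q <= size (nbrs w))%N].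

(** By [unique_sees], [w] has at least [q - 1] neighbours coloured outside [S], besides [z]. This
    gives degree at least [q] and leaves room for at most [D - (q - 1) = c + 1] neighbours coloured
    in [S]. *)
Lemma unique_rich z w b : inS z -> w \in nbrs z -> f w = Some b -> ~~ S b ->
  (forall y, y \in nbrs z -> f y = Some b -> y = w) -> rich w.
Proof.
move=> Sz zw fw Sb uw; have ow_ : outS w by rewrite /outS fw.
have qb : q = #|predD1 (predC S) b|.+1 by rewrite (cardD1 b) inE /= Sb.
have le : (q <= (count outS (nbrs w)).+1)%N.
  rewrite qb ltnS; apply: count_colors => b' /andP[/= bb' Sb'].
  have [y wy fy] := unique_sees Sz zw fw Sb uw Sb' bb'.
  by exists y => //; rewrite /outS fy.
have in0 : (0 < count inS (nbrs w))%N.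
  by rewrite -has_count; apply/hasP; exists z => //; rewrite (nbrs_sym G).
have dw := nbrs_size D nu w; have io := in_out_deg w.
by rewrite /rich ow_ /=; have := cq; move: dw io le in0; clear; lia.
Qed.

(** Each of the [q] colours outside [S] has [n b >= 1], so [n b + (n b == 1) >= 2], while the [n b]
    sum to at most [D]. *)
Lemma inS_count_rich z : inS z -> (q + q <= count rich (nbrs z) + D)%N.
Proof.
move=> Sz; pose n b := count (fun y => f y == Some b) (nbrs z).
pose U : pred 'I_D := [pred b | ~~ S b & n b == 1%N].
have le1 : (\sum_(b | ~~ S b) n b <= D)%N.
  apply: leq_trans (nbrs_size D nu z); rewrite -sum1_size.
  under eq_bigr do rewrite /n -sum1_count big_mkcond.
  rewrite exchange_big /=; apply: leq_sum => y _.
  case E : (f y) => [a|]; last by rewrite big1.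
  have [Sa|Sa] := boolP (S a).
    by rewrite big1// => b Sb; case: eqP => // -[e]; rewrite -e Sa in Sb.
  rewrite (bigD1 a)//= eqxx big1// => b /andP[_ ba].
  by case: eqP => // -[e]; rewrite e eqxx in ba.
have le2 : (#|U| <= count rich (nbrs z))%N.
  apply: count_colors => b /andP[/= Sb /eqP nb].
  have [w zw fw] := sees_out Sz Sb; exists w => //; split => //.
  apply: (unique_rich Sz zw fw Sb) => y zy fy; apply/eqP/negPn/negP => yw.
  suff : (1 < n b)%N by rewrite nb.
  rewrite /n -size_filter; apply: (@uniq_leq_size _ [:: y; w]); first by rewrite /= inE yw.
  by move=> x; rewrite !inE mem_filter => /orP[]/eqP->; rewrite ?zw ?zy ?fw ?fy eqxx.
have le3 : (q + q <= \sum_(b | ~~ S b) n b + #|U|)%N.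
  have -> : #|U| = (\sum_(b | ~~ S b) (n b == 1))%N.
    by rewrite -sum1_card big_mkcondr /=; apply: eq_bigr => b _; case: (_ == _).
  rewrite -big_split /= -sum1_card -big_split /=; apply: leq_sum => b Sb.
  have : (0 < n b)%N.
    by have [w zw fw] := sees_out Sz Sb; rewrite -has_count; apply/hasP; exists w => //; apply/eqP.
  by case: (n b) => [|[|k]].
by move: le1 le2 le3; clear; lia.
Qed.

Definition single z := inS z && (count isW (nbrs z) == 1%N).

Lemma single_unique z w y : single z -> w \in nbrs z -> isW w -> y \in nbrs z -> isW y -> y = w.
Proof.
move=> /andP[_ /eqP c1] zw Ww zy Wy; apply/eqP/negPn/negP => yw.
suff : (1 < count isW (nbrs z))%N by rewrite c1.
rewrite -size_filter; apply: (@uniq_leq_size _ [:: y; w]); first by rewrite /= inE yw.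
by move=> x; rewrite !inE mem_filter => /orP[]/eqP->; rewrite ?zw ?zy ?Wy ?Ww.
Qed.

(** The single neighbours of [w] form a clique containing [z]; as neighbours of [z], the others
    count together with [w] in place of [z] itself. *)
Lemma single_degree z w : single z -> w \in nbrs z -> isW w ->
  (count single (nbrs w) <= size (nbrs z))%N.
Proof.
move=> sz zw Ww; rewrite -size_filter.
set s := seq.filter single (nbrs w).
have zs : z \in s by rewrite mem_filter sz (nbrs_sym G).
have us : uniq s by rewrite filter_uniq// (nbrs_uniq G).
have -> : size s = size (w :: rem z s) by rewrite /= size_rem// prednK//; case: (s) zs.
apply: uniq_leq_size.
  rewrite /= rem_uniq// andbT; apply: contra (nbrs_irr G w) => /mem_rem.
  by rewrite mem_filter => /andP[].
move=> y; rewrite inE => /orP[/eqP->//|]; rewrite mem_rem_uniq// inE => /andP[yz].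
rewrite mem_filter => /andP[sy wy].
have := zs; rewrite mem_filter => /andP[_ wz].
apply: (@single_adjacent w z y) => //; first exact/eqP.
- by case/andP: sz.
- by case/andP: sy.
- by move=> x zx fx; apply: (single_unique sz) => //; rewrite /isW fx.
- by move=> x yx fx; apply: (single_unique sy) => //; rewrite /isW ?fx// (nbrs_sym G).
- by rewrite eq_sym.
Qed.

(** [c'], [q'] and [D'] count the colours in [S], outside [S] and in all; [P], [T] and [Z] are the
    measures of the points coloured in [S], the rich points and the single points. *)
Lemma dense_bound (c' q' D' P T Z : R) : 1 <= c' -> 0 <= q' -> c' + q' = D' ->
  c' <= D' * P -> q' * P * 2 <= D' / 5 -> (q' + q') * P <= (c' + 1) * T + D' * P ->
  q' * (P + T) <= D' / 5 -> 2 * P <= 1 + Z -> 4 * D' * Z <= 4 * (D' / 5) + D' -> False.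
Proof.
move=> c1 q0 cqD cP h1 h2 h3 h4 h7.
have D1 : 1 <= D' by lra.
(* For [x = q' / D'] this reads [10 x (1 - x) <= 1]: [x] is below 0.113 or above 0.887. *)
have e1 : 10 * (q' * c') <= D' * D'.
  have := ler_wpM2l q0 cP; have := ler_wpM2l (le_trans ler01 D1) h1; nra.
(* [T] is eliminated between [q'] times [h2] and [c' + 1] times [h3]. *)
have e2 : q' * P * (q' + 1) * 5 <= (c' + 1) * D'.
  have := ler_wpM2l q0 h2; have := ler_wpM2l (_ : 0 <= c' + 1) h3; rewrite -cqD => H.
  have := H ltac:(lra); nra.
have e3 : 5 * (q' * q') <= 2 * (D' * D').
  have : c' * (q' * (q' + 1)) * 5 <= (c' + 1) * (D' * D').
    have qq : 0 <= q' * (q' + 1) by apply: mulr_ge0 => //; lra.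
    have := ler_wpM2l qq cP; have := ler_wpM2l (le_trans ler01 D1) e2; lra.
  have : (c' + 1) * (D' * D') <= 2 * c' * (D' * D') by apply: ler_wpM2r; [apply: mulr_ge0|]; lra.
  move=> H1 H2; have := le_trans H2 H1.
  rewrite -mulrA [2 * c']mulrC -[_ * 2 * _]mulrA ler_pM2l; last by lra.
  by rewrite mulrDr mulr1; lra.
(* By [e3], [x^2 <= 2/5 < 4/9], which excludes the upper range of [e1]. *)
have q23 : 3 * q' <= 2 * D'.
  by rewrite leNgt; apply/negP => lt; nra.
have q8 : 8 * q' <= D'.
  rewrite leNgt; apply/negP => lt.
  have : 0 <= (8 * q' - D') * (2 * D' - 3 * q') by apply: mulr_ge0; lra.
  have e1' : 10 * (q' * D') - 10 * (q' * q') <= D' * D' by rewrite -{1}cqD in e1 *; nra.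
  have : 0 < D' * (8 * q' - D') by apply: mulr_gt0; lra.
  by nra.
have P78 : 7 <= 8 * P.
  have : 7 * D' <= 8 * P * D' by lra.
  by rewrite ler_pM2r//; lra.
(* [h4] turns [P >= 7/8] into [Z >= 3/4], and [h7] would then give [3 D' <= 9/5 D']. *)
have : 3 * D' <= 4 * D' * Z by have := ler_wpM2l (le_trans ler01 D1) (_ : 3 / 4 <= Z); lra.
lra.
Qed.

Local Notation deg1 := (fun x => size (nbrs x)).

Lemma bnat_deg : bnat deg1.
Proof.
rewrite (_ : deg1 = nsum (fun=> 1%N)); first by apply: bnat_nsum; exact: bnat_cst.
by apply/funext => x; rewrite /nsum sum1_size.
Qed.

Lemma bnat_inS : bnat (fun x => inS x : nat).
Proof. exact: (bnat_color_pred (fun c => if c is Some a then S a else false)). Qed.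

Lemma bnat_outS : bnat (fun x => outS x : nat).
Proof. exact: (bnat_color_pred (fun c => if c is Some a then ~~ S a else false)). Qed.

Lemma bnat_isW : bnat (fun x => isW x : nat).
Proof. exact: (bnat_color_pred (fun c => c == Some W)). Qed.

Lemma bnat_rich : bnat (fun x => rich x : nat).
Proof.
rewrite (_ : (fun x => _) = fun x => (outS x *
    ((nsum (fun y => inS y : nat) x <= c.+1)%N * (q <= size (nbrs x))%N))%N).
  apply: (bnat2 muln bnat_outS); apply: (bnat2 muln).
    exact: (bnat2 (fun a _ => (a <= c.+1)%N : nat) (bnat_nsum bnat_inS) bnat_inS).
  exact: (bnat2 (fun a _ => (q <= a)%N : nat) bnat_deg bnat_inS).
by apply/funext => x; rewrite nsum_count !mulnb.
Qed.

Lemma bnat_single : bnat (fun x => single x : nat).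
Proof.
rewrite (_ : (fun x => _) = fun x => (inS x * (nsum (fun y => isW y : nat) x == 1))%N).
  apply: (bnat2 muln bnat_inS).
  exact: (bnat2 (fun a _ => (a == 1)%N : nat) (bnat_nsum bnat_isW) bnat_inS).
by apply/funext => x; rewrite nsum_count mulnb.
Qed.

Lemma expect_isW : expect (fun x => isW x : nat) = mass f (Some W).
Proof.
rewrite expect_bool; last exact: (measurable_color_pred (fun c => c == Some W)).
by congr (pr _); apply/seteqP; split => x /= /eqP.
Qed.

Lemma expect_inS : c%:R <= D%:R * expect (fun x => inS x : nat).
Proof.
have -> : (fun x => inS x : nat) = fun x => (\sum_(a <- enum S) (f x == Some a))%N.
  apply/funext => x; rewrite big_enum /inS; case: (f x) => [a|]; last by rewrite big1.
  have [Sa|Sa] := boolP (S a).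
    rewrite (bigD1 a)//= eqxx big1// => b /andP[_ ba].
    by case: eqP => // -[e]; rewrite e eqxx in ba.
  by rewrite big1// => b Sb; case: eqP => // -[e]; case/negP: Sa; rewrite e.
rewrite expect_sum => [|a]; last exact: (bnat_color_pred (fun c => c == Some a)).
have D0' : 0 < D%:R :> R by rewrite ltr0n.
rewrite mulrC -ler_pdivrMr// -sum1_card natr_sum mulr_suml -big_enum /= big_seq [leRHS]big_seq.
apply: ler_sum => a; rewrite mem_enum mul1r => Sa; apply: le_trans (SM Sa) _.
rewrite expect_bool; last exact: (measurable_color_pred (fun c => c == Some a)).
rewrite (_ : [set x | f x == Some a] = [set x | f x = Some a])//.
by apply/seteqP; split => x /= /eqP.
Qed.

Lemma sparse_contradiction : expect deg1 <= D%:R / 5 -> False.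
Proof.
move=> Edeg; have bM phi psi : bnat phi -> bnat psi -> bnat (fun x => phi x * psi x)%N.
  exact: bnat2.
have bD phi psi : bnat phi -> bnat psi -> bnat (fun x => phi x + psi x)%N by exact: bnat2.
have bK k phi : bnat phi -> bnat (fun x => k * phi x)%N by exact: (bM _ _ (bnat_cst _)).
have [bI bO bW] := And3 bnat_inS bnat_outS bnat_isW.
have [bR bZ bd] := And3 bnat_rich bnat_single bnat_deg.
have [nI nO nW] := And3 (bnat_nsum bI) (bnat_nsum bO) (bnat_nsum bW).
have [nR nZ] := conj (bnat_nsum bR) (bnat_nsum bZ).
set P := expect (fun x => inS x : nat); set T := expect (fun x => rich x : nat).
set Z := expect (fun x => single x : nat).
(* Edges between [S] and the colours outside are counted at both ends. *)
have h1 : q%:R * P * 2 <= D%:R / 5.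
  apply: le_trans Edeg.
  have le1 : q%:R * P <= expect (fun x => inS x * nsum (fun y => outS y : nat) x)%N.
    rewrite -expectM//; apply: expect_le; [exact: bK|exact: bM|] => x.
    rewrite nsum_count; case: (boolP (inS x)) => Sx; last by rewrite muln0.
    by rewrite muln1 mul1n inS_count_out.
  apply: (@le_trans _ _ (expect (fun x => inS x * nsum (fun y => outS y : nat) x)%N +
    expect (fun x => outS x * nsum (fun y => inS y : nat) x)%N)).
    by rewrite -(transport bI bO); lra.
  rewrite -expectD; [|exact: bM|exact: bM].
  apply: expect_le => [||x]; [by apply: (bD); exact: bM|by []|].
  rewrite !nsum_count; have := in_out_deg x; have := inS_outS x.
  by case: (inS x); case: (outS x) => //= _; clear; lia.
(* Edges from [S] to rich points, counted at the rich end by transport. *)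
have h2 : (q%:R + q%:R) * P <= (c%:R + 1) * T + D%:R * P.
  rewrite -natrD natr1 -expectM// -expectM//.
  apply: (@le_trans _ _ (expect (fun x => inS x * nsum (fun y => rich y : nat) x)%N + D%:R * P)).
    rewrite -expectM// -expectD; [|exact: bM|exact: bK].
    apply: expect_le => [||x]; [exact: bK|by apply: (bD); [exact: bM|exact: bK]|].
    rewrite nsum_count; case: (boolP (inS x)) => Sx; last by rewrite !muln0.
    by rewrite !muln1 mul1n inS_count_rich.
  rewrite lerD2r (transport bI bR); apply: expect_le => [||x]; [exact: bM|exact: bK|].
  rewrite nsum_count; case: (boolP (rich x)) => [/and3P[_ le _]|_]; last by rewrite muln0.
  by rewrite mul1n muln1.
(* Points coloured in [S] and rich points are disjoint, and both have degree at least [q]. *)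
have h3 : q%:R * (P + T) <= D%:R / 5.
  apply: le_trans Edeg; rewrite -expectD// -expectM; last exact: bD.
  apply: expect_le => [||x]; [by apply: (bK); exact: bD|by []|].
  case: (boolP (rich x)) => [/and3P[ox _ qx]|_].
    by have := inS_outS x; rewrite ox andbT => /negPf->; rewrite add0n muln1.
  rewrite addn0; case: (boolP (inS x)) => Sx; last by rewrite muln0.
  by rewrite muln1 (leq_trans (inS_count_out Sx))// count_size.
have D0' : 0 < D%:R :> R by rewrite ltr0n.
(* A point of [S] has two [W]-neighbours unless it is single; at the other end [W] has mass at most
   [1/D] and degree at most [D]. *)
have h4 : 2 * P <= 1 + Z.
  apply: (@le_trans _ _ (expect (fun x => inS x * nsum (fun y => isW y : nat) x)%N + Z)).
    rewrite -[2]/(2%:R) -expectM// -expectD//; last exact: bM.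
    apply: expect_le => [||x]; [exact: bK|by apply: (bD); [exact: bM|]|].
    rewrite nsum_count /single; case: (boolP (inS x)) => Sx //.
    have [y xy fy] := sees_out Sx SW.
    have : has isW (nbrs x) by apply/hasP; exists y => //; rewrite /isW fy.
    by rewrite has_count mul1n; case: (count _ _) => [|[|k]].
  rewrite lerD2r (transport bI bW); apply: (@le_trans _ _ (expect (fun x => D * isW x)%N)).
    apply: expect_le => [||x]; [exact: bM|exact: bK|].
    rewrite nsum_count mulnC leq_mul2r; apply/orP; right.
    by rewrite (leq_trans (count_size _ _))// nbrs_size.
  by rewrite expectM// expect_isW -ler_pdivlMl// mulr1.
pose K := nsum (fun x => single x : nat).
have bWK : bnat (fun x => isW x * K x)%N := bM _ _ bW nZ.
have bWKK : bnat (fun x => isW x * K x * K x)%N := bM _ _ bWK nZ.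
have bDW : bnat (fun x => D * isW x)%N := bK D _ bW.
have h5 : Z = expect (fun x => isW x * K x)%N.
  rewrite -(transport bZ bW); congr expect; apply/funext => x.
  rewrite nsum_count; case: (boolP (single x)) => [/andP[_ /eqP->]//|_].
  by rewrite mul0n.
(* A single point has degree at least [K w] for its only [W]-neighbour [w], and each such [w] has
   [K w] single neighbours: hence the square. *)
have h6 : expect (fun x => isW x * K x * K x)%N <= expect deg1.
  rewrite -(transport bZ (bM _ _ bW nZ)); apply: expect_le => [||x]; [|by []|].
    by apply: (bM) => //; apply: bnat_nsum; exact: bM.
  case: (boolP (single x)) => [sx|_] //; rewrite mul1n.
  have : has isW (nbrs x) by rewrite has_count; case/andP: sx => _ /eqP->.
  move=> /hasP[w xw Ww]; rewrite {1}/nsum (bigD1_seq w) ?(nbrs_uniq G)//= Ww mul1n.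
  rewrite [X in (_ + X)%N](_ : _ = 0%N) ?addn0; last first.
    rewrite big_seq_cond big1// => y /andP[xy yw]; case: (boolP (isW y)) => // Wy.
    by rewrite (single_unique sx xw Ww xy Wy) eqxx in yw.
  by rewrite nsum_count (single_degree sx xw Ww).
(* Averages [4 D k <= (2 k)^2 + D^2] over the points coloured [W]; their mass [1/D] at most turns
   [D^2] into [D]. *)
have h7 : 4 * D%:R * Z <= 4 * (D%:R / 5) + D%:R.
  apply: (@le_trans _ _ (4 * expect (fun x => isW x * K x * K x)%N +
    D%:R * (D%:R * expect (fun x => isW x : nat)))); last first.
    apply: lerD; first by rewrite ler_wpM2l// (le_trans h6).
    rewrite -[leRHS]mulr1 ler_wpM2l// expect_isW -ler_pdivlMl// mulr1; exact: WM.
  have -> : 4 * D%:R = (4 * D)%:R :> R by rewrite natrM.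
  rewrite h5 -[4]/(4%:R) -!expectM// -expectD; [|exact: bK|exact: bK].
  apply: expect_le => [||x]; [exact: bK|by apply: (bD); exact: bK|].
  move: (K x) => k; case: (isW x) => /=; last by rewrite !mul0n !muln0.
  rewrite !mul1n !muln1; have [+ _] := nat_Cauchy (2 * k) D.
  by rewrite -!mulnn; clear; nia.
have [a Sa] := S0.
have c1 : (0 < c)%N by apply/card_gt0P; exists a.
apply: (@dense_bound c%:R q%:R D%:R P T Z) => //.
- by rewrite ler1n.
- by rewrite -natrD cq.
- exact: expect_inS.
Qed.

End Counting.

(** * The equitable colouring *)

Lemma avg_degree_expect (d : measure_display) (V : measurableType d) (R : realType)
  (adj : V -> V -> Prop) (D : nat) (h : V -> R) (nu : nat -> V -> V) (mu : probability V R) :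
  borel_nbr adj D h nu -> (forall x, finite_set (nbhd adj x)) ->
  avg_degree adj mu = (expect mu (fun x => size (nbrs D nu x)))%:E.
Proof.
move=> G fin; rewrite -expectE; last exact: (bnat_deg G).
apply: eq_integral => x _; congr (_%:R)%:E; apply/eqP; rewrite eqn_leq; apply/andP; split.
  apply: uniq_leq_size; first exact: fset_uniq.
  by move=> y; rewrite in_fset_set ?inE//= => xy; apply/(mem_nbrs G).
by apply: size_le_deg => //; [exact: (nbrs_uniq G)|move=> y /(mem_nbrs G)].
Qed.

Theorem theorem1p9 (d : measure_display) (V : measurableType d)
  (R : realType) (adj : V -> V -> Prop) (Delta : nat)
  (mu : probability V R) :
  @standard_borel d V R ->
  borel_graph adj ->
  max_degree adj Delta ->
  (3 <= Delta)%N ->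
  ~ has_clique adj Delta.+1 ->
  atomless mu ->
  invariant_measure adj mu ->
  (avg_degree adj mu <= (Delta%:R / 5)%:E)%E ->
  exists f : V -> 'I_Delta, equitable_coloring adj mu f.
Proof.
move=> std bg [degD _] D3 noclique at0 invmu avg.
have [h [nu G]] := exists_borel_nbr std bg degD.
have D0 : (0 < Delta)%N by apply: leq_trans D3.
have [f0 [K0 N0]] := measurable_brooks G invmu D3 noclique.
have [f [[mf pf] Nf cl [eqf|]]] := equitable_or_split G invmu at0 D0 K0 N0; last first.
  move=> [S [W [S0 SW WM SM [H1 H2]]]]; exfalso.
  refine (sparse_contradiction G invmu D0 (conj mf pf) S0 SW WM SM H1 H2 _).
  by rewrite -lee_fin -(avg_degree_expect mu G (fun x => (degD x).1)).
have [k Hk] := brooks (nbrs_uniq G) (nbrs_sym G) (nbrs_irr G) (nbrs_size Delta nu) D3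
  (fun s => @nbrs_no_clique _ _ _ _ _ _ _ G noclique s).
(* By [cl] the uncoloured points fill whole components, so colours of [f] and of [k] never meet
   along an edge. *)
exists (fun x => if f x is Some a then a else k x); split.
  move=> x y /(mem_nbrs G) xy; have yx : x \in nbrs Delta nu y by rewrite (nbrs_sym G).
  case E : (f x) => [a|]; case F : (f y) => [b|].
  - by have := pf _ _ xy; rewrite E F => H; apply: contraPneq H => -> /(_ ltac:(by [])).
  - by have := cl _ _ xy F; rewrite E.
  - by have := cl _ _ yx E; rewrite F.
  - by apply/eqP; exact: Hk.
(* [k] need not be measurable: each class lies between a class of [f] and its union with the null
   uncoloured set. *)
move=> a; exists [set x | f x = Some a], ([set x | f x = Some a] `|` [set x | f x = None]).
split; first exact: mf.
split; first exact: measurableU.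
split; first by move=> x /= ->.
split; first by move=> x /=; case: (f x) => [b <-|]; [left|right].
split; last by rewrite -(eqf a) prE.
have mN := mf None; apply: (subset_measure0 _ mN).
- by apply: measurableD => //; exact: measurableU.
- by move=> x [[]].
- exact/(pr_eq0P mu mN).
Qed.
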